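(* Let $T\in F[d_x,d_y]$ be a linear partial differential operator of order $n$, and let $a_1\xi+a_2\eta$ ($a_1,a_2\in F$ not both zero) be a linear factor of multiplicity $m\ge 1$ of its symbol $\mathrm{symb}(T)\in F[\xi,\eta]$. Then: (1) The equation $T=0$ has a non-zero fractional-derivatives series solution $$H=\sum_{0\le i<\infty}h_iG^{(s_0-i/q)},\qquad G=G_{s_2,\dots,s_{k_0}}(f_1,\dots,f_{k_0}),$$ corresponding to this factor (that is, $a_1d_xf_1+a_2d_yf_1=0$ and $(d_xf_1,d_yf_1)\ne(0,0)$), with denominator $q\le m$. (2) Every branch of the tree of the construction procedure (described in the context) which produces $1>s_2>s_3>\cdots$ and $f_1,f_2,\dots$ starting from this factor can be continued to a fractional-derivatives series solution of $T=0$; and every fractional-derivatives series solution constructed by this procedure has denominator $q\le 2^{m-1}$.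
   Context: $F$ is a differentially closed (universal in the sense of Kolchin) differential field of characteristic $0$ with two commuting derivations $d_x,d_y$; $F[d_x,d_y]$ is the ring of linear partial differential operators over $F$. For $T=\sum_{i+j\le n}b_{i,j}d_x^id_y^j$ of order $n$, $\mathrm{symb}(T)=\sum_{i+j=n}b_{i,j}\xi^i\eta^j$ is a homogeneous polynomial in formal variables $\xi,\eta$ (standing for $d_xf_1,d_yf_1$). **Fractional-derivatives series.** Let $k_0\ge1$, let $1>s_2>\cdots>s_{k_0}>0$ be rational numbers and $f_1,\dots,f_{k_0}\in F$. The symbol $G=G^{(0)}=G_{s_2,\dots,s_{k_0}}(f_1,\dots,f_{k_0})$ comes with $F$-linearly independent formal symbols $\{G^{(s)}\}_{s\in\mathbb Q}$ (fractional derivatives) and the rule, for $d=d_x$ and $d=d_y$, $$dG^{(s)}=(df_1)G^{(1+s)}+(df_2)G^{(s_2+s)}+\cdots+(df_{k_0})G^{(s_{k_0}+s)}.$$ Let $q$ be the common denominator of $s_2,\dots,s_{k_0}$ ($q=1$ if $k_0=1$); it is called the denominator. A fractional-derivatives series is a formal series $H=\sum_{0\le i<\infty}h_iG^{(s_0-i/q)}$ with $h_i\in F$, $s_0q\in\mathbb Z$. Operators act termwise via the Leibniz rule and the rule above; $H$ is a solution of $T=0$ if $TH=0$. **The construction procedure.** Start: choose $f_1\in F$ with $a_1d_xf_1+a_2d_yf_1=0$, $(d_xf_1,d_yf_1)\neq(0,0)$, and put $s_1=1$. Suppose $f_1,\dots,f_k\in F$ and $1=s_1>s_2>\cdots>s_k>0$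 have been constructed ($k\ge1$). *Polygon $P_{k+1}$.* Let $h,\varphi$ be differential indeterminates over $F$ and $\sigma$ a formal exponent. Expand $T(hG)$ using $dG^{(s)}=\sum_{1\le i\le k}(df_i)G^{(s_i+s)}+(d\varphi)G^{(\sigma+s)}$, and write the result as $\sum_{(j,t)}C_{j,t}\,G^{(j+\sigma t)}$, where $j\in\mathbb Q_{\ge0}$, $t\in\mathbb Z_{\ge0}$, and $C_{j,t}$ is a differential polynomial in $h,\varphi$ over $F$, linear homogeneous in $h$ and its derivatives and homogeneous of degree $t$ in the derivatives of $\varphi$. $P_{k+1}$ is the convex hull of $(0,0)$ and all points $(j,t)$ with $C_{j,t}\ne0$. The slope of a line $\{j+ct=\mathrm{const}\}$ is $c$. *Continuing step.* Choose any edge $L_{k+1}$ of $P_{k+1}$ (a leading edge) whose slope $s_{k+1}$ satisfies $0<s_{k+1}<s_k$. Put $Q_{k+1}=\sum_{(j,t)\in L_{k+1}}C_{j,t}$; it has the form $h$ times a polynomial in $d_x\varphi,d_y\varphi$ with coefficients in $F$. Choose any $f_{k+1}\in F$ such that $Q_{k+1}$ vanishes at $\varphi=f_{k+1}$ (identically in $h$). *Terminal step.* If $P_{k+1}$ has a right-hand vertical edge (slope $0$, contained in the line $j=\max$), with lower endpoint $(j_5,0)$, one may stop: put $k_0=k$ and $\bar B=C_{j_5,0}$ (a non-zero linear differential operator applied to $h$), choose a non-zero $h_0\in F$ with $\bar B(h_0)=0$, and choose $h_1,h_2,\dots\in F$ successively from the equations $\bar B(h_i)=r_i$ (with $r_i\in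 F$ determined by the previous choices) obtained by equating to zero the coefficients of $T\bigl(\sum_{i\ge0}h_iG^{(-i/q)}\bigr)$. The resulting series is a solution constructed by the procedure. The various choices of edges and of solutions $f_{k}$ form the tree of the procedure; a branch is a sequence of such choices. *)

(* Defs.v *)
From HB Require Import structures.
From mathcomp Require Import all_boot all_order all_algebra.
From mathcomp Require Import finmap.
From mathcomp Require Export monalg.

Set Implicit Arguments.
Unset Strict Implicit.
Unset Printing Implicit Defensive.

Import Order.TTheory GRing.Theory Num.Theory.
Local Open Scope ring_scope.

Definition derivation (R : nzRingType) (d : R -> R) : Prop :=
  (forall x y, d (x + y) = d x + d y) /\
  (forall x y, d (x * y) = d x * y + x * d y).

Record diffField := DiffField {
  dfield :> fieldType;
  dx : dfield -> dfield;
  dy : dfield -> dfield;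
  dx_derivation : derivation dx;
  dy_derivation : derivation dy;
  dxdyC : forall z, dx (dy z) = dy (dx z)
}.
Arguments dx {_} _.
Arguments dy {_} _.

(* F{u_i, i in I}: polynomials in the variables (i, (a, b)), which stand for  *)
(* d_x^a d_y^b u_i.                                                           *)
Notation dvar I := (I * (nat * nat))%type.
Notation dpoly F I := {malg F[{cmonom (dvar I)}]}.

Definition indet (F : fieldType) (I : choiceType) (i : I) : dpoly F I :=
  << @ucm (dvar I : choiceType) (i, (0%N, 0%N)) >>.

(* The derivation of F{u} extending d : F -> F and mapping each variable v to *)
(* sh v: on a term c * m it is d(c) * m + sum_v c * (dm/dv) * sh v.           *)
Definition dpoly_der (F : fieldType) (I : choiceType) (d : F -> F)
    (sh : dvar I -> dvar I) (p : dpoly F I) : dpoly F I :=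
  \sum_(m <- msupp p)
    (<< d p@_m *g m >> +
     \sum_(v <- finsupp m)
        << p@_m *+ m v *g mulcm (divcm m (ucm v)) (ucm (sh v)) >>).

Definition shift_x (I : choiceType) (v : dvar I) : dvar I :=
  (v.1, (v.2.1.+1, v.2.2)).
Definition shift_y (I : choiceType) (v : dvar I) : dvar I :=
  (v.1, (v.2.1, v.2.2.+1)).

Definition pdx (F : diffField) (I : choiceType) : dpoly F I -> dpoly F I :=
  dpoly_der (@dx F) (@shift_x I).
Definition pdy (F : diffField) (I : choiceType) : dpoly F I -> dpoly F I :=
  dpoly_der (@dy F) (@shift_y I).

(* Value of p at u_i := z i in a ring R with operators Dx, Dy; the            *)
(* coefficients are sent to R by c.                                           *)
Definition deval (F : fieldType) (I : choiceType) (R : comNzRingType)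
    (c : F -> R) (Dx Dy : R -> R) (z : I -> R) (p : dpoly F I) : R :=
  mmap c (fun m : {cmonom (dvar I)} =>
    \prod_(v <- finsupp m) iter v.2.1 Dx (iter v.2.2 Dy (z v.1)) ^+ m v) p.

Definition diff_extension (F E : diffField) (iota : {rmorphism F -> E}) : Prop :=
  (forall a, iota (dx a) = dx (iota a)) /\
  (forall a, iota (dy a) = dy (iota a)).

Definition solvable_in (F E : diffField) (iota : F -> E) (N : nat)
    (eqs neqs : seq (dpoly F 'I_N)) : Prop :=
  exists z : 'I_N -> E,
    (forall p, p \in eqs -> deval iota dx dy z p = 0) /\
    (forall p, p \in neqs -> deval iota dx dy z p <> 0).

(* Every finite system of algebraic differential equations and inequations    *)
(* over F which is solvable in some differential field extension of F is      *)
(* solvable in F. Kolchin's universal differential fields have this property. *)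
Definition diff_closed (F : diffField) : Prop :=
  forall (N : nat) (eqs neqs : seq (dpoly F 'I_N)),
    (exists (E : diffField) (iota : {rmorphism F -> E}),
       diff_extension iota /\ solvable_in iota eqs neqs) ->
    solvable_in (@idfun F) eqs neqs.

(* F[d_x, d_y], an operator being given by its normal form: the coefficient   *)
(* of T at the monomial m is that of d_x^(m 0) d_y^(m 1). Only the additive   *)
(* structure is that of F[d_x, d_y]; the product of {malg _} is the product   *)
(* of symbols, in the variables symb_x = xi and symb_y = eta.                 *)
Notation ldo F := {malg F[{cmonom 'I_2}]}.

Definition symb_x (F : fieldType) : {malg F[{cmonom 'I_2}]} :=
  << @ucm 'I_2 ord0 >>.
Definition symb_y (F : fieldType) : {malg F[{cmonom 'I_2}]} :=
  << @ucm 'I_2 ord_max >>.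

Definition has_order (F : fieldType) (T : ldo F) (n : nat) : Prop :=
  msize T = n.+1.

Definition symb (F : fieldType) (T : ldo F) : {malg F[{cmonom 'I_2}]} :=
  \sum_(m <- msupp T | (mdeg m).+1 == msize T) << T@_m *g m >>.

Definition factor_mult (R : comNzRingType) (l : R) (m : nat) (p : R) : Prop :=
  (exists r, p = l ^+ m * r) /\ ~ (exists r, p = l ^+ m.+1 * r).

(* A formal sum sum_e H(e) G^(e) with coefficients in R and exponents in E is *)
(* the function H. The list g of pairs (e_i, g_i) encodes the rule            *)
(*    d G^(e) = sum_i d(g_i) G^(e_i + e),                                     *)
(* and gder is the induced derivation of formal sums.                         *)
Definition gder (E : zmodType) (R : nzRingType) (g : seq (E * R)) (d : R -> R)
    (H : E -> R) : E -> R :=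
  fun e => d (H e) + \sum_(p <- g) d p.2 * H (e - p.1).

Definition ldo_act (F : fieldType) (E : zmodType) (R : nzRingType) (c : F -> R)
    (Dx Dy : R -> R) (g : seq (E * R)) (T : ldo F) (H : E -> R) : E -> R :=
  fun e => \sum_(m <- msupp T)
    c T@_m * iter (m ord0) (gder g Dx) (iter (m ord_max) (gder g Dy) H) e.

(* G_{s_2,...,s_k}(f_1,...,f_k) is the list (1, f_1), (s_2, f_2), ..., (s_k, f_k). *)
Definition frac_symbol (F : fieldType) (g : seq (rat * F)) : Prop :=
  [/\ head 0 (unzip1 g) = 1,
      sorted (fun s t : rat => t < s) (unzip1 g) &
      all (fun s : rat => 0 < s) (unzip1 g)].

Definition denominator (F : fieldType) (g : seq (rat * F)) : nat :=
  \big[lcmn/1%N]_(p <- g) `|denq p.1|%N.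

(* sum_(i >= 0) h_i G^(s0 - i/q) *)
Definition fseries (F : fieldType) (s0 : rat) (q : nat) (h : nat -> F) :
    rat -> F :=
  fun s => let i := (s0 - s) * q%:R in
    if i \is a Num.nat then h (Num.truncn i) else 0.

Definition series_act (F : diffField) (T : ldo F) (g : seq (rat * F))
    (H : rat -> F) : rat -> F :=
  ldo_act idfun dx dy g T H.

Definition is_solution (F : diffField) (T : ldo F) (g : seq (rat * F))
    (H : rat -> F) : Prop :=
  forall s, series_act T g H s = 0.

Definition starts (F : diffField) (a1 a2 f1 : F) : Prop :=
  a1 * dx f1 + a2 * dy f1 = 0 /\ (dx f1, dy f1) <> (0, 0).

Definition hdet (F : fieldType) : dpoly F 'I_2 := indet F (ord0 : 'I_2).
Definition phidet (F : fieldType) : dpoly F 'I_2 := indet F (ord_max : 'I_2).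

(* C_{j,t}. The exponent j + sigma t, with sigma formal, is the pair (j, t).  *)
Definition Ccoef (F : diffField) (T : ldo F) (g : seq (rat * F))
    (j : rat) (t : nat) : dpoly F 'I_2 :=
  ldo_act (malgC : F -> dpoly F 'I_2) (@pdx F _) (@pdy F _)
    (rcons [seq ((p.1, 0 : int), (malgC p.2 : dpoly F 'I_2)) | p <- g]
           ((0, 1), phidet F))
    T (fun e => if e == (0, 0) then hdet F else 0) (j, t%:Z).

Definition convex_hull (A : rat * rat -> Prop) (p : rat * rat) : Prop :=
  exists r : seq (rat * (rat * rat)),
    [/\ forall w, w \in r -> 0 <= w.1 /\ A w.2,
        \sum_(w <- r) w.1 = 1,
        \sum_(w <- r) w.1 * w.2.1 = p.1 &
        \sum_(w <- r) w.1 * w.2.2 = p.2].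

Definition polygon (F : diffField) (T : ldo F) (g : seq (rat * F)) :
    rat * rat -> Prop :=
  convex_hull (fun p => p = (0, 0) \/
    exists (j : rat) (t : nat), p = (j, t%:R) /\ Ccoef T g j t <> 0).

(* The line j + c t = kappa contains an edge of the convex set P. *)
Definition is_edge (P : rat * rat -> Prop) (c kappa : rat) : Prop :=
  ((forall p, P p -> p.1 + c * p.2 <= kappa) \/
   (forall p, P p -> kappa <= p.1 + c * p.2)) /\
  (exists p p', [/\ P p, P p', p <> p', p.1 + c * p.2 = kappa &
                    p'.1 + c * p'.2 = kappa]).

(* Sum of C_{j,t} over the line j + c t = kappa; if this is the line of an    *)
(* edge L, then each (j,t) on it with C_{j,t} <> 0 lies on L, and C_{j,t} = 0 *)
(* when t exceeds the order of T.                                             *)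
Definition edge_sum (F : diffField) (T : ldo F) (g : seq (rat * F))
    (c kappa : rat) : dpoly F 'I_2 :=
  \sum_(t < msize T) Ccoef T g (kappa - c * t%:R) t.

(* p vanishes at phi = f, identically in the indeterminate h. *)
Definition vanishes_at_phi (F : diffField) (p : dpoly F 'I_2) (f : F) : Prop :=
  deval (malgC : F -> dpoly F 'I_2) (@pdx F _) (@pdy F _)
    (fun i => if i == ord0 then hdet F else malgC f) p = 0.

Inductive branch (F : diffField) (T : ldo F) (a1 a2 : F) :
    seq (rat * F) -> Prop :=
| BranchStart f1 : starts a1 a2 f1 -> branch T a1 a2 [:: (1, f1)]
| BranchStep g c kappa f :
    branch T a1 a2 g ->
    is_edge (polygon T g) c kappa ->
    0 < c < (last (1, 0) g).1 ->
    vanishes_at_phi (edge_sum T g c kappa) f ->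
    branch T a1 a2 (rcons g (c, f)).

(* The right-hand vertical edge lies on j = kappa and has lower endpoint      *)
(* (kappa, 0).                                                                *)
Definition right_edge (P : rat * rat -> Prop) (kappa : rat) : Prop :=
  [/\ is_edge P 0 kappa, forall p, P p -> p.1 <= kappa & P (kappa, 0)].

(* C_{j,0} as a linear operator applied to h; phi does not occur in C_{j,0},  *)
(* so the value given to it is irrelevant.                                    *)
Definition Bbar (F : diffField) (T : ldo F) (g : seq (rat * F)) (j : rat)
    (h : F) : F :=
  deval idfun dx dy (fun i : 'I_2 => if i == ord0 then h else 0) (Ccoef T g j 0).

(* The terminal step at j5. The coefficient of G^(j5 - i/q) in T applied to   *)
(* the series is Bbar(h_i) - r_i.                                             *)
Definition terminal_step (F : diffField) (T : ldo F) (g : seq (rat * F))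
    (j5 : rat) (h : nat -> F) : Prop :=
  let q := denominator g in
  [/\ right_edge (polygon T g) j5, h 0%N <> 0, Bbar T g j5 (h 0%N) = 0 &
      forall i : nat, series_act T g (fseries 0 q h) (j5 - i%:R / q%:R) = 0].

(* Main.v *)
Require Import Defs.
From HB Require Import structures.
From mathcomp Require Import all_boot all_order all_algebra.
From mathcomp Require Import fieldext.
From mathcomp Require Import finmap boolp functions.
From mathcomp Require Import fraction generic_quotient ring lra zify.

Set Implicit Arguments.
Unset Strict Implicit.
Unset Printing Implicit Defensive.

Import Order.TTheory GRing.Theory Num.Theory.
Local Open Scope ring_scope.

(* Write [G^(s)] as [z^s exp (Phi)]. Conjugating [T] by [exp (Phi)] gives a       *)
(* polynomial in [zeta = z^(1/N)], [d_x] and [d_y] ([Dop] below), and every       *)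
(* object of the construction is read off it: [C_(j,t)] for the largest [t] is    *)
(* the part of order [t] of the coefficient of [zeta^(Nj)], and [C_(j,0)] is      *)
(* this coefficient itself. Adjoining a slope [c] and a function [f] conjugates   *)
(* by one more exponential; on the part of maximal weight [j + c t] this is the   *)
(* translation of [(xi, eta)] by [grad f]. Hence the ordinate [e] of the lower    *)
(* end of the face of slope [s_k] is an order of vanishing: it is at most [m] at  *)
(* the start, and positive since the edge polynomial vanishes at [grad f]. The    *)
(* ordinates on an edge are congruent modulo the factor [r] by which the          *)
(* denominator grows, and an Euler-operator argument bounds the order of such a   *)
(* polynomial at a point by [t + x] when its degrees are among [t, t + r, ...,    *)
(* t + r x]. So [q 2^e] does not increase, nor does [q e] when the edge starts    *)
(* on the axis [t = 0]; this gives [q <= 2^(m-1)] and [q <= m]. Since [q] is      *)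
(* bounded, the slopes lie in a discrete set and every branch ends.               *)
(* The equations for [f_k] and [h_i] are solved formally, degree by degree, in    *)
(* the fraction field of the ring of power series in two variables; closedness    *)
(* of [F] then yields solutions in [F].                                           *)

(** The whole argument follows one number: the ordinate [e] of the lower end of the face of slope
    [s_k] ([lower_end]). It is also the order of vanishing of an edge polynomial at [grad f_k]
    ([wtop_Dop_rcons], [lower_end_intro]). At the start this polynomial is the symbol of [T], so
    that [e] is at most the multiplicity [m] ([form_order], [start_lower_end]).

    If an edge multiplies the denominator by [r], the degrees of its polynomial differ by multiples
    of [r], and a polynomial with few degrees cannot vanish to high order ([order_le_degrees]). The
    two inequalities of [step_lower_end] follow. The one for [q 2^e] holds at every step and, as [e]
    is positive, bounds [q] on all branches ([branch_denominator]). The one for [q e] holds for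
    edges that start on the axis. By [extend], a branch can either stop or go on along such an edge,
    and repeating this gives a solution with [q <= m] ([continue]).

    Existence of the [f_k] and [h_i] comes from [formal_solve], which solves in power series, and
    [closed_solve], which brings solutions back to [F]. Three cases are used: [solve_gradient],
    [solve_linear] and [solve_homogeneous]. [terminal_solution] assembles the series. *)

(** * Monomials and their evaluation *)

(* Locked: unification would otherwise unfold the finitely supported function. *)
HB.lock Definition mon (I : choiceType) (R : nzRingType) (m : {cmonom I}) :
  {malg R[{cmonom I}]} := << m >>.
Arguments mon {I R} m.

Section Mon.
Variables (I : choiceType) (R : nzRingType).

Lemma monE (m : {cmonom I}) : mon m = << m >> :> {malg R[{cmonom I}]}.
Proof. by rewrite unlock. Qed.

Lemma malgUE (c : R) (m : {cmonom I}) : << c *g m >> = c *: mon m.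
Proof.
by rewrite monE -mul_malgC malgM_def fgmulUU mulr1 [mmul _ _]mul1m.
Qed.

Lemma mon1 : mon (onecm I) = 1 :> {malg R[{cmonom I}]}.
Proof. by rewrite monE. Qed.

Lemma monM (k l : {cmonom I}) : mon (mulcm k l) = mon k * mon l :> {malg R[{cmonom I}]}.
Proof. by rewrite !monE malgM_def fgmulUU mulr1. Qed.

Lemma malgCE (c : R) : c%:MP = c *: 1 :> {malg R[{cmonom I}]}.
Proof. by rewrite -mul_malgC mulr1. Qed.

Lemma malg_sum (p : {malg R[{cmonom I}]}) : p = \sum_(m <- msupp p) p@_m *: mon m.
Proof. by rewrite {1}(monalgE p); apply: eq_bigr => m _; rewrite malgUE. Qed.

Lemma malg_ind (P : {malg R[{cmonom I}]} -> Prop) :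
  P 0 -> (forall p q, P p -> P q -> P (p + q)) ->
  (forall a m, P (a *: mon m)) -> forall p, P p.
Proof.
move=> P0 PD PU p; rewrite (malg_sum p).
by elim: (enum_fset _) => [|k s IH]; rewrite ?big_nil ?big_cons //; apply: PD.
Qed.
End Mon.

Section CmEval.
Variables (I : choiceType) (R : comNzRingType).

Definition cm_prod (z : I -> R) (m : {cmonom I}) : R :=
  \prod_(v <- finsupp m) z v ^+ m v.

Lemma cm_prodEw z (m : {cmonom I}) (d : {fset I}) : (finsupp m `<=` d)%fset ->
  cm_prod z m = \prod_(v <- d) z v ^+ m v.
Proof.
move=> sd; rewrite /cm_prod; apply/(big_fset_incl _ sd) => v _ vm.
by rewrite (fsfun_dflt vm) expr0.
Qed.

Lemma cm_prod_mmorphism z : mmorphism (cm_prod z).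
Proof.
split=> [x y|]; last by rewrite /cm_prod mdom1 big_seq_fset0.
rewrite (cm_prodEw z (d := finsupp x `|` finsupp y)%fset) ?mdomD //.
rewrite (cm_prodEw z (fsubsetUl (finsupp x) (finsupp y))).
rewrite (cm_prodEw z (fsubsetUr (finsupp x) (finsupp y))).
by rewrite -big_split; apply: eq_bigr => v _; rewrite cmM exprD.
Qed.

HB.instance Definition _ z :=
  monalg.isMultiplicative.Build {cmonom I} R (cm_prod z) (cm_prod_mmorphism z).

Lemma cm_prodU z v : cm_prod z (ucm v) = z v.
Proof. by rewrite /cm_prod mdomU big_seq_fset1 cmUU expr1. Qed.

Variables (F : comNzRingType).

Definition cm_eval (c : F -> R) (z : I -> R) : {malg F[{cmonom I}]} -> R :=
  mmap c (cm_prod z).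

HB.instance Definition _ (c : {rmorphism F -> R}) z :=
  GRing.RMorphism.copy (cm_eval c z) (mmap c (cm_prod z)).

Lemma cm_eval_mon (c : {rmorphism F -> R}) z m : cm_eval c z (mon m) = cm_prod z m.
Proof. by rewrite monE /cm_eval mmapU /= rmorph1 mul1r. Qed.

Lemma cm_evalV (c : {rmorphism F -> R}) z v : cm_eval c z (mon (ucm v)) = z v.
Proof. by rewrite cm_eval_mon cm_prodU. Qed.

Lemma cm_evalC (c : {rmorphism F -> R}) z a : cm_eval c z a%:MP = c a.
Proof. exact: mmapC. Qed.

Lemma cm_evalZ (c : {rmorphism F -> R}) z a p : cm_eval c z (a *: p) = c a * cm_eval c z p.
Proof. exact: mmapZ. Qed.

End CmEval.

Section CmonomInd.
Variables (I : choiceType).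

Lemma cmonom_split (v : I) (m : {cmonom I}) : v \in finsupp m ->
  m = mulcm (ucm v) (divcm m (ucm v)).
Proof.
move=> vm; apply/eqP/cmP => i; rewrite mulcmE divcmE ucmE.
case: eqP => [<-|_]; last by rewrite subn0.
by rewrite subnKC // lt0n cmE_neq0.
Qed.

Lemma cmonom_ind (P : {cmonom I} -> Prop) :
  P (onecm I) -> (forall v m, P m -> P (mulcm (ucm v) m)) -> forall m, P m.
Proof.
move=> P1 PS m; move: {2}(mdeg m) (leqnn (mdeg m)) => n.
elim: n m => [|n IH] m; first by rewrite leqn0 mdeg_eq0 => /eqP ->.
have [/eqP m0 _|] := boolP (finsupp m == fset0).
  rewrite (_ : m = onecm I) //; apply/eqP/cmP => i; rewrite onecmE.
  by rewrite fsfun_dflt // m0.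
case/fset0Pn => v vm; rewrite {1}(cmonom_split vm) mdegM mdegU => dm.
by rewrite (cmonom_split vm); apply: PS; apply: IH.
Qed.

Lemma malg_cmonom_ind (R : comNzRingType) (P : {malg R[{cmonom I}]} -> Prop) :
  (forall p q, P p -> P q -> P (p + q)) -> (forall a, P a%:MP) ->
  (forall v p, P p -> P (mon (ucm v) * p)) -> forall p, P p.
Proof.
move=> PD PC PM; apply: malg_ind => [||a m] //; first by rewrite -malgC0E.
elim/cmonom_ind: m => [|v m IH]; first by rewrite mon1 -malgCE.
by rewrite monM scalerAr; apply: PM.
Qed.
End CmonomInd.

(** * Derivations of polynomial rings *)

Section Derivation.
Variables (R : nzRingType) (d : R -> R).
Hypothesis dd : derivation d.

Lemma derD x y : d (x + y) = d x + d y. Proof. by case: dd. Qed.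
Lemma derM x y : d (x * y) = d x * y + x * d y. Proof. by case: dd. Qed.
Lemma der0 : d 0 = 0.
Proof. by apply: (addrI (d 0)); rewrite -derD !addr0. Qed.
Lemma derN x : d (- x) = - d x.
Proof. by apply: (addrI (d x)); rewrite -derD !subrr der0. Qed.
Lemma der1 : d 1 = 0.
Proof.
by apply: (addrI (d 1)); rewrite addr0 -{3}(mulr1 1) derM mul1r mulr1.
Qed.
Lemma der_sum (J : Type) (r : seq J) (P : pred J) (E : J -> R) :
  d (\sum_(i <- r | P i) E i) = \sum_(i <- r | P i) d (E i).
Proof. exact: (big_morph d derD der0). Qed.
End Derivation.

Lemma semilinear_addr (R : nzRingType) (V : lmodType R) (D : V -> V) (c c' : R) p q :
  (forall p q, D (p + q) = D p + D q) ->
  D (c *: p) = c' *: p + c *: D p -> D (c *: q) = c' *: q + c *: D q ->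
  D (c *: (p + q)) = c' *: (p + q) + c *: D (p + q).
Proof.
by move=> DD Dp Dq; rewrite scalerDr !DD Dp Dq !scalerDr addrACA.
Qed.

Lemma semilinear_scale (R : nzRingType) (V : lmodType R) (d : R -> R) (D : V -> V) M N c a :
  derivation d -> (forall c, D (c *: M) = d c *: M + c *: N) ->
  D (c *: (a *: M)) = d c *: (a *: M) + c *: D (a *: M).
Proof.
by move=> dd DM; rewrite scalerA !DM derM // scalerDl scalerDr !scalerA addrA.
Qed.

Lemma leibniz_mon (R : comNzRingType) (A : comAlgType R) (d : R -> R) (D : A -> A) (x x' p : A) c :
  (forall p, D (c *: p) = d c *: p + c *: D p) ->
  D (x * p) = x' * p + x * D p -> D (x * (c *: p)) = x' * (c *: p) + x * D (c *: p).
Proof.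
move=> Dc Dp; rewrite -scalerAr !Dc Dp !scalerDr mulrDr -!scalerAr.
by rewrite addrCA.
Qed.

Lemma leibniz_addr (R : comNzRingType) (D : R -> R) (x x' p q : R) :
  (forall p q, D (p + q) = D p + D q) ->
  D (x * p) = x' * p + x * D p -> D (x * q) = x' * q + x * D q ->
  D (x * (p + q)) = x' * (p + q) + x * D (p + q).
Proof. by move=> DD Dp Dq; rewrite mulrDr !DD Dp Dq !mulrDr addrACA. Qed.

Lemma leibniz_addl (R : comNzRingType) (D : R -> R) (x y q : R) :
  (forall p q, D (p + q) = D p + D q) ->
  D (x * q) = D x * q + x * D q -> D (y * q) = D y * q + y * D q ->
  D ((x + y) * q) = D (x + y) * q + (x + y) * D q.
Proof. by move=> DD Dp Dq; rewrite mulrDl !DD Dp Dq !mulrDl addrACA. Qed.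

Lemma leibniz_mull (R : comNzRingType) (D : R -> R) (x x' p q : R) :
  (forall p, D (x * p) = x' * p + x * D p) ->
  D (p * q) = D p * q + p * D q ->
  D (x * p * q) = D (x * p) * q + x * p * D q.
Proof.
by move=> Dx Dpq; rewrite -mulrA !Dx Dpq !mulrDl !mulrDr -!mulrA !addrA.
Qed.

Lemma leibniz_comm (R : comNzRingType) (D E : R -> R) (x xD xE xDE p : R) :
  (forall p q, D (p + q) = D p + D q) -> (forall p q, E (p + q) = E p + E q) ->
  (forall p, D (x * p) = xD * p + x * D p) ->
  (forall p, E (x * p) = xE * p + x * E p) ->
  (forall p, D (xE * p) = xDE * p + xE * D p) ->
  (forall p, E (xD * p) = xDE * p + xD * E p) ->
  D (E p) = E (D p) -> D (E (x * p)) = E (D (x * p)).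
Proof.
move=> DD ED Dx Ex DxE ExD DE; rewrite Ex Dx DD ED Dx Ex DxE ExD DE !addrA.
by congr (_ + _); rewrite -!addrA; congr (_ + _); rewrite addrC.
Qed.

Lemma divcm_mulK (V : choiceType) (v : V) (m : {cmonom V}) :
  divcm (mulcm (ucm v) m) (ucm v) = m.
Proof. by apply/eqP/cmP => i; rewrite divcmE !mulcmE addKn. Qed.

Lemma divcm_mulA (V : choiceType) (v w : V) (m : {cmonom V}) : (0 < m w)%N ->
  divcm (mulcm (ucm v) m) (ucm w) = mulcm (ucm v) (divcm m (ucm w)).
Proof.
move=> mw; apply/eqP/cmP => i; rewrite divcmE !mulcmE divcmE !ucmE.
by case: (w =P i) => [<-|_]; rewrite ?subn0 // addnBA.
Qed.

(** The body of [dpoly_der] over an arbitrary set of variables, locked against unfolding; [pdxE] and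
    [pdyE] identify the two. *)
HB.lock Definition malg_der (F : nzRingType) (V : choiceType) (d : F -> F)
    (sh : V -> V) (p : {malg F[{cmonom V}]}) : {malg F[{cmonom V}]} :=
  \sum_(m <- msupp p)
    (<< d p@_m *g m >> +
     \sum_(v <- finsupp m)
        << p@_m *+ m v *g mulcm (divcm m (ucm v)) (ucm (sh v)) >>).

Section MalgDer.
Variables (F : comNzRingType) (V : choiceType) (d : F -> F) (sh : V -> V).
Hypothesis dd : derivation d.

Local Notation D := (malg_der d sh).

Definition malg_der_term (m : {cmonom V}) (c : F) : {malg F[{cmonom V}]} :=
  << d c *g m >> +
  \sum_(v <- finsupp m) << c *+ m v *g mulcm (divcm m (ucm v)) (ucm (sh v)) >>.

Lemma malg_der_termD m : {morph malg_der_term m : x y / x + y}.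
Proof.
move=> x y; rewrite /malg_der_term derD // monalgUD addrACA -big_split /=.
by congr (_ + _); apply: eq_bigr => v _; rewrite mulrnDl monalgUD.
Qed.

Lemma malg_der_term0 m : malg_der_term m 0 = 0.
Proof. by apply: (addrI (malg_der_term m 0)); rewrite -malg_der_termD !addr0. Qed.

Lemma malg_derEw (p : {malg F[{cmonom V}]}) (s : {fset {cmonom V}}) :
  (msupp p `<=` s)%fset -> D p = \sum_(m <- s) malg_der_term m p@_m.
Proof.
move=> sub; rewrite unlock; apply/(big_fset_incl _ sub) => m _ /mcoeff_outdom ->.
exact: malg_der_term0.
Qed.

Lemma malg_derD (p q : {malg F[{cmonom V}]}) : D (p + q) = D p + D q.
Proof.
pose s := (msupp p `|` msupp q)%fset.
rewrite (@malg_derEw _ s) ?msuppD_le // (@malg_derEw p s) ?fsubsetUl //.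
rewrite (@malg_derEw q s) ?fsubsetUr // -big_split /=.
by apply: eq_bigr => m _; rewrite mcoeffD malg_der_termD.
Qed.

Lemma malg_der0 : D 0 = 0.
Proof. by apply: (addrI (D 0)); rewrite -malg_derD !addr0. Qed.

Lemma malg_derU c m : D << c *g m >> = malg_der_term m c.
Proof. by rewrite (malg_derEw msuppU_le) big_seq_fset1 mcoeffUU. Qed.

Lemma malg_derC c : D c%:MP = (d c)%:MP.
Proof. by rewrite malg_derU /malg_der_term mdom1 big_seq_fset0 addr0. Qed.

Lemma malg_derZ_mon c m : D (c *: mon m) =
  d c *: mon m + c *: \sum_(v <- finsupp m)
    (mon (divcm m (ucm v)) * mon (ucm (sh v))) *+ m v.
Proof.
rewrite -malgUE malg_derU /malg_der_term malgUE scaler_sumr; congr (_ + _).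
by apply: eq_bigr => v _; rewrite malgUE -scalerMnl monM scalerMnr.
Qed.

Lemma malg_der_mon m : D (mon m) = \sum_(v <- finsupp m)
    (mon (divcm m (ucm v)) * mon (ucm (sh v))) *+ m v.
Proof. by have := malg_derZ_mon 1 m; rewrite der1 // scale0r add0r !scale1r. Qed.

Lemma malg_derZ c p : D (c *: p) = d c *: p + c *: D p.
Proof.
elim/malg_ind: p => [|p q|a m].
- by rewrite !scaler0 malg_der0 scaler0 addr0.
- exact/semilinear_addr/malg_derD.
- exact: semilinear_scale dd (fun c => malg_derZ_mon c m).
Qed.

(** The Leibniz rule for a single variable as left factor; [malg_derM] follows by induction on the
    left factor. *)
Lemma malg_der_var v p :
  D (mon (ucm v) * p) = mon (ucm (sh v)) * p + mon (ucm v) * D p.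
Proof.
elim/malg_ind: p => [|p q|c m].
- by rewrite !mulr0 malg_der0 mulr0 addr0.
- exact/leibniz_addr/malg_derD.
apply: leibniz_mon (malg_derZ c) _; rewrite -monM.
rewrite malg_der_mon malg_der_mon mulr_sumr.
(* All three sums are extended to the variables of [v m]. The exponent of [w] there is
   [(v == w) + m w], and its two summands give the two sides of the Leibniz rule. *)
have sm : (finsupp m `<=` finsupp (mulcm (ucm v) m))%fset.
  by rewrite mdomD fsubsetUr.
have sv : ([fset v] `<=` finsupp (mulcm (ucm v) m))%fset.
  by rewrite mdomD mdomU fsubsetUl.
rewrite [X in _ = _ + X](big_fset_incl _ sm) /=; last first.
  by move=> w _ wm; rewrite (fsfun_dflt wm) mulr0n mulr0.
have -> : mon (ucm (sh v)) * mon m = \sum_(w <- finsupp (mulcm (ucm v) m))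
    (mon (ucm (sh w)) * mon m) *+ (v == w) :> {malg F[{cmonom V}]}.
  rewrite -(big_fset_incl _ sv) /= ?big_seq_fset1 ?eqxx // => w _.
  by rewrite inE eq_sym => /negbTE ->; rewrite mulr0n.
rewrite -big_split; apply: eq_bigr => w _ /=.
rewrite mulcmE ucmE; set A := _ * _; set B := _ * mon m; set C := mon (divcm m _) * _.
have AB : v == w -> A = B.
  by move=> /eqP vw; rewrite /A /B -vw mulrC divcm_mulK.
have AC : (0 < m w)%N -> A = mon (ucm v) * C.
  by move=> mw; rewrite /A /C mulrA -(monM _ (ucm v)) divcm_mulA.
move: (mon (ucm v)) A B C AB AC => x A B C AB AC; rewrite mulrnDr mulrnAr.
congr (_ + _); first by case: eqP AB => [_ -> //|_ _]; rewrite !mulr0n.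
by case: (m w) AC => [|k ->]; rewrite ?mulr0n.
Qed.

Lemma malg_derM p q : D (p * q) = D p * q + p * D q.
Proof.
elim/malg_cmonom_ind: p q => [p1 p2 IH1 IH2|a|v p IH] q.
- exact: leibniz_addl malg_derD _ _.
- have eqs (x x' y s s' u : {malg F[{cmonom V}]}) : x * y = s -> x' * y = s' ->
    x * D y = u -> D s = s' + u -> D (x * y) = x' * y + x * D y.
    by move=> -> -> -> ->.
  rewrite malg_derC.
  exact: eqs (mul_malgC _ _) (mul_malgC _ _) (mul_malgC _ _) (malg_derZ a q).
- exact: leibniz_mull (malg_der_var v) (IH q).
Qed.

Lemma malg_der_derivation : derivation D.
Proof. by split; [exact: malg_derD | exact: malg_derM]. Qed.

Lemma malg_derV v : D (mon (ucm v)) = mon (ucm (sh v)).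
Proof.
rewrite -[mon (ucm v)]mulr1 malg_der_var (der1 malg_der_derivation).
by rewrite mulr0 addr0 mulr1.
Qed.
End MalgDer.

Lemma malg_der_comm (F : comNzRingType) (V : choiceType) (d1 d2 : F -> F)
    (sh1 sh2 : V -> V) :
  derivation d1 -> derivation d2 -> (forall x, d1 (d2 x) = d2 (d1 x)) ->
  (forall v, sh1 (sh2 v) = sh2 (sh1 v)) -> forall p : {malg F[{cmonom V}]},
  malg_der d1 sh1 (malg_der d2 sh2 p) = malg_der d2 sh2 (malg_der d1 sh1 p).
Proof.
move=> dd1 dd2 dC shC p; elim/malg_cmonom_ind: p => [p q IHp IHq|a|v p IH].
- by rewrite !malg_derD // IHp IHq.
- apply: (etrans (congr1 _ (malg_derC sh2 dd2 a))).
  apply: (etrans (malg_derC sh1 dd1 _)); rewrite dC.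
  by apply: esym; apply: (etrans (congr1 _ (malg_derC sh1 dd1 a))); apply: malg_derC.
- have E2 q : malg_der d2 sh2 (mon (ucm (sh1 v)) * q) =
      mon (ucm (sh1 (sh2 v))) * q + mon (ucm (sh1 v)) * malg_der d2 sh2 q.
    by rewrite shC; apply: malg_der_var.
  exact: (leibniz_comm (malg_derD sh1 dd1) (malg_derD sh2 dd2)
    (malg_der_var sh1 dd1 v) (malg_der_var sh2 dd2 v)
    (malg_der_var sh1 dd1 (sh2 v)) E2 IH).
Qed.

Section Pd.
Variables (F : diffField) (I : choiceType).
Local Notation P := (dpoly F I).

Lemma pdxE : @pdx F I = malg_der (@dx F) (@shift_x I).
Proof. by rewrite unlock. Qed.

Lemma pdyE : @pdy F I = malg_der (@dy F) (@shift_y I).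
Proof. by rewrite unlock. Qed.

Lemma pdx_derivation : derivation (@pdx F I).
Proof. rewrite pdxE; exact/malg_der_derivation/dx_derivation. Qed.

Lemma pdy_derivation : derivation (@pdy F I).
Proof. rewrite pdyE; exact/malg_der_derivation/dy_derivation. Qed.

Lemma pdxC a : pdx a%:MP = (dx a)%:MP :> P.
Proof. rewrite pdxE; exact/malg_derC/dx_derivation. Qed.

Lemma pdyC a : pdy a%:MP = (dy a)%:MP :> P.
Proof. rewrite pdyE; exact/malg_derC/dy_derivation. Qed.

Lemma pdxdyC (p : P) : pdx (pdy p) = pdy (pdx p).
Proof.
rewrite pdxE pdyE; exact: (malg_der_comm (dx_derivation F) (dy_derivation F) (@dxdyC F)).
Qed.

Lemma iter_pd_indet (i : I) a b :
  iter a (@pdx F I) (iter b (@pdy F I) (indet F i)) = mon (ucm (i, (a, b))).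
Proof.
have -> : indet F i = mon (ucm (i, (0, 0)%N)) by rewrite monE.
elim: a => [|a IH] /=; last by rewrite IH pdxE (malg_derV _ (dx_derivation F)).
by elim: b => [|b IH] //=; rewrite IH pdyE (malg_derV _ (dy_derivation F)).
Qed.
End Pd.

(** * Hurwitz series *)

(* Hurwitz series: the double sequence [a] stands for the power series        *)
(* sum_(i, j) a i j X^i Y^j / (i! j!), so that the derivations are shifts.    *)
Definition hseries (K : Type) : Type := nat -> nat -> K.

Section HseriesRing.
Variable K : comNzRingType.
Local Notation H := (hseries K).
Implicit Types a b c : H.

HB.instance Definition _ := GRing.Zmodule.copy H (nat -> nat -> K).

Definition hdx a : H := fun i j => a i.+1 j.
Definition hdy a : H := fun i j => a i j.+1.

(** The product is defined by the Leibniz rule rather than by binomial coefficients: each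
    coefficient is a derivative at the origin. Thus [hdx_mul] holds by definition, and the ring laws
    follow by induction on the two indices ([hmulr_ind]). *)
Fixpoint hmul0 j a b : K :=
  if j is j'.+1 then hmul0 j' (hdy a) b + hmul0 j' a (hdy b) else a 0%N 0%N * b 0%N 0%N.

Fixpoint hmulr i j a b : K :=
  if i is i'.+1 then hmulr i' j (hdx a) b + hmulr i' j a (hdx b) else hmul0 j a b.

Definition hmul a b : H := fun i j => hmulr i j a b.
Definition hone : H := fun i j => ((i == 0%N) && (j == 0%N))%:R.

Lemma hseriesP a b : (forall i j, a i j = b i j) -> a = b.
Proof. by move=> ab; apply/funext => i; apply/funext => j. Qed.

Lemma haddE a b i j : (a + b) i j = a i j + b i j. Proof. by []. Qed.
Lemma hoppE a i j : (- a) i j = - a i j. Proof. by []. Qed.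
Lemma hmulSy i j a b : hmulr i j.+1 a b = hmulr i j (hdy a) b + hmulr i j a (hdy b).
Proof. by elim: i a b => [|i IH] a b //=; rewrite !IH addrACA. Qed.

Lemma hmulr_ind (P : nat -> nat -> Prop) : P 0%N 0%N ->
  (forall j, P 0%N j -> P 0%N j.+1) -> (forall i j, P i j -> P i.+1 j) -> forall i j, P i j.
Proof. by move=> P0 Py Px; elim=> [|i IH] j; [elim: j => // j; apply: Py | apply: Px]. Qed.

Lemma hmulrDl i j a b c : hmulr i j (a + b) c = hmulr i j a c + hmulr i j b c.
Proof.
move: i j a b c; apply: hmulr_ind => [a b c|j IH a b c|i j IH a b c].
- by rewrite /= haddE mulrDl.
- by rewrite !hmulSy !IH addrACA.
- by rewrite /= !IH addrACA.
Qed.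

Lemma hmulrC i j a b : hmulr i j a b = hmulr i j b a.
Proof.
move: i j a b; apply: hmulr_ind => [a b|j IH a b|i j IH a b].
- exact: mulrC.
- by rewrite !hmulSy IH addrC [X in X + _]IH.
- by rewrite /= IH addrC [X in X + _]IH.
Qed.

Lemma hmulrDr i j a b c : hmulr i j a (b + c) = hmulr i j a b + hmulr i j a c.
Proof. by rewrite hmulrC hmulrDl ![hmulr i j _ a]hmulrC. Qed.

Lemma hdx_mul a b : hdx (hmul a b) = hmul (hdx a) b + hmul a (hdx b).
Proof. by []. Qed.

Lemma hdy_mul a b : hdy (hmul a b) = hmul (hdy a) b + hmul a (hdy b).
Proof. by apply: hseriesP => i j; rewrite /hdy /hmul hmulSy. Qed.

Lemma hmulA : associative hmul.
Proof.
move=> a b c; apply: hseriesP => i j; rewrite {1 3}/hmul.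
move: i j a b c; apply: hmulr_ind => [a b c|j IH a b c|i j IH a b c].
- exact: mulrA.
- by rewrite !hmulSy !hdy_mul hmulrDl hmulrDr !IH addrA.
- by rewrite /= !hdx_mul hmulrDl hmulrDr !IH addrA.
Qed.

Lemma hmulC : commutative hmul.
Proof. by move=> a b; apply: hseriesP => i j; apply: hmulrC. Qed.

Lemma hmulDl : left_distributive hmul +%R.
Proof. by move=> a b c; apply: hseriesP => i j; apply: hmulrDl. Qed.

Lemma hmulr0l i j b : hmulr i j 0 b = 0.
Proof.
move: i j b; apply: hmulr_ind => [b|j IH b|i j IH b]; first exact: mul0r.
- by rewrite hmulSy !IH addr0.
- by rewrite /= !IH addr0.
Qed.

Lemma hmul1 : left_id hone hmul.
Proof.
move=> a; apply: hseriesP => i j; rewrite /hmul.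
move: i j a; apply: hmulr_ind => [a|j IH a|i j IH a]; first exact: mul1r.
- have h0 : hdy hone = 0 by apply: hseriesP => k l; rewrite /hdy /hone andbF.
  by rewrite hmulSy h0 hmulr0l add0r IH.
- have h0 : hdx hone = 0 by apply: hseriesP => k l.
  by rewrite /= h0 hmulr0l add0r IH.
Qed.

Lemma hone_neq0 : hone != 0.
Proof.
apply/eqP => /(congr1 (fun a : H => a 0%N 0%N)) /eqP.
by rewrite /hone /= oner_eq0.
Qed.

HB.instance Definition _ := GRing.Zmodule_isComNzRing.Build H
  hmulA hmulC hmul1 hmulDl hone_neq0.

Lemma hmulE a b i j : (a * b) i j = hmulr i j a b. Proof. by []. Qed.

Lemma hdx_derivation : derivation hdx.
Proof. by split=> [a b|a b]; [|exact: hdx_mul]. Qed.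

Lemma hdy_derivation : derivation hdy.
Proof. by split=> [a b|a b]; [|exact: hdy_mul]. Qed.

Lemma hdxyC a : hdx (hdy a) = hdy (hdx a). Proof. by []. Qed.

Lemma iter_hd a p q i j : iter p hdx (iter q hdy a) i j = a (i + p)%N (j + q)%N.
Proof.
elim: p i => [|p IH] i /=; last by rewrite /hdx IH addSnnS.
rewrite addn0; elim: q j => [|q IH] j /=; first by rewrite addn0.
by rewrite /hdy IH addSnnS.
Qed.

Definition vanish (d : nat) a := forall i j, (i + j < d)%N -> a i j = 0.

Lemma vanishW d d' a : (d' <= d)%N -> vanish d a -> vanish d' a.
Proof. by move=> dd h i j ij; apply: h; apply: leq_trans dd. Qed.

Lemma vanishD d a b : vanish d a -> vanish d b -> vanish d (a + b).
Proof. by move=> ha hb i j ij; rewrite haddE ha ?hb ?addr0. Qed.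

Lemma vanish_dx d a : vanish d.+1 a -> vanish d (hdx a).
Proof. by move=> h i j ij; apply: h. Qed.

Lemma vanish_dy d a : vanish d.+1 a -> vanish d (hdy a).
Proof. by move=> h i j ij; apply: h; rewrite addnS. Qed.

(** In the lowest degree a product sees only the value of [a] at the origin. This is what reduces
    equations to constant coefficients in the formal constructions below. *)
Lemma hmul_vanish d a b i j : vanish d b -> (i + j <= d)%N ->
  (a * b) i j = a 0%N 0%N * b i j.
Proof.
rewrite hmulE; move: i j d a b; apply: hmulr_ind => [d a b|j IH d a b|i j IH d a b] // h ij.
- rewrite hmulSy add0n in ij *; case: d h ij => [//|d] h ij.
  rewrite (IH d.+1 _ _ h (ltnW ij)) h // mulr0 add0r.
  by rewrite (IH d _ _ (vanish_dy h) ij).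
- rewrite /= addSn in ij *; case: d h ij => [//|d] h ij.
  rewrite (IH d.+1 _ _ h (ltnW ij)) h // mulr0 add0r.
  by rewrite (IH d _ _ (vanish_dx h) ij).
Qed.
End HseriesRing.

(** * Hurwitz series over a field of characteristic 0 form a domain *)

Section LeadingTerm.
Variables (K : nmodType) (T : Type) (d : T -> T) (mu : nat -> T -> T -> K) (Z : T -> Prop).
Hypotheses (muS : forall n a b, mu n.+1 a b = mu n (d a) b + mu n a (d b))
  (mu0l : forall a b, Z a -> mu 0 a b = 0) (mu0r : forall a b, Z b -> mu 0 a b = 0).

Let ord (k : nat) (a : T) := forall i, (i < k)%N -> Z (iter i d a).

Let ord_d k a : ord k.+1 a -> ord k (d a).
Proof. by move=> h i ik; rewrite -iterSr; apply: h. Qed.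

Let ord0 a : ord 0 a. Proof. by []. Qed.

Lemma mu_lt n k l a b : ord k a -> ord l b -> (n < k + l)%N -> mu n a b = 0.
Proof.
elim: n k l a b => [|n IH] k l a b ha hb.
  by case: k l ha hb => [|k] [|l] // ha hb _; [apply/mu0r/(hb 0%N)|apply/mu0l/(ha 0%N)..].
move=> nkl; rewrite muS.
have -> : mu n (d a) b = 0.
  case: k ha nkl => [|k] ha nkl; first by apply: (IH 0%N l) => //; apply: ltnW.
  by apply: (IH k l) => //; exact: ord_d.
have -> : mu n a (d b) = 0; last by rewrite addr0.
case: l hb nkl => [|l] hb nkl; first by apply: (IH k 0%N) => //; apply: ltnW.
by apply: (IH k l) => //; [exact: ord_d | rewrite addnS in nkl].
Qed.

(** By Leibniz, the leading coefficient of a product is a binomial multiple of the product of the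
    leading coefficients; only the positivity of this integer is kept. *)
Lemma mu_lead k l a b : ord k a -> ord l b -> exists2 c, (0 < c)%N &
  mu (k + l) a b = mu 0 (iter k d a) (iter l d b) *+ c.
Proof.
move: {2}(k + l)%N (erefl (k + l)%N) => n; elim: n k l a b => [|n IH] k l a b.
  by move/eqP; rewrite addn_eq0 => /andP[/eqP -> /eqP ->] _ _; exists 1%N.
case: k => [|k].
  rewrite add0n => -> ha hb; rewrite muS (@mu_lt n 0 n.+1 (d a) b) // add0r.
  by have [c c0 ->] := IH 0%N n a (d b) (add0n _) ha (ord_d hb); exists c => //; rewrite -iterSr.
rewrite addSn => -[kl] ha hb; rewrite muS.
have [c c0 ->] := IH k l (d a) b kl (ord_d ha) hb.
case: l kl hb => [|l] kl hb; last rewrite addnS in kl.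
  rewrite (@mu_lt (k + 0) k.+1 0 a (d b)) ?addn0 // addr0.
  by exists c => //; rewrite -iterSr.
have [c' c'0] := IH k.+1 l a (d b) kl ha (ord_d hb).
rewrite addSnnS => ->; exists (c + c')%N; first by rewrite addn_gt0 c0.
by rewrite -!iterSr mulrnDr.
Qed.
End LeadingTerm.

Section Domain.
Variable K : fieldType.
Hypothesis ch0 : [pchar K] =i pred0.
Local Notation H := (hseries K).

Let iter_hdx k (a : H) i j : iter k (@hdx K) a i j = a (i + k)%N j.
Proof. by have := iter_hd a k 0 i j; rewrite addn0. Qed.

Let iter_hdy k (a : H) i j : iter k (@hdy K) a i j = a i (j + k)%N.
Proof. by have := iter_hd a 0 k i j; rewrite addn0. Qed.

(** Take the lexicographically first non-zero coefficients of [a] and of [b]. At the sum of their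
    indices, the coefficient of [a * b] is a positive integer times their product, hence non-zero in
    characteristic 0. *)
Lemma hseries_mulf_eq0 (a b : H) : a * b = 0 -> (a == 0) || (b == 0).
Proof.
move=> ab; apply: contrapT => /negP; rewrite negb_or => /andP[/eqP a0 /eqP b0].
have first_row (x : H) : x <> 0 -> exists i j,
    [/\ forall i' j', (i' < i)%N -> x i' j' = 0,
        forall j', (j' < j)%N -> x i j' = 0 & x i j != 0].
  move=> x0; have ex : exists i, `[< exists j, x i j != 0 >].
    apply: contrapT => nex; apply: x0; apply: hseriesP => i j; apply/eqP.
    by apply: contrapT => /negP xij; apply: nex; exists i; apply/asboolP; exists j.
  have [i /asboolP exj imin] := ex_minnP ex; have [j xij jmin] := ex_minnP exj.
  exists i, j; split=> // [i' j' i'i|j' j'j]; apply/eqP.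
    by apply: contraTT i'i => x'; rewrite -leqNgt; apply: imin; apply/asboolP; exists j'.
  by apply: contraTT j'j => x'; rewrite -leqNgt; apply: jmin.
have [i1 [j1 [ra ca a1]]] := first_row _ a0; have [i2 [j2 [rb cb b2]]] := first_row _ b0.
pose a' := iter i1 (@hdx K) a; pose b' := iter i2 (@hdx K) b.
have row0 (x y : H) : (forall j, x 0%N j = 0) -> forall j, hmulr 0 j x y = 0.
  move=> x0 j; elim: j x y x0 => [|j IH] x y x0; first by rewrite /= x0 mul0r.
  by rewrite hmulSy !IH ?addr0 // => k; apply: x0.
(* The leading-term argument is run in [x] on whole rows, then in [y] on the coefficients of the
   first non-zero rows. *)
have [c c0 E1] : exists2 c, (0 < c)%N &
    hmulr (i1 + i2) (j1 + j2) a b = hmulr 0 (j1 + j2) a' b' *+ c.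
  apply: (mu_lead (mu := fun i => hmulr i (j1 + j2)) (Z := fun x => forall j, x 0%N j = 0)).
  - by [].
  - by move=> x y x0; apply: row0.
  - by move=> x y y0; rewrite hmulrC; apply: row0.
  - by move=> i ii j; rewrite /= iter_hdx add0n; apply: ra.
  - by move=> i ii j; rewrite /= iter_hdx add0n; apply: rb.
have [c' c'0 E2] : exists2 c, (0 < c)%N &
    hmulr 0 (j1 + j2) a' b' = hmulr 0 0 (iter j1 (@hdy K) a') (iter j2 (@hdy K) b') *+ c.
  apply: (mu_lead (mu := hmulr 0) (Z := fun x => x 0%N 0%N = 0)).
  - by move=> n x y; apply: hmulSy.
  - by move=> x y /= ->; rewrite mul0r.
  - by move=> x y /= ->; rewrite mulr0.
  - by move=> i ii; rewrite /= iter_hdy /a' iter_hdx !add0n; apply: ca.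
  - by move=> i ii; rewrite /= iter_hdy /b' iter_hdx !add0n; apply: cb.
have /eqP := congr1 (fun x : H => x (i1 + i2)%N (j1 + j2)%N) ab.
rewrite hmulE E1 E2 /= !iter_hdy /a' /b' !iter_hdx !add0n -mulrnA -mulr_natr !mulf_eq0.
rewrite (negbTE a1) (negbTE b2) /=; move/pcharf0P: ch0 => ->.
by rewrite eqn0Ngt muln_gt0 c0 c'0.
Qed.
End Domain.

Section HseriesField.
Variables (K : fieldType) (ch0 : [pchar K] =i pred0).

(** The hypothesis on the characteristic is an argument of the type, so that the integral domain
    structure can be attached to it. *)
Definition hdomain (_ : [pchar K] =i pred0) : Type := hseries K.
Local Notation D := (hdomain ch0).

HB.instance Definition _ := GRing.ComNzRing.copy D (hseries K).

Definition hunit (a : D) : bool := `[< exists b : D, b * a = 1 >].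
Definition hinv (a : D) : D := if pselect (exists b : D, b * a = 1) is left e then sval (cid e) else a.

Lemma hmulVr : {in hunit, left_inverse 1 hinv *%R}.
Proof. by move=> a /asboolP e; rewrite /hinv; case: pselect => // e'; case: cid. Qed.

Lemma hunitPl (a b : D) : b * a = 1 -> hunit a.
Proof. by move=> e; apply/asboolP; exists b. Qed.

Lemma hinv_out : {in [predC hunit], hinv =1 id}.
Proof.
by move=> a; rewrite inE => /asboolPn ne; rewrite /hinv; case: pselect.
Qed.

HB.instance Definition _ := GRing.ComNzRing_hasMulInverse.Build D hmulVr hunitPl hinv_out.

HB.instance Definition _ := GRing.ComUnitRing_isIntegral.Build D (hseries_mulf_eq0 ch0).

End HseriesField.

(** * The field of fractions of Hurwitz series *)

(** The quotient rule does not depend on the fraction chosen to represent an element. *)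
Lemma quotient_rule_eq (R : comNzRingType) (p q p' q' dp dq dp' dq' : R) :
  p * q' = p' * q -> dp * q' + p * dq' = dp' * q + p' * dq ->
  (dp' * q' - p' * dq') * q ^+ 2 = (dp * q - p * dq) * q' ^+ 2.
Proof.
move=> pq dpq; apply/eqP; rewrite -subr_eq0; apply/eqP.
transitivity (q * q' * (dp' * q + p' * dq - (dp * q' + p * dq')) +
  (p * q' - p' * q) * (q * dq' + q' * dq)); first by ring.
by rewrite dpq pq !subrr mulr0 mul0r addr0.
Qed.

Lemma quotient_rule_add (E : fieldType) (P P' Q Q' dP dP' dQ dQ' : E) : Q != 0 -> Q' != 0 ->
  ((dP * Q' + P * dQ' + (dP' * Q + P' * dQ)) * (Q * Q') +
    - ((P * Q' + P' * Q) * (dQ * Q' + Q * dQ'))) / (Q * Q') ^+ 2 =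
  (dP * Q + - (P * dQ)) / Q ^+ 2 + (dP' * Q' + - (P' * dQ')) / Q' ^+ 2.
Proof. by move=> Q0 Q'0; field; rewrite Q0 Q'0. Qed.

Lemma quotient_rule_mul (E : fieldType) (P P' Q Q' dP dP' dQ dQ' : E) : Q != 0 -> Q' != 0 ->
  ((dP * P' + P * dP') * (Q * Q') + - (P * P' * (dQ * Q' + Q * dQ'))) / (Q * Q') ^+ 2 =
  (dP * Q + - (P * dQ)) / Q ^+ 2 * (P' / Q') + P / Q * ((dP' * Q' + - (P' * dQ')) / Q' ^+ 2).
Proof. by move=> Q0 Q'0; field; rewrite Q0 Q'0. Qed.

Local Notation "x %:F" := (FracField.tofrac x).

Section FracDer.
Variable R : idomainType.
Local Notation E := {fraction R}.
Local Notation tofrac := (@FracField.tofrac R).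

Lemma fraction_ex (x : E) : exists nd : R * R, nd.2 != 0 /\ x = nd.1%:F / nd.2%:F.
Proof.
elim/quotW: x => r; exists (frac r); split; first exact: denom_ratioP.
have d0 : (\d_r)%:F != 0 by rewrite tofrac_eq0 denom_ratioP.
apply: (mulIf d0); rewrite mulfVK //; unlock FracField.tofrac.
rewrite -[LHS]FracField.pi_mul; apply/eqmodP; rewrite /= FracField.equivfE /FracField.mulf.
by rewrite !numden_Ratio ?mulf_neq0 ?denom_ratioP ?oner_neq0 // !mulr1 mulrC.
Qed.

Definition num_den (x : E) : R * R := sval (cid (fraction_ex x)).

Lemma num_denP x : (num_den x).2 != 0 /\ x = (num_den x).1%:F / (num_den x).2%:F.
Proof. exact: (svalP (cid (fraction_ex x))). Qed.

Variable d : R -> R.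
Hypothesis dd : derivation d.

Definition frac_der (x : E) : E :=
  let: (p, q) := num_den x in (d p * q - p * d q)%:F / q%:F ^+ 2.

Lemma frac_derE p q : q != 0 -> frac_der (p%:F / q%:F) = (d p * q - p * d q)%:F / q%:F ^+ 2.
Proof.
rewrite /frac_der; have [] := num_denP (p%:F / q%:F).
case: (num_den _) => p' q' /= q'0 e q0.
have Q0 : q%:F != 0 by rewrite tofrac_eq0.
have Q'0 : q'%:F != 0 by rewrite tofrac_eq0.
have pq : p * q' = p' * q.
  by move/eqP: e; rewrite eqr_div // -!rmorphM tofrac_eq => /eqP.
have dpq : d p * q' + p * d q' = d p' * q + p' * d q by rewrite -!(derM dd) pq.
apply/eqP; rewrite eqr_div ?expf_neq0 // -!rmorphXn -!rmorphM tofrac_eq.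
exact/eqP/quotient_rule_eq.
Qed.

Lemma frac_derF p : frac_der p%:F = (d p)%:F.
Proof.
have := frac_derE p (oner_neq0 R); rewrite (der1 dd) mulr0 subr0 mulr1.
by rewrite rmorph1 expr1n !divr1.
Qed.

Lemma frac_derD x y : frac_der (x + y) = frac_der x + frac_der y.
Proof.
have [[p q] /= [q0 ->]] := fraction_ex x; have [[p' q'] /= [q'0 ->]] := fraction_ex y.
have Q0 : q%:F != 0 by rewrite tofrac_eq0.
have Q'0 : q'%:F != 0 by rewrite tofrac_eq0.
rewrite addf_div // -!rmorphM -rmorphD !frac_derE ?mulf_neq0 //.
rewrite (derD dd) !(derM dd) !(rmorphM, rmorphD, rmorphN) /=.
exact: quotient_rule_add.
Qed.

Lemma frac_derM x y : frac_der (x * y) = frac_der x * y + x * frac_der y.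
Proof.
have [[p q] /= [q0 ->]] := fraction_ex x; have [[p' q'] /= [q'0 ->]] := fraction_ex y.
have Q0 : q%:F != 0 by rewrite tofrac_eq0.
have Q'0 : q'%:F != 0 by rewrite tofrac_eq0.
rewrite mulf_div -!rmorphM !frac_derE ?mulf_neq0 //.
rewrite !(derM dd) !(rmorphM, rmorphD, rmorphN) /=.
exact: quotient_rule_mul.
Qed.

Lemma frac_der_derivation : derivation frac_der.
Proof. by split; [exact: frac_derD | exact: frac_derM]. Qed.
End FracDer.

Lemma frac_der_comm (R : idomainType) (d e : R -> R) : derivation d -> derivation e ->
  (forall x, d (e x) = e (d x)) ->
  forall x : {fraction R}, frac_der d (frac_der e x) = frac_der e (frac_der d x).
Proof.
move=> dd de deC x; have [[p q] /= [q0 ->]] := fraction_ex x.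
rewrite (frac_derE de) // (frac_derE dd) // -!rmorphXn.
rewrite (frac_derE dd) ?expf_neq0 // (frac_derE de) ?expf_neq0 //.
congr (_%:F / _); rewrite !expr2 (derD dd) (derD de) (derN dd) (derN de).
rewrite !(derM dd) !(derM de) !deC.
move: (d p) (d q) (e p) (e q) (e (d p)) (e (d q)) => dp dq ep eq edp edq.
by ring.
Qed.

Section HurwitzField.
Variables (K : fieldType) (ch0 : [pchar K] =i pred0).
Local Notation D := (hdomain ch0).

Let ddx : @derivation D (@hdx K) := @hdx_derivation K.
Let ddy : @derivation D (@hdy K) := @hdy_derivation K.

(** The differential field extension in which all systems are first solved, before [diff_closed] is
    applied. *)
Definition hfield : diffField :=
  @DiffField {fraction D} (frac_der (@hdx K : D -> D)) (frac_der (@hdy K : D -> D))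
    (frac_der_derivation ddx) (frac_der_derivation ddy)
    (frac_der_comm ddx ddy (@hdxyC K)).

Definition hemb : hseries K -> hfield := @FracField.tofrac D.

Let hemb_zmod : zmod_morphism hemb.
Proof. exact: (@tofrac_is_zmod_morphism D). Qed.

Let hemb_monoid : monoid_morphism hemb.
Proof. exact: (@tofrac_is_monoid_morphism D). Qed.

HB.instance Definition _ := GRing.isZmodMorphism.Build (hseries K) hfield hemb hemb_zmod.
HB.instance Definition _ := GRing.isMonoidMorphism.Build (hseries K) hfield hemb hemb_monoid.

Lemma hemb_dx a : dx (hemb a) = hemb (hdx a).
Proof. exact: (frac_derF ddx). Qed.

Lemma hemb_dy a : dy (hemb a) = hemb (hdy a).
Proof. exact: (frac_derF ddy). Qed.

Lemma hemb_eq0 a : (hemb a == 0) = (a == 0).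
Proof. exact: (@tofrac_eq0 D). Qed.

End HurwitzField.

(** * Taylor expansion as a differential embedding *)

Section Taylor.
Variables (F : diffField) (K : fieldType) (k : {rmorphism F -> K}).

(** The expansion of [a] at a formal point, where [k] plays the part of evaluation at this point.
    Taking an algebraic extension for [K] makes room for initial values outside [F]. *)
Definition taylor (a : F) : hseries K := fun i j => k (iter i dx (iter j dy a)).

Lemma iter_dxyC j (a : F) : iter j dy (dx a) = dx (iter j dy a).
Proof. by elim: j => //= j ->; rewrite dxdyC. Qed.

Lemma taylor_dx a : taylor (dx a) = hdx (taylor a).
Proof. by apply: hseriesP => i j; rewrite /taylor /hdx iter_dxyC -iterSr. Qed.

Lemma taylor_dy a : taylor (dy a) = hdy (taylor a).
Proof. by apply: hseriesP => i j; rewrite /taylor /hdy -iterSr. Qed.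

Lemma taylorD a b : taylor (a + b) = taylor a + taylor b.
Proof.
have dxD := derD (dx_derivation F); have dyD := derD (dy_derivation F).
apply: hseriesP => i j; rewrite haddE /taylor.
have -> : iter j dy (a + b) = iter j dy a + iter j dy b.
  by elim: j => //= j ->; apply: dyD.
rewrite -rmorphD; congr (k _); elim: i => //= i ->; exact: dxD.
Qed.

Lemma taylorM a b : taylor (a * b) = taylor a * taylor b.
Proof.
apply: hseriesP => i j; rewrite hmulE; move: i j a b.
apply: hmulr_ind => [a b|j IH a b|i j IH a b].
- exact: rmorphM.
- rewrite -[LHS]/(hdy (taylor (a * b)) 0%N j) -taylor_dy (derM (dy_derivation F)).
  by rewrite taylorD haddE !IH hmulSy !taylor_dy.
- rewrite -[LHS]/(hdx (taylor (a * b)) i j) -taylor_dx (derM (dx_derivation F)).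
  by rewrite taylorD haddE !IH !taylor_dx.
Qed.

Lemma taylor1 : taylor 1 = 1.
Proof.
apply: hseriesP => i j; rewrite /taylor.
have dx0 := der0 (dx_derivation F); have dy0 := der0 (dy_derivation F).
have dx1 := der1 (dx_derivation F); have dy1 := der1 (dy_derivation F).
have ix n : iter n (@dx F) 0 = 0 by elim: n => //= n ->.
have iy n : iter n (@dy F) 0 = 0 by elim: n => //= n ->.
rewrite -[RHS]/(((i == 0%N) && (j == 0%N))%:R).
case: j => [|j]; last by rewrite iterSr dy1 iy ix rmorph0 andbF.
case: i => [|i]; first by rewrite rmorph1.
by rewrite iterSr dx1 ix rmorph0.
Qed.

Let taylor_zmod : zmod_morphism taylor.
Proof.
have taylorN a : taylor (- a) = - taylor a.
  apply: (addrI (taylor a)); rewrite -taylorD !subrr; apply: (addrI (taylor 0)).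
  by rewrite -taylorD !addr0.
by move=> a b; rewrite taylorD taylorN.
Qed.

Let taylor_monoid : monoid_morphism taylor.
Proof. by split; [exact: taylor1 | exact: taylorM]. Qed.

HB.instance Definition _ := GRing.isZmodMorphism.Build F (hseries K) taylor taylor_zmod.
HB.instance Definition _ := GRing.isMonoidMorphism.Build F (hseries K) taylor taylor_monoid.

Hypothesis ch0 : [pchar K] =i pred0.

Definition taylor_field : F -> hfield ch0 := hemb ch0 \o taylor.

HB.instance Definition _ := GRing.RMorphism.on taylor_field.

Lemma taylor_extension : diff_extension taylor_field.
Proof.
split=> a.
  by rewrite -[LHS]/(hemb ch0 (taylor (dx a))) taylor_dx -hemb_dx.
by rewrite -[LHS]/(hemb ch0 (taylor (dy a))) taylor_dy -hemb_dy.
Qed.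
End Taylor.

(** * Formal solutions *)

Section FormalSolve.
Variable K : fieldType.
Local Notation H := (hseries K).

(** The system is banded: with [A] the largest index such that [c A] is non-zero, equation [i]
    determines [u (i + A)]. Changing the unknown [n + A] does not disturb the equations [i < n],
    where its coefficient is some [c a] with [a > A]. *)
Lemma toeplitz_solvable (p : nat) (c r : nat -> K) (n : nat) :
  (exists2 a, (a <= p)%N & c a != 0) ->
  exists u : nat -> K, forall i, (i < n)%N -> \sum_(a < p.+1) c a * u (i + a)%N = r i.
Proof.
move=> ex; have ex' : exists a, (a <= p)%N && (c a != 0).
  by case: ex => a ap ca; exists a; rewrite ap.
have ub a : (a <= p)%N && (c a != 0) -> (a <= p)%N by case/andP.
have [A /andP[Ap cA] Amax] := ex_maxnP ex' ub.
elim: n => [|n [u IH]]; first by exists (fun=> 0).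
pose v : K := (r n - \sum_(a < p.+1 | a != A :> nat) c a * u (n + a)%N) / c A.
exists (fun k => if k == (n + A)%N then v else u k) => i; rewrite ltnS leq_eqVlt => /orP[/eqP ->|ilt].
  rewrite (bigD1 (inord A)) //= inordK // eqxx mulrC divfK //.
  rewrite (eq_bigl (fun a : 'I_p.+1 => a != A :> nat)); last first.
    by move=> a; rewrite -val_eqE /= inordK.
  under [X in _ + X]eq_bigr => a aA do rewrite eqn_add2l (negbTE aA).
  by rewrite subrK.
rewrite -(IH i ilt); apply: eq_bigr => a _; case: eqP => // e.
have : (a <= A)%N -> False.
  by move=> aA; have := leq_add ilt aA; rewrite addSn e ltnn.
move/negP; rewrite -ltnNge => Aa; have [->|ca] := eqVneq (c a) 0; first by rewrite !mul0r.
by have := Amax a; rewrite -ltnS ltn_ord ca leqNgt Aa => /(_ isT).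
Qed.

(** Successive approximation by degree. On a correction of degree [d + p], the equation in degree
    [d] acts as the constant-coefficient operator with symbol [c], which is onto by
    [toeplitz_solvable]. The degrees below [d0] are left to the initial jet [phi0]. *)
Theorem formal_solve (N : H -> H) (phi0 : H) (p d0 : nat) (c : nat -> K) :
  (exists2 a, (a <= p)%N & c a != 0) ->
  (forall phi psi d, vanish (d0 + p) (phi - phi0) -> (d0 <= d)%N -> vanish (d + p) psi ->
     forall i j, (i + j <= d)%N ->
     N (phi + psi) i j = N phi i j + \sum_(a < p.+1) c a * psi (i + a)%N (j + (p - a))%N) ->
  exists phi, vanish (d0 + p) (phi - phi0) /\
    forall i j, (d0 <= i + j)%N -> N phi i j = 0.
Proof.
move=> cex lin.
pose good n phi := vanish (d0 + p) (phi - phi0) /\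
  forall i j, (d0 <= i + j < d0 + n)%N -> N phi i j = 0.
have step (x : nat * H) : exists psi, vanish (d0 + x.1 + p) psi /\
    (good x.1 x.2 -> good x.1.+1 (x.2 + psi)).
  case: x => n phi /=; set d := (d0 + n)%N.
  have [u uP] := toeplitz_solvable (fun i => - N phi i (d - i)%N) d.+1 cex.
  (* The correction is homogeneous of degree [d + p], so it leaves the degrees already solved
     unchanged. *)
  pose psi : H := fun k l => if (k + l == d + p)%N then u k else 0.
  have psiv : vanish (d + p) psi by move=> k l kl; rewrite /psi (ltn_eqF kl).
  exists psi; split=> // -[near zero]; split.
    rewrite addrAC; apply: vanishD => //; apply: vanishW psiv.
    by rewrite leq_add2r leq_addr.
  move=> i j /andP[d0ij]; rewrite addnS ltnS -/d => ijd.
  rewrite (lin _ _ d) ?leq_addr //; move: ijd; rewrite leq_eqVlt => /orP[/eqP ijd|ijd].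
    have -> : j = (d - i)%N by rewrite -ijd addKn.
    rewrite -[X in X + _]opprK -(uP i); last by rewrite ltnS -ijd leq_addr.
    apply/eqP; rewrite addrC subr_eq0; apply/eqP; apply: eq_bigr => a _.
    rewrite /psi ifT // addnACA -{1}ijd addKn ijd eqn_add2l subnKC //.
    by rewrite -ltnS.
  rewrite zero ?d0ij // add0r big1 // => a _; rewrite psiv ?mulr0 //.
  by rewrite addnACA subnKC ?ltn_add2r // -ltnS.
have [f fP] := choice step.
pose ph n := nat_rect (fun=> H) phi0 (fun n phi => phi + f (n, phi)) n.
have phS n : ph n.+1 = ph n + f (n, ph n) by [].
have gd n : good n (ph n).
  elim: n => [|n IH]; last by have [_ /(_ IH)] := fP (n, ph n).
  split; first by move=> i j _; rewrite subrr.
  by move=> i j; rewrite addn0 ltnNge => /andP[->].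
have stable n m : (n <= m)%N -> vanish (d0 + n + p) (ph m - ph n).
  elim: m => [|m IH]; first by rewrite leqn0 => /eqP -> i j _; rewrite subrr.
  rewrite leq_eqVlt => /orP[/eqP ->|]; first by move=> i j _; rewrite subrr.
  rewrite ltnS => nm; rewrite phS addrAC; apply: vanishD; first exact: IH.
  by have [fv _] := fP (m, ph m); apply: vanishW fv; rewrite leq_add2r leq_add2l.
(* Coefficients of total degree below [d0 + n + p] no longer change after stage [n]. Hence stage
   [(i + j).+1] has the final coefficient at [(i, j)], even if [d0] and [p] are 0. *)
pose phi : H := fun i j => ph (i + j).+1 i j.
have lim n : vanish (d0 + n + p) (phi - ph n).
  move=> i j ij; rewrite haddE hoppE /phi.
  have [le|/ltnW le] := leqP n (i + j).+1.
    by have := stable _ _ le i j ij; rewrite haddE hoppE.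
  apply/eqP; rewrite -oppr_eq0 opprB; apply/eqP.
  have := stable _ _ le i j; rewrite haddE hoppE; apply.
  by rewrite addnS addSn ltnS -addnA addnCA leq_addr.
exists phi; split; first by have := lim 0%N; rewrite addn0.
move=> i j d0ij; pose n := (i + j).+1.
have [near zero] := gd n.
rewrite -(subrK (ph n) phi) addrC (lin _ _ (d0 + n)%N) ?leq_addr //; last first.
  by rewrite /n addnS leqW // leq_addl.
rewrite zero; last by rewrite d0ij /n addnS ltnS leq_addl.
rewrite add0r big1 // => a _; rewrite lim ?mulr0 //.
by rewrite addnACA subnKC ?ltn_add2r ?/n ?addnS ?ltnS ?leq_addl // -ltnS.
Qed.
End FormalSolve.

(** * Simple points of plane curves *)

Lemma eqr_nat_pchar0 (R : idomainType) : [pchar R] =i pred0 ->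
  forall k l, (k%:R == l%:R :> R) = (k == l).
Proof.
move=> /pcharf0P ch0 k l; wlog le_lk : k l / (l <= k)%N => [W|].
  by case/orP: (leq_total l k) => /W // e; rewrite eq_sym e eq_sym.
by rewrite -subr_eq0 -natrB // ch0 subn_eq0 eqn_leq le_lk andbT.
Qed.

Section Ev2.
Variables (F B : comNzRingType) (k : {rmorphism F -> B}) (x y : B).
Definition ev2 : {rmorphism {poly {poly F}} -> B} :=
  horner_eval y \o map_poly (horner_eval x \o map_poly k).

Lemma ev2D P Q : ev2 (P + Q) = ev2 P + ev2 Q. Proof. exact: rmorphD. Qed.
Lemma ev2M P Q : ev2 (P * Q) = ev2 P * ev2 Q. Proof. exact: rmorphM. Qed.

Lemma ev2C c : ev2 c%:P = (map_poly k c).[x].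
Proof. by rewrite /ev2 /= map_polyC horner_evalE hornerC. Qed.

Lemma ev2X : ev2 'X = y.
Proof. by rewrite /ev2 /= map_polyX horner_evalE hornerX. Qed.

Lemma ev2CC c : ev2 c%:P%:P = k c.
Proof. by rewrite ev2C map_polyC hornerC. Qed.

Lemma ev2CX : ev2 'X%:P = x.
Proof. by rewrite ev2C map_polyX hornerX. Qed.
End Ev2.

Lemma minimal_dvdp (R : idomainType) (Q : {poly R}) : (1 < size Q)%N ->
  exists P, [/\ P %| Q, (1 < size P)%N &
    forall P', P' %| Q -> (1 < size P')%N -> (size P <= size P')%N].
Proof.
move=> sQ; suff: forall n P, P %| Q -> (1 < size P)%N -> (size P < n)%N ->
    exists P, [/\ P %| Q, (1 < size P)%N &
      forall P', P' %| Q -> (1 < size P')%N -> (size P <= size P')%N].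
  by apply; [exact: dvdpp|exact: sQ|exact: ltnSn].
elim=> // n IH P PQ sP sPn.
have [[P' [P'Q sP' lt]]|no] := pselect (exists P', [/\ P' %| Q, (1 < size P')%N &
    (size P' < size P)%N]).
  by apply: (IH P') => //; apply: leq_trans lt _.
exists P; split=> // P' P'Q sP'; rewrite leqNgt; apply/negP => lt.
by apply: no; exists P'.
Qed.

Lemma nonroot (F : fieldType) (p : {poly F}) : [pchar F] =i pred0 -> p != 0 ->
  exists x, p.[x] != 0.
Proof.
move=> ch0 p0; have [/allP all0|] := boolP (all (root p) [seq i%:R | i <- iota 0 (size p)]).
  have := max_poly_roots p0 (introT allP all0); rewrite size_map size_iota ltnn.
  rewrite map_inj_uniq ?iota_uniq; last first.
    by move=> i j /eqP; rewrite eqr_nat_pchar0 // => /eqP.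
  by move/(_ isT).
by move=> /allPn[x _ px]; exists x.
Qed.

Lemma ext_root (F : fieldType) (p : {poly F}) : (1 < size p)%N ->
  exists (K : fieldType) (k : {rmorphism F -> K}) (y : K), (map_poly k p).[y] = 0.
Proof.
move=> sp; have [r [rp sr rmin]] := minimal_dvdp sp.
have irr : irreducible_poly r.
  split=> // q q1 qr; have r0 : r != 0 by rewrite -size_poly_gt0 (ltn_trans _ sr).
  rewrite -(dvdp_size_eqp qr) eqn_leq (dvdp_leq r0 qr) rmin ?(dvdp_trans qr) //.
  have q0 : q != 0 by apply: contraTneq qr => ->; rewrite dvd0p.
  by rewrite ltn_neqAle eq_sym q1 size_poly_gt0.
have [L _ [y ry _]] := irredp_FAdjoin irr.
exists L, (in_alg L), y; move: rp => /dvdpP[q ->].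
by rewrite rmorphM hornerM (rootP ry) mulr0.
Qed.

(* A divisor of [Q] of least positive degree in the outer variable is coprime *)
(* to its derivative, so that it has simple points above almost every value   *)
(* of the inner variable.                                                     *)
Theorem simple_point (F : fieldType) (Q : {poly {poly F}}) : [pchar F] =i pred0 ->
  (1 < size Q)%N ->
  exists (K : fieldType) (k : {rmorphism F -> K}) (x : F) (y : K)
    (P R : {poly {poly F}}) (c : {poly F}),
  [/\ x != 0, c.[x] != 0, c *: Q = R * P,
      ev2 k (k x) y P = 0 & ev2 k (k x) y P^`() != 0].
Proof.
move=> ch0 sQ; have [P [PQ sP Pmin]] := minimal_dvdp sQ.
have P0 : P != 0 by rewrite -size_poly_gt0 (ltn_trans _ sP).
have ch : forall n : nat, (n%:R == 0 :> {poly F}) = (n == 0%N).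
  by move=> n; rewrite -polyC_natr polyC_eq0 (eqr_nat_pchar0 ch0 n 0).
have sP' : (size P^`() < size P)%N by rewrite lt_size_deriv.
have P'0 : P^`() != 0.
  apply/eqP => /(congr1 (fun q : {poly {poly F}} => q`_(size P).-2)).
  rewrite coef0 coef_deriv -mulr_natr => /eqP; rewrite mulf_eq0 ch orbF.
  by move: (lead_coef_eq0 P); rewrite (negbTE P0) lead_coefE; case: (size P) sP => [|[|s]] //= _ ->.
have cop : coprimep P P^`().
  rewrite coprimep_def eqn_leq size_poly_gt0 gcdp_eq0 (negbTE P0) andbT leqNgt.
  apply/negP => /(Pmin _ (dvdp_trans (dvdp_gcdl _ _) PQ)).
  by rewrite leqNgt (leq_ltn_trans (leq_gcdpr _ P'0) sP').
have [[u v] /= /eqpP[[a b] /= /andP[a0 b0] e]] := Bezout_coprimepP _ _ cop.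
have [[c R] /= c0 eQ] := Pdiv.Idomain.dvdpP _ _ PQ.
(* The value [x] must avoid 0, the zeros of the denominator [c] of the division, those of the Bezout
   constant [b], and those of the leading coefficient, so that [P] keeps its degree and has a root
   above [x]. *)
pose D := 'X * c * b * lead_coef P.
have [x] : exists x, D.[x] != 0.
  by apply: nonroot => //; rewrite !mulf_neq0 ?polyX_eq0 ?lead_coef_eq0.
rewrite !hornerM hornerX !mulf_eq0 !negb_or -!andbA => /and4P[x0 cx bx lx].
pose p := map_poly (horner_eval x) P.
have sp : (1 < size p)%N by rewrite size_poly_eq.
have [K [k [y py]]] := ext_root sp.
have hk (q : {poly F}) : (map_poly k q).[k x] = k q.[x] by rewrite horner_map.
have ev0 : ev2 k (k x) y P = 0.
  rewrite -[RHS]py /p -map_poly_comp; congr (_.[_]).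
  by apply: eq_map_poly => q /=; rewrite !horner_evalE hk.
exists K, k, x, y, P, R, c; split=> //.
apply/eqP => P'y0; have P'y : ev2 k (k x) y P^`() = 0 by exact: P'y0.
case/negP: bx; have := congr1 (ev2 k (k x) y) e.
rewrite -!mul_polyC !(ev2M, ev2D) ev0 P'y !mulr0 addr0 mulr0 rmorph1 mulr1.
by rewrite ev2C hk => /esym/eqP; rewrite fmorph_eq0.
Qed.

(** * Conjugated operators *)

(* From here on [mcoeff], [msupp], [mdeg], ... are those of [mpoly]. *)
From mathcomp Require Import ssrcomplements mpoly.

Local Notation mpoly2 F := (mpoly 2 F).
Local Notation mpoly3 F := (mpoly 3 F).
Notation i30 := (@Ordinal 3 0 isT).
Notation i31 := (@Ordinal 3 1 isT).
Notation i32 := (@Ordinal 3 2 isT).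

HB.lock Definition coefder (n : nat) (F : nzRingType) (d : F -> F)
  (p : mpoly n F) : mpoly n F := map_mpoly d p.

Section CoefDer.
Variables (n : nat) (F : comNzRingType) (d : F -> F).
Hypothesis dd : derivation d.

Let d_zmod : zmod_morphism d.
Proof. by move=> x y; rewrite derD // derN. Qed.

Let d_add : {additive F -> F} :=
  HB.pack d (GRing.isZmodMorphism.Build F F d d_zmod).

Local Notation coefder := (@coefder n F d).

Lemma mcoeff_coefder p m : (coefder p)@_m = d p@_m.
Proof. by rewrite unlock; apply: (mcoeff_map_mpoly d_add). Qed.

Lemma coefder0 : coefder 0 = 0.
Proof. by apply/mpolyP => m; rewrite mcoeff_coefder !mcoeff0 der0. Qed.

Lemma coefderD p q : coefder (p + q) = coefder p + coefder q.
Proof. by apply/mpolyP => m; rewrite mcoeffD !mcoeff_coefder mcoeffD derD. Qed.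

Lemma coefderZ c p : coefder (c *: p) = d c *: p + c *: coefder p.
Proof.
by apply/mpolyP => m; rewrite mcoeffD !mcoeffZ !mcoeff_coefder mcoeffZ derM.
Qed.

Lemma coefderX m : coefder 'X_[m] = 0.
Proof.
apply/mpolyP => k; rewrite mcoeff0 mcoeff_coefder mcoeffX.
by case: eqP => _; rewrite ?der1 ?der0.
Qed.

Lemma coefderMX p m : coefder (p * 'X_[m]) = coefder p * 'X_[m].
Proof.
elim/mpolyind: p => [|c m' p _ _ IH]; first by rewrite mul0r coefder0 mul0r.
rewrite mulrDl !coefderD IH mulrDl; congr (_ + _).
by rewrite -scalerAl -mpolyXD !coefderZ !coefderX !scaler0 !addr0 -scalerAl -mpolyXD.
Qed.

Lemma coefder_derivation : derivation coefder.
Proof.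
split; first exact: coefderD.
move=> p q; elim/mpolyind: q => [|c m q _ _ IH].
  by rewrite !(mulr0, coefder0, addr0).
rewrite !(mulrDr, coefderD) IH addrACA; congr (_ + _).
by rewrite -!scalerAr !coefderZ coefderMX coefderX scaler0 addr0 -!scalerAr addrC.
Qed.
End CoefDer.

Section MLin.
Variables (n : nat) (F : nzRingType) (M : lmodType F) (f : 'X_{1..n} -> M).
Implicit Types p q : mpoly n F.

Definition mlin p : M := \sum_(m <- msupp p) p@_m *: f m.

Lemma mlinE p k : (msize p <= k)%N ->
  mlin p = \sum_(m : 'X_{1..n < k}) p@_m *: f m.
Proof.
move=> le_pk; set I : subFinType _ := 'X_{1..n < k}.
rewrite /mlin (big_mksub I) ?msupp_uniq //=.
  rewrite big_rmcond //= => m /memN_msupp_eq0 ->.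
  by rewrite scale0r.
by move=> m /msize_mdeg_lt /leq_trans; apply.
Qed.

Lemma mlinD p q : mlin (p + q) = mlin p + mlin q.
Proof.
pose k := maxn (msize p) (msize q).
rewrite (@mlinE _ k) ?msizeD_le // (@mlinE p k) ?leq_maxl // (@mlinE q k) ?leq_maxr //.
by rewrite -big_split; apply: eq_bigr => m _; rewrite mcoeffD scalerDl.
Qed.

Lemma mlinZ c p : mlin (c *: p) = c *: mlin p.
Proof.
rewrite (mlinE (msizeZ_le p c)) (mlinE (leqnn _)) scaler_sumr.
by apply: eq_bigr => m _; rewrite mcoeffZ scalerA.
Qed.

Lemma mlin0 : mlin 0 = 0.
Proof. by rewrite -[0](scale0r (0 : mpoly n F)) mlinZ scale0r. Qed.

Lemma mlinX m : mlin 'X_[m] = f m.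
Proof. by rewrite /mlin msuppX big_seq1 mcoeffX eqxx scale1r. Qed.

Lemma mlin_sum (I : Type) (r : seq I) (P : pred I) (E : I -> mpoly n F) :
  mlin (\sum_(i <- r | P i) E i) = \sum_(i <- r | P i) mlin (E i).
Proof. exact: (big_morph mlin mlinD mlin0). Qed.
End MLin.

(** The connection [D + a], [E + b] is flat: its curvature [D b - E a] vanishes. For gradients this
    is the equality of mixed derivatives. *)
Lemma twisted_comm (R : comNzRingType) (D E : R -> R) (a b x : R) :
  derivation D -> derivation E -> D (E x) = E (D x) -> D b = E a ->
  D (E x + b * x) + a * (E x + b * x) = E (D x + a * x) + b * (D x + a * x).
Proof.
move=> dD dE DE Dba; rewrite (derD dD) (derD dE) (derM dD) (derM dE) DE Dba.
by rewrite !mulrDr -!addrA (mulrCA a b) [b * D x + _]addrCA.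
Qed.

Section Ops.
Variable F : diffField.
Local Notation A := (mpoly3 F).
Implicit Types (S : A) (gn : seq (nat * F)) (T : ldo F).

Let dxd := dx_derivation F.
Let dyd := dy_derivation F.

(* Left multiplication by d_x conjugated by exp (sum_i f_i zeta^(n_i)), on    *)
(* normal forms; 'X_i30, 'X_i31 and 'X_i32 stand for d_x, d_y and zeta.       *)
Definition gradx gn : A := \sum_(p <- gn) dx p.2 *: 'X_i32 ^+ p.1.
Definition grady gn : A := \sum_(p <- gn) dy p.2 *: 'X_i32 ^+ p.1.
Definition Lx gn S : A := coefder dx S + ('X_i30 + gradx gn) * S.
Definition Ly gn S : A := coefder dy S + ('X_i31 + grady gn) * S.

Lemma LxD gn S S' : Lx gn (S + S') = Lx gn S + Lx gn S'.
Proof. by rewrite /Lx (coefderD dxd) mulrDr addrACA. Qed.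

Lemma LyD gn S S' : Ly gn (S + S') = Ly gn S + Ly gn S'.
Proof. by rewrite /Ly (coefderD dyd) mulrDr addrACA. Qed.

Lemma LxZ gn c S : Lx gn (c *: S) = dx c *: S + c *: Lx gn S.
Proof. by rewrite /Lx (coefderZ dxd) -scalerAr scalerDr addrA. Qed.

Lemma LyZ gn c S : Ly gn (c *: S) = dy c *: S + c *: Ly gn S.
Proof. by rewrite /Ly (coefderZ dyd) -scalerAr scalerDr addrA. Qed.

Lemma Lx_zeta gn S : Lx gn ('X_i32 * S) = 'X_i32 * Lx gn S.
Proof. by rewrite /Lx mulrDr mulrCA (mulrC 'X_i32 S) (coefderMX dxd) mulrC. Qed.

Lemma Ly_zeta gn S : Ly gn ('X_i32 * S) = 'X_i32 * Ly gn S.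
Proof. by rewrite /Ly mulrDr mulrCA (mulrC 'X_i32 S) (coefderMX dyd) mulrC. Qed.

Lemma coefder_grad gn : coefder dx (grady gn) = coefder dy (gradx gn).
Proof.
rewrite (der_sum (@coefder_derivation 3 _ _ dxd)) (der_sum (@coefder_derivation 3 _ _ dyd)).
apply: eq_bigr => p _; rewrite (coefderZ dxd) (coefderZ dyd) mpolyXn.
by rewrite (coefderX dxd) (coefderX dyd) !scaler0 !addr0 dxdyC.
Qed.

Lemma LxyC gn S : Lx gn (Ly gn S) = Ly gn (Lx gn S).
Proof.
have cdx := @coefder_derivation 3 _ _ dxd; have cdy := @coefder_derivation 3 _ _ dyd.
apply: twisted_comm => //; last first.
  by rewrite (derD cdx) (derD cdy) (coefderX dxd) (coefderX dyd) coefder_grad.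
apply/mpolyP => m; rewrite (mcoeff_coefder dxd) (mcoeff_coefder dyd).
by rewrite (mcoeff_coefder dyd) (mcoeff_coefder dxd) dxdyC.
Qed.

(** The normal form of the conjugated operator, found by letting the twisted left multiplications
    act on 1. *)
Definition Dop gn T : A :=
  \sum_(m <- monalg.msupp T)
    monalg.mcoeff m T *: iter (m ord0) (Lx gn) (iter (m ord_max) (Ly gn) 1).
End Ops.

Lemma iter_comm (M : Type) (f g : M -> M) : (forall x, f (g x) = g (f x)) ->
  forall n x, iter n f (g x) = g (iter n f x).
Proof. by move=> fg; elim=> [|n IH] x //=; rewrite IH fg. Qed.

(** * Action of normal forms on modules *)

Section Pact.
Variables (F : diffField) (M : lmodType F) (X Y Z : M -> M).
Hypotheses (XD : forall H K, X (H + K) = X H + X K)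
  (XZ : forall c H, X (c *: H) = dx c *: H + c *: X H)
  (YD : forall H K, Y (H + K) = Y H + Y K)
  (YZ : forall c H, Y (c *: H) = dy c *: H + c *: Y H)
  (ZD : forall H K, Z (H + K) = Z H + Z K)
  (ZZ : forall c H, Z (c *: H) = c *: Z H)
  (XYC : forall H, X (Y H) = Y (X H)) (ZXC : forall H, Z (X H) = X (Z H))
  (ZYC : forall H, Z (Y H) = Y (Z H)).
Local Notation A := (mpoly3 F).

Definition pterm (H : M) (m : 'X_{1..3}) : M :=
  iter (m i32) Z (iter (m i30) X (iter (m i31) Y H)).

Definition pact (S : A) (H : M) : M := mlin (pterm H) S.

Let mE (m k : 'X_{1..3}) i : (m + k)%MM i = (m i + k i)%N := mnmDE i m k.
Let U (i j : 'I_3) : (U_(i) : 'X_{1..3})%MM j = (i == j) := mnm1E i j.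

Lemma ptermX H m : pterm H (U_(i30) + m)%MM = X (pterm H m).
Proof. by rewrite /pterm !mE !U /= (iter_comm ZXC). Qed.

Lemma ptermY H m : pterm H (U_(i31) + m)%MM = Y (pterm H m).
Proof.
by rewrite /pterm !mE !U /= (iter_comm XYC) (iter_comm ZYC).
Qed.

Lemma ptermZ H m k : pterm H (U_(i32) *+ k + m)%MM = iter k Z (pterm H m).
Proof. by rewrite /pterm !mE !mulmnE !U /= mul1n !mul0n iterD. Qed.

Lemma iterZD k H K : iter k Z (H + K) = iter k Z H + iter k Z K.
Proof. by elim: k => //= k ->. Qed.

Lemma iterZZ k c H : iter k Z (c *: H) = c *: iter k Z H.
Proof. by elim: k => //= k ->. Qed.

Definition twist (d : F -> F) (W : M -> M) (gn : seq (nat * F)) (H : M) : M :=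
  W H + \sum_(p <- gn) d p.2 *: iter p.1 Z H.

Lemma twistD d W gn : (forall H K, W (H + K) = W H + W K) ->
  forall H K, twist d W gn (H + K) = twist d W gn H + twist d W gn K.
Proof.
move=> WD H K; rewrite /twist WD addrACA -big_split; congr (_ + _).
by apply: eq_bigr => p _; rewrite iterZD scalerDr.
Qed.

Lemma twist0 d W gn : (forall H K, W (H + K) = W H + W K) -> twist d W gn 0 = 0.
Proof. by move=> WD; apply: (addrI (twist d W gn 0)); rewrite -twistD // !addr0. Qed.

Lemma twistZ d W gn c H : W (c *: H) = d c *: H + c *: W H ->
  twist d W gn (c *: H) = d c *: H + c *: twist d W gn H.
Proof.
move=> Wc; rewrite /twist Wc scalerDr addrA; congr (_ + _).
rewrite scaler_sumr; apply: eq_bigr => p _.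
by rewrite iterZZ !scalerA mulrC.
Qed.

Lemma pactD H S S' : pact (S + S') H = pact S H + pact S' H.
Proof. exact: mlinD. Qed.

Lemma pactZ H c S : pact (c *: S) H = c *: pact S H.
Proof. exact: mlinZ. Qed.

Lemma pactX H m : pact 'X_[m] H = pterm H m.
Proof. exact: mlinX. Qed.

(** Moving a derivation past a coefficient produces the term in [coefder]; so left multiplication on
    normal forms corresponds to composition of operators on any module. *)
Lemma pact_twist (d : F -> F) (W : M -> M) (i : 'I_3) gn H S :
  derivation d -> (forall H K, W (H + K) = W H + W K) ->
  (forall c H, W (c *: H) = d c *: H + c *: W H) ->
  (forall m, pterm H (U_(i) + m)%MM = W (pterm H m)) ->
  pact (coefder d S + ('X_i + \sum_(p <- gn) d p.2 *: 'X_i32 ^+ p.1) * S) H =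
  twist d W gn (pact S H).
Proof.
move=> dd WD WZ Wt; elim/mpolyind: S => [|c m S _ _ IH].
  by rewrite coefder0 // mulr0 addr0 [pact 0 H]mlin0 twist0.
rewrite (coefderD dd) mulrDr addrACA pactD IH (pactD H (c *: _)) twistD //.
congr (_ + _).
rewrite (coefderZ dd) (coefderX dd) scaler0 addr0 pactD mulrDl pactD.
rewrite !pactZ !pactX twistZ // -scalerAr pactZ -mpolyXD pactX Wt.
congr (_ + _); rewrite scalerDr; congr (_ + _).
rewrite mulr_suml {1}/pact mlin_sum scaler_sumr; apply: eq_bigr => p _.
rewrite -scalerAl -scalerAr mpolyXn -mpolyXD !mlinZ mlinX ptermZ.
by rewrite !scalerA mulrC.
Qed.

Lemma pact_Lx gn H S : pact (Lx gn S) H = twist (@dx F) X gn (pact S H).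
Proof. exact: pact_twist (dx_derivation F) XD XZ (ptermX H). Qed.

Lemma pact_Ly gn H S : pact (Ly gn S) H = twist (@dy F) Y gn (pact S H).
Proof. exact: pact_twist (dy_derivation F) YD YZ (ptermY H). Qed.

(** Stated for an arbitrary module because it serves twice: for formal sums in [ldo_actE], and for
    the ring of normal forms itself in [Dop_rcons]. *)
Lemma pact_Dop gn (T : ldo F) H : pact (Dop gn T) H =
  \sum_(m <- monalg.msupp T) monalg.mcoeff m T *:
    iter (m ord0) (twist (@dx F) X gn) (iter (m ord_max) (twist (@dy F) Y gn) H).
Proof.
rewrite /Dop {1}/pact mlin_sum; apply: eq_bigr => m _; rewrite mlinZ.
congr (_ *: _); elim: (m ord0) => [|a IH] /=; last by rewrite -IH -pact_Lx.
elim: (m ord_max) => [|b IH] /=; last by rewrite -IH -pact_Ly.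
by rewrite -mpolyX0 mlinX /pterm !mnm0E.
Qed.
End Pact.

Section LdoAct.
Variables (F : diffField) (E : zmodType) (R : comAlgType F).
Variables (c : F -> R) (Dx Dy : R -> R) (ex : seq (E * R)) (z : E).
Hypotheses (cE : forall a r, c a * r = a *: r)
  (Dxd : derivation Dx) (Dyd : derivation Dy)
  (DxC : forall a, Dx (c a) = c (dx a)) (DyC : forall a, Dy (c a) = c (dy a))
  (DxyC : forall r, Dx (Dy r) = Dy (Dx r)).
Local Notation M := (E -> R).

Definition fshift (H : M) : M := fun e => H (e - z).

Lemma iter_fshift k H e : iter k fshift H e = H (e - z *+ k).
Proof.
elim: k e => [|k IH] e; first by rewrite mulr0n subr0.
by rewrite iterS /fshift IH mulrS opprD addrA.
Qed.

Section One.
Variables (D : R -> R) (d : F -> F).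
Hypotheses (Dd : derivation D) (DC : forall a, D (c a) = c (d a)).

Lemma gder_add H K : gder ex D (H + K) = gder ex D H + gder ex D K.
Proof.
apply/funext => e; rewrite /gder !fctE (derD Dd) addrACA -big_split.
by congr (_ + _); apply: eq_bigr => p _; rewrite mulrDr.
Qed.

Lemma gder_scale a H : gder ex D (a *: H) = d a *: H + a *: gder ex D H.
Proof.
apply/funext => e; rewrite /gder !fctE -cE (derM Dd) DC !cE scalerDr addrA.
congr (_ + _); rewrite scaler_sumr; apply: eq_bigr => p _.
by rewrite /= -scalerAr.
Qed.

Lemma gder_fshift H : fshift (gder ex D H) = gder ex D (fshift H).
Proof.
apply/funext => e; rewrite /fshift /gder; congr (_ + _).
by apply: eq_bigr => p _; rewrite addrAC.
Qed.

Lemma gder_twist (gn : seq (nat * F)) :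
  gder ([seq (z *+ p.1, c p.2) | p <- gn] ++ ex) D =
  twist fshift d (gder ex D) gn.
Proof.
apply/funext => H; apply/funext => e; rewrite /twist /gder !fctE big_cat big_map.
rewrite /= [X in _ + X]addrC addrA; congr (_ + _); rewrite fct_sumE.
by apply: eq_bigr => p _; rewrite !fctE iter_fshift DC cE.
Qed.
End One.

Lemma gder_gder (D D' : R -> R) H e : derivation D ->
  gder ex D (gder ex D' H) e = D (D' (H e)) + \sum_(p <- ex) D (D' p.2) * H (e - p.1)
    + (\sum_(p <- ex) D' p.2 * D (H (e - p.1)) + \sum_(p <- ex) D p.2 * D' (H (e - p.1)))
    + \sum_(p <- ex) \sum_(r <- ex) D p.2 * D' r.2 * H (e - p.1 - r.1).
Proof.
move=> Dd; rewrite /gder (derD Dd) (der_sum Dd).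
under eq_bigr do rewrite (derM Dd).
under [X in _ + X]eq_bigr do rewrite mulrDr mulr_sumr.
rewrite !big_split /= !addrA; congr (_ + _).
by apply: eq_bigr => p _; apply: eq_bigr => r _; rewrite mulrA.
Qed.

Lemma gderC H : gder ex Dx (gder ex Dy H) = gder ex Dy (gder ex Dx H).
Proof.
apply/funext => e; rewrite !gder_gder // DxyC exchange_big /=; congr (_ + _ + _ + _).
- by apply: eq_bigr => p _; rewrite DxyC.
- by rewrite addrC.
- apply: eq_bigr => p _; apply: eq_bigr => r _.
  by rewrite [Dx _ * _]mulrC addrAC.
Qed.

(** The part of the rule with exponents in multiples of [z] is absorbed into the conjugated
    operator, and only [ex] remains. It is the single term [phi] for the coefficients [C_(j,t)], and
    empty for series. *)
Theorem ldo_actE (gn : seq (nat * F)) (T : ldo F) (H : M) :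
  ldo_act c Dx Dy ([seq (z *+ p.1, c p.2) | p <- gn] ++ ex) T H =
  pact (gder ex Dx) (gder ex Dy) fshift (Dop gn T) H.
Proof.
rewrite pact_Dop; first last.
- exact: gder_fshift.
- exact: gder_fshift.
- exact: gderC.
- by move=> a K; apply/funext.
- by move=> K K'; apply/funext.
- exact: gder_scale.
- exact: gder_add.
- exact: gder_scale.
- exact: gder_add.
apply/funext => e; rewrite /ldo_act fct_sumE; apply: eq_bigr => m _.
by rewrite cE (gder_twist DxC) (gder_twist DyC).
Qed.
End LdoAct.

Notation i20 := (@Ordinal 2 0 isT).
Notation i21 := (@Ordinal 2 1 isT).

(** * Specialisation to the coefficients C_(j,t) *)

Definition mn2 (a b : nat) : 'X_{1..2} := [multinom [tuple a; b]].
Definition mn3 (a b k : nat) : 'X_{1..3} := [multinom [tuple a; b; k]].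
Definition front (m : 'X_{1..3}) : 'X_{1..2} := mn2 (m i30) (m i31).
Definition ord2 (m : 'X_{1..3}) : nat := m i30 + m i31.

Lemma mn2E0 a b : mn2 a b i20 = a. Proof. by []. Qed.
Lemma mn2E1 a b : mn2 a b i21 = b. Proof. by []. Qed.

Lemma ord2_ind (P : 'I_2 -> Prop) : P i20 -> P i21 -> forall i, P i.
Proof.
move=> P0 P1 [[|[|//]] hi]; first by rewrite (_ : Ordinal hi = i20) //; exact: val_inj.
by rewrite (_ : Ordinal hi = i21) //; exact: val_inj.
Qed.

Lemma ord3_ind (P : 'I_3 -> Prop) : P i30 -> P i31 -> P i32 -> forall i, P i.
Proof.
move=> P0 P1 P2 [[|[|[|//]]] hi].
- by rewrite (_ : Ordinal hi = i30) //; exact: val_inj.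
- by rewrite (_ : Ordinal hi = i31) //; exact: val_inj.
- by rewrite (_ : Ordinal hi = i32) //; exact: val_inj.
Qed.

Lemma mn2P (m m' : 'X_{1..2}) : m i20 = m' i20 -> m i21 = m' i21 -> m = m'.
Proof. by move=> e0 e1; apply/mnmP; apply: ord2_ind. Qed.

Lemma mn3P (m m' : 'X_{1..3}) :
  m i30 = m' i30 -> m i31 = m' i31 -> m i32 = m' i32 -> m = m'.
Proof. by move=> e0 e1 e2; apply/mnmP; apply: ord3_ind. Qed.

Lemma mn2_eta (m : 'X_{1..2}) : m = mn2 (m i20) (m i21).
Proof. exact: mn2P. Qed.

Lemma mdeg2 (m : 'X_{1..2}) : mdeg m = (m i20 + m i21)%N.
Proof.
rewrite mdegE !big_ord_recr big_ord0 /= add0n.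
by congr (m _ + m _)%N; apply: val_inj.
Qed.

Lemma mdeg_front m : mdeg (front m) = ord2 m.
Proof. by rewrite mdeg2. Qed.

Lemma front_inj m m' : front m = front m' -> m i30 = m' i30 /\ m i31 = m' i31.
Proof.
move=> e; split; first by rewrite -(mn2E0 (m i30) (m i31)) -/(front m) e.
by rewrite -(mn2E1 (m i30) (m i31)) -/(front m) e.
Qed.

Section Slice.
Variable F : fieldType.
Implicit Types (S : mpoly3 F) (Q : mpoly2 F) (P : pred 'X_{1..3}).

Lemma mpolyX2 (m : 'X_{1..2}) : 'X_[m] = 'X_i20 ^+ m i20 * 'X_i21 ^+ m i21 :> mpoly2 F.
Proof. by rewrite !mpolyXn -mpolyXD; congr mpolyX; apply: mn2P; rewrite mnmDE !mulmnE !mnm1E ?mul1n ?mul0n ?addn0. Qed.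

Definition slice P S : mpoly2 F := mlin (fun m => if P m then 'X_[front m] else 0) S.

Definition hpart t Q : mpoly2 F := mlin (fun m => if mdeg m == t then 'X_[m] else 0) Q.

Lemma mcoeff_mlin n k (f : 'X_{1..n} -> mpoly k F) (p : mpoly n F) m :
  (mlin f p)@_m = \sum_(i <- msupp p) p@_i * (f i)@_m.
Proof.
rewrite /mlin (big_morph (mcoeff m) (mcoeffD m) (mcoeff0 _ m)).
by apply: eq_bigr => i _; rewrite mcoeffZ.
Qed.

Lemma mcoeff_hpart t Q m : (hpart t Q)@_m = if mdeg m == t then Q@_m else 0.
Proof.
rewrite mcoeff_mlin; have [mQ|mQ] := boolP (m \in msupp Q).
  rewrite (bigD1_seq m) ?msupp_uniq //= big1 ?addr0 => [|i im].
    by case: ifP => _; rewrite ?mcoeffX ?mcoeff0 ?eqxx ?mulr1 ?mulr0.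
  by case: ifP => _; rewrite ?mcoeff0 ?mulr0 // mcoeffX (negbTE im) mulr0.
rewrite (memN_msupp_eq0 mQ) if_same big_seq big1 // => i iQ.
case: ifP => _; rewrite ?mcoeff0 ?mulr0 // mcoeffX.
by case: eqP mQ => [<-|_ _]; rewrite ?iQ ?mulr0.
Qed.

(* [P] cuts out at most one monomial above each monomial in d_x, d_y *)
Definition section P := forall m m', P m -> P m' -> front m = front m' -> m = m'.

Lemma mcoeff_slice P S m : section P -> P m -> (slice P S)@_(front m) = S@_m.
Proof.
move=> inj Pm; rewrite mcoeff_mlin; have [mQ|mQ] := boolP (m \in msupp S).
  rewrite (bigD1_seq m) ?msupp_uniq //= big1 ?addr0 => [|i im].
    by rewrite Pm mcoeffX eqxx mulr1.
  case: ifP => Pi; rewrite ?mcoeff0 ?mulr0 // mcoeffX.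
  case: (front i =P front m) => [e|_]; last by rewrite mulr0.
  by rewrite (inj _ _ Pi Pm e) eqxx in im.
rewrite (memN_msupp_eq0 mQ) big_seq big1 // => i iQ.
case: ifP => Pi; rewrite ?mcoeff0 ?mulr0 // mcoeffX.
case: (front i =P front m) => [e|_]; last by rewrite mulr0.
by rewrite -(inj _ _ Pi Pm e) iQ in mQ.
Qed.

Lemma msupp_slice P S m : m \in msupp (slice P S) ->
  exists m', [/\ m' \in msupp S, P m' & m = front m'].
Proof.
rewrite mcoeff_msupp mcoeff_mlin => /eqP nz; apply: contrapT => nex; apply: nz.
rewrite big_seq big1 // => i iS; case: ifP => Pi; rewrite ?mcoeff0 ?mulr0 //.
rewrite mcoeffX; case: eqP => [e|_]; last by rewrite mulr0.
by case: nex; exists i; rewrite e.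
Qed.

Lemma hpart_slice t P S :
  hpart t (slice P S) = slice (fun m => P m && (ord2 m == t)) S.
Proof.
rewrite /hpart; have -> : slice P S = \sum_(m <- msupp S) S@_m *:
  (if P m then 'X_[front m] else 0) by [].
rewrite mlin_sum; apply: eq_bigr => m _.
rewrite mlinZ; congr (_ *: _); case: (P m) => /=; last exact: mlin0.
by rewrite mlinX mdeg_front.
Qed.
Lemma mlin_slice (V : lmodType F) (f : 'X_{1..2} -> V) P S :
  mlin f (slice P S) = \sum_(m <- msupp S | P m) S@_m *: f (front m).
Proof.
have -> : slice P S = \sum_(m <- msupp S) S@_m *:
  (if P m then 'X_[front m] else 0) by [].
rewrite mlin_sum [RHS]big_mkcond; apply: eq_bigr => m _.
by rewrite mlinZ; case: (P m); rewrite ?mlinX ?mlin0 ?scaler0.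
Qed.
End Slice.

Section OneTerm.
Variables (F : diffField) (R : comAlgType F) (Dx Dy : R -> R) (h phi : R) (N : nat).
Hypotheses (Dxd : derivation Dx) (Dyd : derivation Dy).
Local Notation E := (rat * int)%type.
Local Notation M := (E -> R).
Local Notation ex := [:: ((0, 1) : E, phi)].

Definition base_term : M := fun e => if e == (0, 0) then h else 0.

Definition in_strip (n : nat) (H : M) : Prop :=
  forall e, [|| e.1 != 0, e.2 < 0 | n%:Z < e.2] -> H e = 0.

Lemma gder_exE D H e : gder ex D H e = D (H e) + D phi * H (e.1, e.2 - 1).
Proof.
rewrite /gder big_seq1; congr (_ + _ * H _); case: e => a b.
by apply: (congr2 pair); rewrite /= ?subr0.
Qed.

Lemma gder_strip D n H : derivation D -> in_strip n H -> in_strip n.+1 (gder ex D H).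
Proof.
move=> Dd sH [x t] /= out; rewrite gder_exE (sH (x, t)) ?(sH (x, t - 1)) /=.
- by rewrite (der0 Dd) mulr0 addr0.
- by move: out; case: eqP => //= _ /orP[] ?; apply/orP; [left|right]; lia.
- by move: out; case: eqP => //= _ /orP[] ?; apply/orP; [left|right]; lia.
Qed.

Lemma gder_top D n H : derivation D -> in_strip n H ->
  gder ex D H (0, n.+1%:Z) = D phi * H (0, n%:Z).
Proof.
move=> Dd sH; rewrite gder_exE sH; last by apply/or3P/Or33; rewrite ltz_nat.
by rewrite (der0 Dd) add0r; congr (_ * H (_, _)); rewrite /=; lia.
Qed.

Lemma gder_bot D n H : derivation D -> in_strip n H ->
  gder ex D H (0, 0) = D (H (0, 0)).
Proof.
move=> Dd sH; rewrite gder_exE /= (sH (0, -1)) ?mulr0 ?addr0 //=.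
Qed.

Definition expand a b : M := iter a (gder ex Dx) (iter b (gder ex Dy) base_term).

Lemma base_strip : in_strip 0 base_term.
Proof.
move=> [x t] /= out; rewrite /base_term; case: eqP => // -[e1 e2].
by move: out; rewrite e1 e2 eqxx ltxx.
Qed.

(** Three facts about [d_x^a d_y^b (h G)] suffice: the range of its exponents, its top coefficient,
    which involves only first derivatives of [phi], and its bottom coefficient, free of [phi]. The
    intermediate coefficients need not be known. *)
Lemma expandP a b : [/\ in_strip (a + b) (expand a b),
  expand a b (0, (a + b)%:Z) = Dx phi ^+ a * Dy phi ^+ b * h &
  expand a b (0, 0) = iter a Dx (iter b Dy h)].
Proof.
rewrite /expand; elim: a => [|a [s t o]].
  rewrite add0n /= expr0 mul1r; elim: b => [|b [s t o]] /=.
    by split; [exact: base_strip | rewrite expr0 mul1r /base_term eqxx | rewrite /base_term eqxx].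
  split; first exact: gder_strip.
    by rewrite (gder_top Dyd s) t exprS mulrA.
  by rewrite (gder_bot Dyd s) o.
rewrite addSn iterS; split; first exact: gder_strip.
  by rewrite (gder_top Dxd s) t exprS !mulrA.
by rewrite (gder_bot Dxd s) o.
Qed.

Local Notation z := ((N%:R^-1, 0) : E).
Local Notation hact S := (pact (gder ex Dx) (gder ex Dy) (fshift z) S base_term).
Definition level (m : 'X_{1..3}) : rat := (m i32)%:R / N%:R.

Lemma hactE S (j : rat) (t : nat) : hact S (j, t%:Z) =
  \sum_(m <- msupp S | level m == j) S@_m *: expand (m i30) (m i31) (0, t%:Z).
Proof.
rewrite /pact /mlin fct_sumE [RHS]big_mkcond; apply: eq_bigr => m _.
rewrite fctE /pterm iter_fshift.
have -> : (j, t%:Z) - z *+ m i32 = (j - level m, t%:Z).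
  have -> : z *+ m i32 = (level m, 0).
    rewrite /level; elim: (m i32) => [|k IH]; first by rewrite mulr0n mul0r.
    rewrite mulrS IH; apply: (congr2 pair); rewrite /= ?addr0 //.
    by rewrite -natr1 mulrDl mul1r addrC.
  by apply: (congr2 pair); rewrite /= ?subr0.
have [s _ _] := expandP (m i30) (m i31); rewrite -/(expand _ _).
have [<-|ne] := eqVneq (level m) j; first by rewrite subrr.
by rewrite (s (j - level m, t%:Z)) ?scaler0 //= subr_eq0 eq_sym ne.
Qed.

Lemma hact_supp S (j : rat) (t : nat) : hact S (j, t%:Z) <> 0 ->
  exists m, [/\ m \in msupp S, level m = j & (t <= ord2 m)%N].
Proof.
rewrite hactE => nz; apply: contrapT => nex; apply: nz.
rewrite big_seq_cond big1 // => m /andP[mS /eqP mj].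
have [s _ _] := expandP (m i30) (m i31).
rewrite s ?scaler0 //; apply/or3P/Or33; rewrite ltz_nat ltnNge.
by apply/negP => tm; case: nex; exists m.
Qed.

Lemma hact_top S (j : rat) (t : nat) :
  (forall m, m \in msupp S -> level m = j -> (ord2 m <= t)%N) ->
  hact S (j, t%:Z) = mlin (fun m => Dx phi ^+ m i20 * Dy phi ^+ m i21 * h)
    (slice (fun m => (level m == j) && (ord2 m == t)) S).
Proof.
move=> top; rewrite hactE mlin_slice big_seq_cond [RHS]big_seq_cond.
rewrite [LHS]big_mkcond [RHS]big_mkcond; apply: eq_bigr => m _.
have [mS|//] := boolP (m \in msupp S); rewrite /=.
have [mj|//] := eqVneq (level m) j; rewrite /=.
have [s e _] := expandP (m i30) (m i31).
have [mt|nt] := eqVneq (ord2 m) t; first by rewrite -mt e mn2E0 mn2E1.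
rewrite s ?scaler0 //; apply/or3P/Or33; rewrite ltz_nat.
by rewrite ltn_neqAle nt top.
Qed.

Lemma hact_bot S (j : rat) :
  hact S (j, 0) = mlin (fun m => iter (m i20) Dx (iter (m i21) Dy h))
    (slice (fun m => level m == j) S).
Proof.
rewrite [LHS](hactE S j 0) mlin_slice; apply: eq_bigr => m _.
by have [_ _ ->] := expandP (m i30) (m i31).
Qed.
End OneTerm.

Definition scale_exps (F : Type) (N : nat) (gn : seq (nat * F)) : seq (rat * F) :=
  [seq (p.1%:R / N%:R, p.2) | p <- gn].

Lemma rmorph_monom (A B : nzRingType) (rho : {rmorphism A -> B}) a b x y w x' y' w' :
  rho x = x' -> rho y = y' -> rho w = w' ->
  rho (x ^+ a * y ^+ b * w) = x' ^+ a * y' ^+ b * w'.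
Proof. by move=> <- <- <-; rewrite !rmorphM !rmorphXn. Qed.

Lemma rmorph_eq0 (A B : nzRingType) (rho : {rmorphism A -> B}) x y w :
  rho x = y -> rho w = 1 -> x * w = 0 -> y = 0.
Proof. by move=> <- rw xw; rewrite -[LHS]mulr1 -rw -rmorphM xw rmorph0. Qed.

Section Specialise.
Variables (F : diffField).
Local Notation R := (dpoly F 'I_2).
Local Notation E := (rat * int)%type.

Let cst : F -> R := malgC.

Let cstE (a : F) (r : R) : cst a * r = a *: r.
Proof. exact: mul_malgC. Qed.

Local Notation h := (hdet F).
Local Notation phi := (phidet F).
Local Notation DX := (@pdx F 'I_2).
Local Notation DY := (@pdy F 'I_2).
Let dX := @pdx_derivation F 'I_2.
Let dY := @pdy_derivation F 'I_2.

Lemma Ccoef_hact (N : nat) (gn : seq (nat * F)) (T : ldo F) j t :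
  Ccoef T (scale_exps N gn) j t =
  pact (gder [:: ((0, 1) : E, phi)] DX) (gder [:: ((0, 1) : E, phi)] DY)
    (fshift ((N%:R^-1, 0) : E)) (Dop gn T) (base_term h) (j, t%:Z).
Proof.
rewrite -(ldo_actE _ _ cstE dX dY (@pdxC F 'I_2) (@pdyC F 'I_2) (@pdxdyC F 'I_2)).
rewrite (_ : _ ++ _ = rcons [seq ((p.1, 0 : int), cst p.2) |
    p <- scale_exps N gn] ((0, 1), phi)) //.
rewrite cats1 -map_comp; congr rcons; apply: eq_map => p; congr pair.
rewrite /=; elim: (p.1) => [|k IH]; first by rewrite mul0r mulr0n.
by rewrite mulrS IH -natr1 mulrDl mul1r; apply: (congr2 pair); rewrite /= ?addr0 // addrC.
Qed.

Lemma pdx_phi : DX phi = mon (ucm (ord_max : 'I_2, (1, 0)%N)).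
Proof. exact: (iter_pd_indet F (ord_max : 'I_2) 1 0). Qed.

Lemma pdy_phi : DY phi = mon (ucm (ord_max : 'I_2, (0, 1)%N)).
Proof. exact: (iter_pd_indet F (ord_max : 'I_2) 0 1). Qed.

Lemma hdet_mon : h = mon (ucm (ord0 : 'I_2, (0, 0)%N)).
Proof. exact: (iter_pd_indet F (ord0 : 'I_2) 0 0). Qed.

Definition symb_form (Q : mpoly2 F) : R :=
  mlin (fun m => DX phi ^+ m i20 * DY phi ^+ m i21 * h) Q.

Definition op_form (P : mpoly2 F) : R :=
  mlin (fun m => iter (m i20) DX (iter (m i21) DY h)) P.

Lemma cm_eval_mlin (A : comNzRingType) (c : {rmorphism F -> A}) z n (f : 'X_{1..n} -> R) p :
  cm_eval c z (mlin f p) = \sum_(m <- msupp p) c p@_m * cm_eval c z (f m).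
Proof.
rewrite /mlin raddf_sum; apply: eq_bigr => m _; exact: cm_evalZ.
Qed.

(** Specialising [h] to 1 and the first derivatives of [phi] to the two variables recovers [Q]. *)
Lemma symb_form_eq0 Q : symb_form Q = 0 -> Q = 0.
Proof.
pose z (v : dvar 'I_2) : mpoly2 F :=
  if v.1 == ord0 then 1 else if v.2 == (1, 0)%N then 'X_i20 else 'X_i21.
move=> /(congr1 (cm_eval (@mpolyC 2 F) z)); rewrite raddf0 cm_eval_mlin => <-.
rewrite [LHS]mpolyE; apply: eq_bigr => m _.
have ex : cm_eval (@mpolyC 2 F) z (DX phi) = 'X_i20 by rewrite pdx_phi cm_evalV.
have ey : cm_eval (@mpolyC 2 F) z (DY phi) = 'X_i21 by rewrite pdy_phi cm_evalV.
have eh : cm_eval (@mpolyC 2 F) z h = 1 by rewrite hdet_mon cm_evalV.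
by rewrite (rmorph_monom _ _ ex ey eh) mulr1 mul_mpolyC mpolyX2.
Qed.

(** The derivatives of [h] are independent variables; sending each to the corresponding monomial
    recovers [P]. *)
Lemma op_form_eq0 P : op_form P = 0 -> P = 0.
Proof.
pose z (v : dvar 'I_2) : mpoly2 F := 'X_[mn2 v.2.1 v.2.2].
move=> /(congr1 (cm_eval (@mpolyC 2 F) z)); rewrite raddf0 cm_eval_mlin => <-.
rewrite [LHS]mpolyE; apply: eq_bigr => m _.
by rewrite iter_pd_indet cm_evalV mul_mpolyC /z /= -mn2_eta.
Qed.

Definition eval_grad (f : F) (Q : mpoly2 F) : F :=
  \sum_(m <- msupp Q) Q@_m * (dx f ^+ m i20 * dy f ^+ m i21).

Lemma const_term (A B : comNzRingType) (k : {rmorphism A -> B}) q x y a b w :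
  k q * (k x ^+ a * k y ^+ b * w) = k (q * (x ^+ a * y ^+ b)) * w.
Proof. by rewrite !rmorphM !rmorphXn !mulrA. Qed.

Lemma sum_const_term (I : Type) (A B : comNzRingType) (k : {rmorphism A -> B}) (r : seq I)
    (q : I -> A) x y (a b : I -> nat) w :
  \sum_(i <- r) k (q i) * (k x ^+ a i * k y ^+ b i * w) =
  k (\sum_(i <- r) q i * (x ^+ a i * y ^+ b i)) * w.
Proof.
rewrite raddf_sum mulr_suml; apply: eq_bigr => i _; exact: const_term.
Qed.

Lemma cm_eval_symb_form (A : comNzRingType) (k : {rmorphism F -> A}) z Q f w :
  cm_eval k z (DX phi) = k (dx f) -> cm_eval k z (DY phi) = k (dy f) ->
  cm_eval k z h = w -> cm_eval k z (symb_form Q) = k (eval_grad f Q) * w.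
Proof.
move=> ex ey eh; rewrite cm_eval_mlin -sum_const_term; apply: eq_bigr => m _.
by congr (_ * _); apply: rmorph_monom.
Qed.

Lemma deval_symb_form Q f :
  deval cst DX DY (fun i => if i == ord0 then h else cst f) (symb_form Q) =
  cst (eval_grad f Q) * h.
Proof.
pose z := fun v : dvar 'I_2 => iter v.2.1 DX (iter v.2.2 DY
  (if v.1 == ord0 then h else malgC f)).
apply: (cm_eval_symb_form (k := malgC) (z := z)).
- by rewrite pdx_phi; apply: (etrans (cm_evalV _ _ _)); apply: pdxC.
- by rewrite pdy_phi; apply: (etrans (cm_evalV _ _ _)); apply: pdyC.
- by rewrite hdet_mon; apply: (etrans (cm_evalV _ _ _)); rewrite -hdet_mon.
Qed.

Lemma vanishes_symb_form Q f :
  vanishes_at_phi (symb_form Q) f <-> eval_grad f Q = 0.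
Proof.
rewrite /vanishes_at_phi (deval_symb_form Q f); split=> [|->]; last first.
  by rewrite [cst 0]raddf0 mul0r.
pose rho : {rmorphism R -> F} := cm_eval idfun (fun _ : dvar 'I_2 => 1).
have rc a : rho (cst a) = a by apply: (cm_evalC (idfun : {rmorphism F -> F})).
have rh : rho h = 1.
  by rewrite hdet_mon; apply: (cm_evalV (idfun : {rmorphism F -> F})).
exact: rmorph_eq0 (rc _) rh.
Qed.

Lemma deval_op_form P (h0 : F) :
  deval idfun dx dy (fun i : 'I_2 => if i == ord0 then h0 else 0) (op_form P) =
  mlin (fun m => iter (m i20) dx (iter (m i21) dy h0) : F^o) P.
Proof.
rewrite -[LHS]/(cm_eval idfun (fun v => iter v.2.1 dx (iter v.2.2 dy
  (if v.1 == ord0 then h0 else 0))) (op_form P)).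
rewrite (cm_eval_mlin idfun); apply: eq_bigr => m _.
by rewrite iter_pd_indet cm_evalV.
Qed.

Section Points.
Variables (N : nat) (gn : seq (nat * F)) (T : ldo F).
Local Notation S := (Dop gn T).
Local Notation g := (scale_exps N gn).

Lemma Ccoef_supp j t : Ccoef T g j t <> 0 ->
  exists m, [/\ m \in msupp S, level N m = j & (t <= ord2 m)%N].
Proof. rewrite Ccoef_hact; exact: (@hact_supp F R DX DY h phi N dX dY S j t). Qed.

Lemma Ccoef_top j t :
  (forall m, m \in msupp S -> level N m = j -> (ord2 m <= t)%N) ->
  Ccoef T g j t = symb_form (slice (fun m => (level N m == j) && (ord2 m == t)) S).
Proof. rewrite Ccoef_hact; exact: (@hact_top F R DX DY h phi N dX dY S j t). Qed.

Lemma Ccoef_bot j : Ccoef T g j 0 = op_form (slice (fun m => level N m == j) S).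
Proof. rewrite Ccoef_hact; exact: (@hact_bot F R DX DY h phi N dX dY S j). Qed.

Lemma BbarE j h0 : Bbar T g j h0 =
  mlin (fun m => iter (m i20) dx (iter (m i21) dy h0) : F^o)
    (slice (fun m => level N m == j) S).
Proof. by rewrite /Bbar Ccoef_bot deval_op_form. Qed.

Lemma iter_gder_nil (d : F -> F) k (H : rat -> F) s :
  iter k (gder [::] d) H s = iter k d (H s).
Proof. by elim: k s => [|k IH] s //=; rewrite /gder big_nil addr0 IH. Qed.

Lemma series_actE H s : series_act T g H s =
  \sum_(m <- msupp S) S@_m * iter (m i30) dx (iter (m i31) dy (H (s - level N m))).
Proof.
have E : g = [seq (N%:R^-1 *+ p.1, idfun p.2) | p <- gn] ++ [::] :> seq (rat * F).
  rewrite cats0; apply: eq_map => p; congr pair.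
  elim: (p.1) => [|k IH]; first by rewrite mul0r mulr0n.
  by rewrite [RHS]mulrS -IH -natr1 mulrDl mul1r addrC.
have /(congr1 (fun f => f s)) := ldo_actE (R := F^o) (c := idfun) (Dx := dx) (Dy := dy)
  [::] (N%:R^-1 : rat) (fun a r => erefl) (dx_derivation F) (dy_derivation F)
  (fun a => erefl) (fun a => erefl) (@dxdyC F) gn T H.
rewrite -E => act; apply: (etrans act); rewrite /pact /mlin fct_sumE; apply: eq_bigr => m _.
rewrite fctE /pterm iter_fshift !iter_gder_nil /level.
by congr (_ * iter _ _ (iter _ _ (H (_ - _)))); rewrite mulrC mulr_natr.
Qed.
End Points.
End Specialise.

(** * Weights and conjugation by one more exponential *)

Lemma eq_slice (F : fieldType) (P P' : pred 'X_{1..3}) (S : mpoly3 F) :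
  P =1 P' -> slice P S = slice P' S.
Proof. by move=> PP; apply: eq_bigr => m _; rewrite PP. Qed.

Section Weight.
Variables (F : diffField) (N : nat) (c : rat).
Hypothesis N0 : (0 < N)%N.
Local Notation A := (mpoly3 F).

Definition wt (m : 'X_{1..3}) : rat := level N m + c * (ord2 m)%:R.

Lemma wtD m m' : wt (m + m')%MM = wt m + wt m'.
Proof.
by rewrite /wt /level /ord2 !mnmDE addnACA natrD mulrDl [X in c * X]natrD mulrDr addrACA.
Qed.

Definition wtop (kappa : rat) : A -> mpoly2 F := slice (fun m => wt m == kappa).

Lemma level_inj m m' : level N m = level N m' -> m i32 = m' i32.
Proof.
have nz : (N%:R : rat)^-1 != 0 by rewrite invr_eq0 pnatr_eq0 -lt0n.
by move/(mulIf nz)/eqP; rewrite eqr_nat => /eqP.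
Qed.

Lemma wt_section kappa : section (fun m => wt m == kappa).
Proof.
move=> m m' /eqP e /eqP e' /front_inj[e0 e1]; apply: mn3P => //; apply: level_inj.
by move: e; rewrite -e' /wt /ord2 e0 e1 => /addIr.
Qed.

Lemma level_section j : section (fun m => level N m == j).
Proof.
by move=> m m' /eqP e /eqP e' /front_inj[e0 e1]; apply: mn3P => //; apply: level_inj; rewrite e.
Qed.

Lemma section_and P Q : section P -> section (fun m => P m && Q m).
Proof. by move=> s m m' /andP[Pm _] /andP[Pm' _]; apply: s. Qed.

Lemma slice_neq0 P (S : A) m : section P -> m \in msupp S -> P m -> slice P S != 0.
Proof.
move=> sP mS Pm; apply/eqP => /(congr1 (mcoeff (front m))); rewrite mcoeff_slice // mcoeff0.
by move/eqP; rewrite mcoeff_eq0 mS.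
Qed.

Definition in_wt (D : pred rat) (S : A) := forall m, m \in msupp S -> D (wt m).

Lemma in_wtD D S S' : in_wt D S -> in_wt D S' -> in_wt D (S + S').
Proof.
by move=> h h' m /msuppD_le; rewrite mem_cat => /orP[]; [apply: h|apply: h'].
Qed.

Lemma in_wtZ D a S : in_wt D S -> in_wt D (a *: S).
Proof. by move=> h m /msuppZ_le; apply: h. Qed.

Lemma in_wtS (D D' : pred rat) S : (forall x, D x -> D' x) -> in_wt D S -> in_wt D' S.
Proof. by move=> DD h m /h /DD. Qed.

Lemma in_wt0 D : in_wt D 0.
Proof. by move=> m; rewrite msupp0. Qed.

Lemma in_wtM (D D1 D2 : pred rat) S S' : (forall x y, D1 x -> D2 y -> D (x + y)) ->
  in_wt D1 S -> in_wt D2 S' -> in_wt D (S * S').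
Proof.
move=> DD h h' m /msuppM_le /allpairsP[[m1 m2] /= [m1S m2S ->]].
by rewrite wtD; apply: DD; [apply: h|apply: h'].
Qed.

Lemma in_wtX (D : pred rat) m : D (wt m) -> in_wt D 'X_[m].
Proof. by move=> Dm k; rewrite msuppX inE => /eqP ->. Qed.

Lemma in_wt_coefder D (d : F -> F) S : derivation d -> in_wt D S -> in_wt D (coefder d S).
Proof.
move=> dd h m; rewrite mcoeff_msupp mcoeff_coefder // => nz; apply: h.
by rewrite mcoeff_msupp; apply: contraNneq nz => ->; rewrite der0.
Qed.

Lemma wtop_lt kappa S : in_wt (fun x => x < kappa) S -> wtop kappa S = 0.
Proof.
move=> h; rewrite /wtop /slice /mlin big_seq big1 // => m /h lt.
by rewrite (lt_eqF lt) scaler0.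
Qed.

Definition at1 : {rmorphism A -> mpoly2 F} :=
  mmap (@mpolyC 2 F) (fun i : 'I_3 => nth 1 [:: 'X_i20; 'X_i21] i).

Lemma at1X m : at1 'X_[m] = 'X_[front m].
Proof.
apply: (etrans (mmapX _ _ _)); rewrite /mmap1 !big_ord_recr big_ord0 /= mul1r expr1n mulr1 [RHS]mpolyX2
  (mn2E0 (m i30)) (mn2E1 (m i30)).
by congr (_ ^+ (fun_of_multinom m _) * _ ^+ (fun_of_multinom m _)); apply: val_inj.
Qed.

Lemma at1E S : at1 S = mlin (fun m => 'X_[front m]) S.
Proof.
rewrite {1}[S]mpolyE raddf_sum; apply: eq_bigr => m _.
by apply: (etrans (mmapZ _ _ _ _)); rewrite -/(at1 'X_[m]) at1X mul_mpolyC.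
Qed.

Lemma wtop_hom kappa x S : in_wt (pred1 x) S ->
  wtop kappa S = if x == kappa then at1 S else 0.
Proof.
move=> h; rewrite at1E /wtop /slice /mlin [LHS]big_seq; case: ifP => xk.
  by rewrite [RHS]big_seq; apply: eq_bigr => m /h /eqP ->; rewrite xk.
by rewrite big1 // => m /h /eqP ->; rewrite xk scaler0.
Qed.

(* Conjugation by exp (f zeta^C) preserves the weight and, up to terms of     *)
(* lower weight, is the substitution d_x -> d_x + f_x zeta^C and              *)
(* d_y -> d_y + f_y zeta^C.                                                   *)
Section Conjugation.
Variables (C : nat) (f : F).
Hypotheses (C0 : (0 < C)%N) (cE : c = C%:R / N%:R).
Local Notation LX := (Lx [:: (C, f)]).
Local Notation LY := (Ly [:: (C, f)]).
Local Notation X' := ('X_i30 + dx f *: 'X_i32 ^+ C : A).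
Local Notation Y' := ('X_i31 + dy f *: 'X_i32 ^+ C : A).

Let c0 : 0 < c.
Proof. by rewrite cE divr_gt0 ?ltr0n. Qed.

Let wt_zeta k : wt (U_(i32) *+ k)%MM = k%:R / N%:R.
Proof. by rewrite /wt /level /ord2 !mulmnE !mnm1E /= mul1n !mul0n mulr0 addr0. Qed.

Lemma wt_X' : in_wt (pred1 c) X'.
Proof.
apply: in_wtD; first by apply: in_wtX; rewrite /= /wt /level /ord2 !mnm1E /= mul0r add0r mulr1.
by apply: in_wtZ; rewrite mpolyXn; apply: in_wtX; rewrite /= wt_zeta cE.
Qed.

Lemma wt_Y' : in_wt (pred1 c) Y'.
Proof.
apply: in_wtD; first by apply: in_wtX; rewrite /= /wt /level /ord2 !mnm1E /= mul0r add0r mulr1.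
by apply: in_wtZ; rewrite mpolyXn; apply: in_wtX; rewrite /= wt_zeta cE.
Qed.

Lemma LxE1 S : LX S = coefder dx S + X' * S.
Proof. by rewrite /Lx /gradx big_seq1. Qed.

Lemma LyE1 S : LY S = coefder dy S + Y' * S.
Proof. by rewrite /Ly /grady big_seq1. Qed.

(** Induction step for leading terms: [coefder] keeps the weight, whereas [V] raises it by [c > 0],
    so only [V * G] reaches the top weight. *)
Lemma conj_step (d : F -> F) (U G V : A) (x : rat) : derivation d -> in_wt (pred1 c) V ->
  in_wt (pred1 x) G -> in_wt (fun y => y < x) (U - G) ->
  in_wt (pred1 (c + x)) (V * G) /\
  in_wt (fun y => y < c + x) (coefder d U + V * U - V * G).
Proof.
move=> dd Vc Gx UG; split; first by apply: in_wtM Vc Gx => y z /eqP -> /eqP ->; rewrite /= eqxx.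
rewrite -addrA -mulrBr; apply: in_wtD; last first.
  by apply: in_wtM Vc UG => y z /eqP -> zx; rewrite /= ltrD2l.
apply: in_wt_coefder => //; rewrite -(subrK G U); apply: in_wtD.
  by apply: in_wtS UG => y yx; apply: lt_le_trans yx _; rewrite lerDr ltW.
by apply: in_wtS Gx => y /eqP ->; rewrite ltrDr.
Qed.

Lemma conj_monomial a b :
  in_wt (pred1 (c * (a + b)%:R)) (X' ^+ a * Y' ^+ b) /\
  in_wt (fun y => y < c * (a + b)%:R) (iter a LX (iter b LY 1) - X' ^+ a * Y' ^+ b).
Proof.
have cS k : c + c * k%:R = c * k.+1%:R by rewrite -natr1 mulrDr mulr1 addrC.
elim: a => [|a [G U]].
  elim: b => [|b [G U]] /=.
    rewrite !expr0 mulr1 subrr mulr0; split; last exact: in_wt0.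
    by rewrite -mpolyX0; apply: in_wtX; rewrite /= /wt /level /ord2 !mnm0E mul0r add0r mulr0.
  have [G' U'] := conj_step (dy_derivation F) wt_Y' G U.
  by rewrite addnS -cS exprS mulrCA LyE1.
have [G' U'] := conj_step (dx_derivation F) wt_X' G U.
by rewrite addSn -cS exprS -mulrA iterS LxE1.
Qed.

Definition gradf (i : 'I_2) : F := if i == i20 then dx f else dy f.

End Conjugation.
End Weight.
Arguments at1 {F}.

Definition tshift (F : fieldType) (v : 'I_2 -> F) : mpoly2 F -> mpoly2 F :=
  mmap (@mpolyC 2 F) (fun i => 'X_i + (v i)%:MP).

Lemma tshiftX (F : fieldType) (v : 'I_2 -> F) m : tshift v 'X_[m] =
  ('X_i20 + (v i20)%:MP) ^+ m i20 * ('X_i21 + (v i21)%:MP) ^+ m i21.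
Proof.
apply: (etrans (mmapX _ _ _)); rewrite /mmap1 !big_ord_recr big_ord0 /= mul1r.
by rewrite (_ : widen_ord _ _ = i20) 1?(_ : ord_max = i21) //; apply: val_inj.
Qed.

Lemma tshiftE (F : fieldType) (v : 'I_2 -> F) Q :
  tshift v Q = mlin (fun m => tshift v 'X_[m]) Q.
Proof.
rewrite {1}[Q]mpolyE /tshift raddf_sum; apply: eq_bigr => m _.
by apply: (etrans (mmapZ _ _ _ _)); rewrite mul_mpolyC.
Qed.

Lemma wtop_sum (F : diffField) N c kappa (I : Type) (r : seq I) (a : I -> F) (E : I -> mpoly3 F) :
  wtop N c kappa (\sum_(i <- r) a i *: E i) = \sum_(i <- r) a i *: wtop N c kappa (E i).
Proof.
rewrite /wtop /slice mlin_sum; apply: eq_bigr => i _; exact: mlinZ.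
Qed.

Section Step.
Variables (F : diffField) (N C : nat) (c : rat) (f : F).
Hypotheses (N0 : (0 < N)%N) (C0 : (0 < C)%N) (cE : c = C%:R / N%:R).
Local Notation A := (mpoly3 F).
Local Notation LX := (Lx [:: (C, f)]).
Local Notation LY := (Ly [:: (C, f)]).
Local Notation zeta := (fun H : A => 'X_i32 * H).

Lemma iter_zeta k (H : A) : iter k zeta H = 'X_i32 ^+ k * H.
Proof. by elim: k => [|k IH] /=; rewrite ?mul1r // IH exprS mulrA. Qed.

(** Conjugations are performed one after the other: the first normal form acts through operators
    already twisted by the last exponential. *)
Lemma Dop_rcons gn (T : ldo F) :
  Dop (rcons gn (C, f)) T = pact LX LY zeta (Dop gn T) 1.
Proof.
have tx : twist zeta dx LX gn = Lx (rcons gn (C, f)).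
  apply/funext => H; rewrite /twist /Lx /gradx big_seq1 -cats1 big_cat big_seq1 /=.
  rewrite -addrA; congr (_ + _); rewrite [X in _ = ('X_i30 + X) * H]addrC addrA [RHS]mulrDl.
  by congr (_ + _); rewrite mulr_suml; apply: eq_bigr => p _; rewrite iter_zeta scalerAl.
have ty : twist zeta dy LY gn = Ly (rcons gn (C, f)).
  apply/funext => H; rewrite /twist /Ly /grady big_seq1 -cats1 big_cat big_seq1 /=.
  rewrite -addrA; congr (_ + _); rewrite [X in _ = ('X_i31 + X) * H]addrC addrA [RHS]mulrDl.
  by congr (_ + _); rewrite mulr_suml; apply: eq_bigr => p _; rewrite iter_zeta scalerAl.
rewrite (pact_Dop (LxD _) (LxZ _) (LyD _) (LyZ _)) ?tx ?ty //.
- by move=> H K; rewrite mulrDr.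
- by move=> a H; rewrite scalerAr.
- exact: LxyC.
- by move=> H; rewrite Lx_zeta.
- by move=> H; rewrite Ly_zeta.
Qed.

(** Each monomial [m] becomes [U m], which agrees with its substituted form [G m] up to lower weight
    ([conj_monomial]). Setting [zeta] to 1 in [G m] gives the monomial translated by [grad f]. *)
Theorem wtop_Dop_rcons gn (T : ldo F) kappa :
  in_wt N c (fun x => x <= kappa) (Dop gn T) ->
  in_wt N c (fun x => x <= kappa) (Dop (rcons gn (C, f)) T) /\
  wtop N c kappa (Dop (rcons gn (C, f)) T) =
    tshift (gradf f) (wtop N c kappa (Dop gn T)).
Proof.
move=> bd; set S := Dop gn T.
pose G m : A := 'X_i32 ^+ m i32 * (('X_i30 + dx f *: 'X_i32 ^+ C) ^+ m i30 *
  ('X_i31 + dy f *: 'X_i32 ^+ C) ^+ m i31).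
pose U m : A := 'X_i32 ^+ m i32 * iter (m i30) LX (iter (m i31) LY 1).
have wz k : in_wt N c (pred1 (k%:R / N%:R)) ('X_i32 ^+ k : A).
  rewrite mpolyXn; apply: in_wtX.
  by rewrite /= /wt /level /ord2 !mulmnE !mnm1E /= mul1n !mul0n mulr0 addr0.
have wG m : in_wt N c (pred1 (wt N c m)) (G m).
  have [g _] := conj_monomial N0 f C0 cE (m i30) (m i31).
  by apply: in_wtM (wz (m i32)) g => x y /eqP -> /eqP ->; rewrite /= eqxx.
have wU m : in_wt N c (fun x => x < wt N c m) (U m - G m).
  have [_ u] := conj_monomial N0 f C0 cE (m i30) (m i31).
  rewrite /U /G -mulrBr.
  by apply: in_wtM (wz (m i32)) u => x y /eqP -> yl; rewrite /= ltrD2l.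
have SE : Dop (rcons gn (C, f)) T = \sum_(m <- msupp S) S@_m *: U m.
  by rewrite Dop_rcons; apply: eq_bigr => m _; rewrite /pterm iter_zeta.
have UE m : U m = G m + (U m - G m) by rewrite addrC subrK.
split.
  rewrite SE big_seq; elim/big_ind: _ => [||m mS]; first exact: in_wt0.
    by move=> *; apply: in_wtD.
  apply: in_wtZ; rewrite UE; apply: in_wtD.
    by apply: in_wtS (wG m) => x /eqP ->; apply: bd.
  by apply: in_wtS (wU m) => x /ltW /le_trans; apply; apply: bd.
rewrite SE wtop_sum tshiftE {2}/wtop mlin_slice [RHS]big_seq_cond [RHS]big_mkcond.
rewrite [LHS]big_seq [LHS]big_mkcond; apply: eq_bigr => m _.
have [mS|//] := boolP (m \in msupp S).
rewrite andTb UE {1}/wtop /slice mlinD -!/(slice _ _) -!/(wtop N c kappa _).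
rewrite (wtop_hom kappa (wG m)) (@wtop_lt _ N c kappa (U m - G m)); last first.
  by apply: in_wtS (wU m) => x xl; apply: lt_le_trans xl _; apply: bd.
rewrite addr0; case: ifP => _; last by rewrite scaler0.
congr (_ *: _); rewrite tshiftX /G.
have vX i : at1 ('X_i : A) = nth 1 [:: 'X_i20; 'X_i21] i by apply: (etrans (mmapX _ _ _)); rewrite mmap1U.
have vZ a (p : A) : at1 (a *: p) = a *: at1 p.
  by apply: (etrans (mmapZ _ _ _ _)); rewrite mul_mpolyC.
rewrite !(rmorphM, rmorphXn, rmorphD) !vZ !rmorphXn !vX /= !expr1n mul1r.
by rewrite -!mul_mpolyC !mulr1.
Qed.
End Step.

(** * Order of vanishing of binary polynomials *)

Section Poly2.
Variable F : fieldType.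
Local Notation A := (mpoly2 F).
Implicit Types (P Q : A) (v : 'I_2 -> F).

Lemma mpoly2_ind (P : A -> Prop) : (forall p q, P p -> P q -> P (p + q)) ->
  (forall p q, P p -> P q -> P (p * q)) -> (forall c, P c%:MP) ->
  P 'X_i20 -> P 'X_i21 -> forall p, P p.
Proof.
move=> PD PM PC P0 P1; have P1' : P 1 by rewrite -mpolyC1.
have Pexp q k : P q -> P (q ^+ k).
  by move=> Pq; elim: k => [|k IH]; rewrite ?expr0 // exprS; apply: PM.
elim/mpolyind => [|c m p _ _ IH]; first by rewrite -mpolyC0.
apply: PD => //; rewrite -mul_mpolyC mpolyX2.
by apply: (PM) => //; apply: (PM); apply: Pexp.
Qed.

Lemma tshiftC v c : tshift v c%:MP = c%:MP.
Proof. exact: mmapC. Qed.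

Lemma tshiftD v P Q : tshift v (P + Q) = tshift v P + tshift v Q.
Proof. exact: (rmorphD (mmap _ _)). Qed.

Lemma tshiftM v P Q : tshift v (P * Q) = tshift v P * tshift v Q.
Proof. exact: (rmorphM (mmap _ _)). Qed.

Lemma tshiftXU v i : tshift v 'X_i = 'X_i + (v i)%:MP.
Proof. by apply: (etrans (mmapX _ _ _)); rewrite mmap1U. Qed.

Lemma tshiftZ v c Q : tshift v (c *: Q) = c *: tshift v Q.
Proof. by rewrite -!mul_mpolyC tshiftM tshiftC. Qed.

Lemma tshiftK v : cancel (tshift v) (tshift (fun i => - v i)).
Proof.
have tX i : tshift (fun i => - v i) (tshift v 'X_i) = 'X_i.
  by rewrite tshiftXU tshiftD tshiftC tshiftXU mpolyCN addrNK.
apply: mpoly2_ind => [p q ep eq|p q ep eq|c||] //.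
- by rewrite !tshiftD ep eq.
- by rewrite !tshiftM ep eq.
- by rewrite !tshiftC.
Qed.

Lemma tshift_eq0 v Q : tshift v Q = 0 -> Q = 0.
Proof. by move/(congr1 (tshift (fun i => - v i))); rewrite tshiftK => ->; exact: (rmorph0 (mmap _ _)). Qed.

Lemma mderivXU i j : mderiv i 'X_j = (j == i)%:R%:MP :> A.
Proof.
rewrite mderivX mnm1E; case: (j =P i) => [->|_]; last by rewrite scale0r mpolyC0.
rewrite scale1r (_ : _ - _ = 0)%MM ?mpolyX0 //.
by apply/mnmP => k; rewrite mnmBE subnn mnm0E.
Qed.

Lemma mderiv_tshift v i Q : mderiv i (tshift v Q) = tshift v (mderiv i Q).
Proof.
move: Q; apply: mpoly2_ind.
- by move=> p q ep eq; rewrite tshiftD !mderivD ep eq tshiftD.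
- by move=> p q ep eq; rewrite tshiftM !mderivM ep eq tshiftD !tshiftM.
- by move=> c; rewrite tshiftC !mderivC -mpolyC0 tshiftC.
- by rewrite tshiftXU mderivD mderivC addr0 mderivXU tshiftC.
- by rewrite tshiftXU mderivD mderivC addr0 mderivXU tshiftC.
Qed.

(** Mostly used as [low e (tshift v Q)], which says that [Q] vanishes at [v] to order at least
    [e]. *)
Definition low e Q := forall m, m \in msupp Q -> (e <= mdeg m)%N.
Definition high e Q := forall m, m \in msupp Q -> (mdeg m <= e)%N.

Lemma lowD e P Q : low e P -> low e Q -> low e (P + Q).
Proof.
by move=> h h' m /msuppD_le; rewrite mem_cat => /orP[]; [apply: h|apply: h'].
Qed.

Lemma lowZ e c Q : low e Q -> low e (c *: Q).
Proof. by move=> h m /msuppZ_le; apply: h. Qed.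

Lemma lowW e e' Q : (e' <= e)%N -> low e Q -> low e' Q.
Proof. by move=> le h m /h; apply: leq_trans. Qed.

Lemma lowM e P Q : low e Q -> low e (P * Q).
Proof.
move=> h m /msuppM_le /allpairsP[[m1 m2] /= [_ m2Q ->]].
by rewrite mdegD (leq_trans (h _ m2Q)) ?leq_addl.
Qed.

Lemma low_mderiv e i Q : low e.+1 Q -> low e (mderiv i Q).
Proof.
move=> h m; rewrite mcoeff_msupp mcoeff_deriv => nz.
have /h : (m + U_(i))%MM \in msupp Q.
  by rewrite mcoeff_msupp; apply: contraNneq nz => ->; rewrite mul0rn.
by rewrite mdegD mdeg1 addn1.
Qed.

Definition euler Q : A := 'X_i20 * mderiv i20 Q + 'X_i21 * mderiv i21 Q.

Lemma XmderivX i (m : 'X_{1..2}) : 'X_i * mderiv i 'X_[m] = (m i)%:R *: 'X_[m] :> A.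
Proof.
rewrite mderivX -scalerAr -mpolyXD; have [->|mi] := posnP (m i); first by rewrite !scale0r.
by rewrite addmC submK // lep1mP -lt0n.
Qed.

Lemma mcoeff_euler Q m : (euler Q)@_m = (mdeg m)%:R * Q@_m.
Proof.
have -> : euler Q = mlin (fun m => (mdeg m)%:R *: 'X_[m]) Q.
  rewrite /euler {1 2}[Q]mpolyE !raddf_sum !mulr_sumr -big_split; apply: eq_bigr => k _.
  rewrite /= !mderivZ -!scalerAr !XmderivX -scalerDr -scalerDl mdeg2 natrD //.
rewrite mcoeff_mlin; have [mQ|mQ] := boolP (m \in msupp Q).
  rewrite (bigD1_seq m) ?msupp_uniq //= big1 ?addr0 => [|i im].
    by rewrite mcoeffZ mcoeffX eqxx mulr1 mulrC.
  by rewrite mcoeffZ mcoeffX (negbTE im) !mulr0.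
rewrite (memN_msupp_eq0 mQ) mulr0 big_seq big1 // => i iQ.
by rewrite mcoeffZ mcoeffX; case: (i =P m) mQ => [<-|_ _]; rewrite ?iQ ?mulr0.
Qed.

Definition kill (t : nat) Q : A := euler Q - t%:R *: Q.

Lemma mcoeff_kill t Q m : (kill t Q)@_m = ((mdeg m)%:R - t%:R) * Q@_m.
Proof. by rewrite mcoeffB mcoeff_euler mcoeffZ mulrBl. Qed.

(** Partial derivatives commute with translation and lower the order of vanishing by at most one;
    multiplication by polynomials does not lower it. *)
Lemma low_kill v e t Q : low e (tshift v Q) -> low e.-1 (tshift v (kill t Q)).
Proof.
case: e => [|e] h; first by move=> m _.
rewrite /kill -scaleNr tshiftD tshiftZ; apply: lowD; last by apply: lowZ; apply: lowW h.
rewrite /euler tshiftD !tshiftM -!mderiv_tshift.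
by apply: lowD; apply: lowM; apply: low_mderiv.
Qed.

Lemma mcoeff_kills ts Q m :
  (foldr kill Q ts)@_m = (\prod_(t <- ts) ((mdeg m)%:R - t%:R)) * Q@_m.
Proof.
elim: ts => [|t ts IH] /=; first by rewrite big_nil mul1r.
by rewrite mcoeff_kill IH big_cons mulrA.
Qed.

Lemma low_kills v e ts Q :
  low e (tshift v Q) -> low (e - size ts) (tshift v (foldr kill Q ts)).
Proof.
move=> h; elim: ts => [|t ts IH] /=; first by rewrite subn0.
by rewrite subnS; apply: low_kill.
Qed.

Lemma high_tshift v e Q : high e Q -> high e (tshift v Q).
Proof.
have hM a b P R : high a P -> high b R -> high (a + b) (P * R).
  move=> h h' m /msuppM_le /allpairsP[[m1 m2] /= [m1P m2R ->]].
  by rewrite mdegD leq_add ?h ?h'.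
have h1 : high 0 1 by move=> m; rewrite msupp1 inE => /eqP ->; rewrite mdeg0.
have hX i : high 1 ('X_i + (v i)%:MP).
  move=> m /msuppD_le; rewrite mem_cat msuppX inE => /orP[/eqP->|]; first by rewrite mdeg1.
  by rewrite msuppC; case: eqP => // _; rewrite inE => /eqP ->; rewrite mdeg0.
have hexp i k : high k (('X_i + (v i)%:MP) ^+ k).
  by elim: k => [|k IH]; rewrite ?expr0 // exprS -add1n; apply: hM.
move=> h; rewrite tshiftE /mlin big_seq; elim/big_ind: _ => [||m mQ].
- by move=> m; rewrite msupp0.
- by move=> P R hP hR m /msuppD_le; rewrite mem_cat => /orP[]; [apply: hP|apply: hR].
move=> k /msuppZ_le; rewrite tshiftX => kX; apply: leq_trans (h _ mQ).
have hh := hM _ _ _ _ (hexp i20 (m i20)) (hexp i21 (m i21)).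
by rewrite (mdeg2 m); apply: hh.
Qed.

Lemma msupp_neq0 (p : A) : p != 0 -> exists m, m \in msupp p.
Proof.
by rewrite -msupp_eq0; case: (msupp p) => // m s _; exists m; rewrite inE eqxx.
Qed.

(* The operator [euler - t] kills the part of degree [t], multiplies the part *)
(* of degree [t0] by a non-zero constant, and lowers the order of vanishing   *)
(* at [v] by at most 1.                                                       *)
Theorem order_le_degrees v e t0 ts Q : [pchar F] =i pred0 -> t0 \notin ts ->
  (forall m, m \in msupp Q -> (mdeg m == t0) || (mdeg m \in ts)) ->
  (exists2 m, m \in msupp Q & mdeg m = t0) ->
  low e (tshift v Q) -> (e <= t0 + size ts)%N.
Proof.
move=> ch0 t0ts degs [m mQ mt0] le; set P := foldr kill Q ts.
have natF k l : (k%:R == l%:R :> F) = (k == l) := eqr_nat_pchar0 ch0 k l.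
have hP : high t0 P.
  move=> k; rewrite mcoeff_msupp mcoeff_kills mulf_eq0 negb_or => /andP[pr].
  rewrite -mcoeff_msupp => /degs /orP[/eqP -> //|kts].
  case/negP: pr; rewrite prodf_seq_eq0; apply/hasP.
  by exists (mdeg k) => //=; rewrite subrr eqxx.
have P0 : tshift v P != 0.
  apply/eqP => /tshift_eq0 /(congr1 (mcoeff m)); rewrite mcoeff_kills mcoeff0.
  move/eqP; rewrite mulf_eq0 mcoeff_eq0 mQ orbF prodf_seq_eq0 => /hasP[t tts].
  by rewrite /= subr_eq0 mt0 natF => /eqP t0t; rewrite t0t tts in t0ts.
have [k kP] := msupp_neq0 P0.
(* A non-zero polynomial of degree at most [t0] vanishes at [v] to order at most [t0]. *)
have := leq_trans (low_kills (ts := ts) le kP) (high_tshift hP kP).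
by rewrite leq_subLR addnC.
Qed.
End Poly2.

(** * Binary forms vanishing at a point *)

Lemma cramer0 (B : comNzRingType) (v0 v1 u0 u1 i x y : B) : (v0 * u1 - v1 * u0) * i = 1 ->
  v0 * (u1 * i * x - u0 * i * y) + u0 * (v0 * i * y - v1 * i * x) = x.
Proof. by move=> e; rewrite -[RHS]mul1r -e; ring. Qed.

Lemma cramer1 (B : comNzRingType) (v0 v1 u0 u1 i x y : B) : (v0 * u1 - v1 * u0) * i = 1 ->
  v1 * (u1 * i * x - u0 * i * y) + u1 * (v0 * i * y - v1 * i * x) = y.
Proof. by move=> e; rewrite -[RHS]mul1r -e; ring. Qed.

Section BinaryForm.
Variable F : fieldType.
Local Notation A := (mpoly2 F).
Implicit Types p : A.

Definition subst2 (B : comNzRingType) (k : {rmorphism F -> B}) (x y : B) (p : A) : B :=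
  mmap k (fun i => if i == i20 then x else y) p.

Section Subst.
Variables (B : comNzRingType) (k : {rmorphism F -> B}) (x y : B).
Local Notation sub := (subst2 k x y).

Lemma subst2D p q : sub (p + q) = sub p + sub q.
Proof. exact: (rmorphD (mmap k _)). Qed.

Lemma subst2M p q : sub (p * q) = sub p * sub q.
Proof. exact: (rmorphM (mmap k _)). Qed.

Lemma subst2Xn p n : sub (p ^+ n) = sub p ^+ n.
Proof. exact: (rmorphXn (mmap k _)). Qed.

Lemma subst2C c : sub c%:MP = k c.
Proof. exact: mmapC. Qed.

Lemma subst2X0 : sub 'X_i20 = x.
Proof. by rewrite /subst2 mmapX mmap1U. Qed.

Lemma subst2X1 : sub 'X_i21 = y.
Proof. by rewrite /subst2 mmapX mmap1U. Qed.

Lemma subst2Z c p : sub (c *: p) = k c * sub p.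
Proof. exact: mmapZ. Qed.

Lemma subst2Xm m : sub 'X_[m] = x ^+ m i20 * y ^+ m i21.
Proof. by rewrite mpolyX2 subst2M !subst2Xn subst2X0 subst2X1. Qed.

Lemma subst2E p : sub p = \sum_(m <- msupp p) k p@_m * (x ^+ m i20 * y ^+ m i21).
Proof.
have sub0 : sub 0 = 0 by exact: (raddf0 (mmap k _)).
rewrite {1}[p]mpolyE (big_morph sub subst2D sub0).
by apply: eq_bigr => m _; rewrite subst2Z subst2Xm.
Qed.

Lemma subst2_uniq (f : A -> B) : (forall p q, f (p + q) = f p + f q) ->
  (forall p q, f (p * q) = f p * f q) -> (forall c, f c%:MP = k c) ->
  f 'X_i20 = x -> f 'X_i21 = y -> forall p, f p = sub p.
Proof.
move=> fD fM fC f0 f1; apply: mpoly2_ind => [p q ep eq|p q ep eq|c||].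
- by rewrite fD subst2D ep eq.
- by rewrite fM subst2M ep eq.
- by rewrite fC subst2C.
- by rewrite f0 subst2X0.
- by rewrite f1 subst2X1.
Qed.
End Subst.

Definition isform n p := forall m, m \in msupp p -> mdeg m = n.

Lemma formM a b (p q : A) : isform a p -> isform b q -> isform (a + b) (p * q).
Proof.
move=> hp hq m /msuppM_le /allpairsP[[m1 m2] /= [m1p m2q ->]].
by rewrite mdegD hp ?hq.
Qed.

Lemma formD n (p q : A) : isform n p -> isform n q -> isform n (p + q).
Proof. by move=> hp hq m /msuppD_le; rewrite mem_cat => /orP[]; [apply: hp|apply: hq]. Qed.

Lemma formZ n c (p : A) : isform n p -> isform n (c *: p).
Proof. by move=> hp m /msuppZ_le; apply: hp. Qed.

Lemma formX i : isform 1 ('X_i : A).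
Proof. by move=> m; rewrite msuppX inE => /eqP ->; rewrite mdeg1. Qed.

Lemma formXn n k (p : A) : isform n p -> isform (k * n) (p ^+ k).
Proof.
move=> hp; elim: k => [|k IH]; first by move=> m; rewrite expr0 msupp1 inE => /eqP ->; rewrite mdeg0.
by rewrite exprS mulSn; apply: formM.
Qed.

Lemma form_subst2 n (p x y : A) : isform n p -> isform 1 x -> isform 1 y ->
  isform n (subst2 (@mpolyC 2 F) x y p).
Proof.
move=> hp hx hy; rewrite subst2E big_seq; elim/big_ind: _ => [m|p1 p2|m mp].
- by rewrite msupp0.
- exact: formD.
rewrite mul_mpolyC; apply: formZ; rewrite -(hp _ mp) mdeg2 -[X in (X + _)%N]muln1 -[X in (_ + X)%N]muln1.
by apply: formM; apply: formXn.
Qed.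

(* In coordinates in which [v] is a basis vector, a form vanishing to order   *)
(* [e] at [v] is divisible by the [e]-th power of the other coordinate.       *)
Theorem form_order n e p (v : 'I_2 -> F) : isform n p -> (v i20 != 0) || (v i21 != 0) ->
  low e (tshift v p) -> exists s, p = (v i20 *: 'X_i21 - v i21 *: 'X_i20) ^+ e * s.
Proof.
move=> hp v0 le.
have [u det0] : exists u : 'I_2 -> F, v i20 * u i21 - v i21 * u i20 != 0.
  have [v00|v00] := eqVneq (v i20) 0.
    exists (fun i => if i == i20 then 1 else 0); rewrite /= mulr0 mulr1 sub0r oppr_eq0.
    by move: v0; rewrite v00 eqxx.
  by exists (fun i => if i == i20 then 0 else 1); rewrite /= mulr0 mulr1 subr0.
set det := _ - _ in det0.
pose x : A := v i20 *: 'X_i20 + u i20 *: 'X_i21.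
pose y : A := v i21 *: 'X_i20 + u i21 *: 'X_i21.
pose x' : A := (u i21 / det) *: 'X_i20 - (u i20 / det) *: 'X_i21.
pose y' : A := (v i20 / det) *: 'X_i21 - (v i21 / det) *: 'X_i20.
pose sg := subst2 (@mpolyC 2 F) x y; pose sg' := subst2 (@mpolyC 2 F) x' y'.
have sgK q : sg' (sg q) = q.
  have di : ((v i20)%:MP * (u i21)%:MP - (v i21)%:MP * (u i20)%:MP) * det^-1%:MP = 1 :> A.
    by rewrite -!mpolyCM -mpolyCB -mpolyCM divff // mpolyC1.
  move: q; apply: mpoly2_ind => [q r eq er|q r eq er|c||].
  - by rewrite -[in RHS]eq -[in RHS]er /sg' /sg !subst2D.
  - by rewrite -[in RHS]eq -[in RHS]er /sg' /sg !subst2M.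
  - by rewrite /sg /sg' !subst2C.
  - rewrite /sg subst2X0 /x /sg' subst2D !subst2Z subst2X0 subst2X1.
    by rewrite /x' /y' -!mul_mpolyC !mpolyCM (cramer0 _ _ di).
  - rewrite /sg subst2X1 /y /sg' subst2D !subst2Z subst2X0 subst2X1.
    by rewrite /x' /y' -!mul_mpolyC !mpolyCM (cramer1 _ _ di).
pose q := sg p.
have hq : isform n q.
  by apply: form_subst2 => //; apply: formD; apply: formZ; apply: formX.
have lq m : m \in msupp q -> (e <= m i21)%N.
  move=> mq; rewrite leqNgt; apply/negP => me.
  (* Restriction to the line [v + t u]: the polynomial [q(1, t) = p(v + t u)] is divisible by [t^e].
     As [q] is homogeneous, each of its monomials contributes a different power of [t]. *)
  pose ka := subst2 (@polyC F) (u i20 *: 'X) (u i21 *: 'X).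
  have E : subst2 (@polyC F) 1 'X q = ka (tshift v p).
    rewrite /q; apply: etrans (_ : subst2 (@polyC F) ((v i20)%:P + u i20 *: 'X)
      ((v i21)%:P + u i21 *: 'X) p = _).
      apply: (subst2_uniq (f := fun r => subst2 (@polyC F) 1 'X (sg r))) => [r r'|r r'|c||].
      - by rewrite /sg !subst2D.
      - by rewrite /sg !subst2M.
      - by rewrite /sg !subst2C.
      - rewrite /sg subst2X0 /x subst2D !subst2Z subst2X0 subst2X1 mulr1.
        by rewrite mul_polyC.
      - rewrite /sg subst2X1 /y subst2D !subst2Z subst2X0 subst2X1 mulr1.
        by rewrite mul_polyC.
    apply/esym; apply: (subst2_uniq (f := fun r => ka (tshift v r))) => [r r'|r r'|c||].
    - by rewrite tshiftD /ka subst2D.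
    - by rewrite tshiftM /ka subst2M.
    - by rewrite tshiftC /ka subst2C.
    - by rewrite tshiftXU /ka subst2D subst2X0 subst2C addrC.
    - by rewrite tshiftXU /ka subst2D subst2X1 subst2C addrC.
  have /eqP := congr1 (fun r : {poly F} => r`_(m i21)) E.
  rewrite /ka !subst2E !coef_sum big_seq [X in _ == X]big1_seq => [|k /andP[_ kp]].
    rewrite -big_seq (bigD1_seq m) ?msupp_uniq //= big1_seq ?addr0 => [|k /andP[km kq]].
      by rewrite expr1n mul1r coefCM coefXn eqxx mulr1 mcoeff_eq0 mq.
    rewrite expr1n mul1r coefCM coefXn; case: eqP => [e1|_]; last by rewrite mulr0.
    case/eqP: km; apply: mn2P => //; apply: (@addIn (m i21)).
    by rewrite {1}e1 -!mdeg2 !hq.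
  have -> a b : (u i20 *: 'X) ^+ a * (u i21 *: 'X) ^+ b =
      (u i20 ^+ a * u i21 ^+ b) *: 'X^(a + b).
    by rewrite !exprZn -scalerAl -scalerAr scalerA exprD.
  rewrite coefCM coefZ coefXn -mdeg2.
  by rewrite (ltn_eqF (leq_trans me (le _ kp))) !mulr0.
pose s := \sum_(m <- msupp q) q@_m *: 'X_[m - U_(i21) *+ e].
have qs : q = 'X_i21 ^+ e * s.
  rewrite {1}[q]mpolyE mulr_sumr big_seq [RHS]big_seq; apply: eq_bigr => m mq.
  rewrite -scalerAr mpolyXn -mpolyXD addmC submK //.
  by apply/mnm_lepP; apply: ord2_ind; rewrite mulmnE mnm1E ?mul0n // mul1n lq.
exists ((det^-1 ^+ e) *: sg' s).
rewrite -[LHS]sgK -/q qs /sg' subst2M subst2Xn subst2X1 -scalerAr scalerAl -exprZn.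
by congr (_ ^+ e * _); rewrite /y' scalerBr !scalerA ![det^-1 * _]mulrC.
Qed.
End BinaryForm.

(** * Solving equations in a differentially closed field *)

Lemma hmulE00 (K : comNzRingType) (a b : hseries K) : (a * b) 0%N 0%N = a 0%N 0%N * b 0%N 0%N.
Proof. by []. Qed.

Section Linearization.
Variables (K : comNzRingType) (phi0 : hseries K) (d1 d2 : hseries K -> hseries K).
Local Notation H := (hseries K).

(* At every [phi] with the 1-jet of [phi0], [N] has value [n0] at the origin  *)
(* and the leading part of its differential is [c1 d1 + c2 d2].               *)
Definition linearized (N : H -> H) (n0 c1 c2 : K) := forall phi, vanish 2 (phi - phi0) ->
  N phi 0%N 0%N = n0 /\ forall psi d, (0 < d)%N -> vanish d.+1 psi ->
    forall i j, (i + j <= d)%N ->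
    N (phi + psi) i j = N phi i j + (c1 * d1 psi i j + c2 * d2 psi i j).

Lemma linearizedC (a : H) : linearized (fun=> a) (a 0%N 0%N) 0 0.
Proof. by move=> phi _; split=> // *; rewrite !mul0r !addr0. Qed.

Lemma linearizedD M N m0 n0 c1 c2 e1 e2 :
  linearized M m0 c1 c2 -> linearized N n0 e1 e2 ->
  linearized (fun phi => M phi + N phi) (m0 + n0) (c1 + e1) (c2 + e2).
Proof.
move=> hM hN phi /[dup] /hM[M0 Ml] /hN[N0 Nl]; split=> [|psi d d0 v i j ij].
  by rewrite haddE M0 N0.
rewrite !haddE (Ml _ _ d0 v _ _ ij) (Nl _ _ d0 v _ _ ij) addrACA; congr (_ + _).
by rewrite !mulrDl addrACA.
Qed.

Hypotheses (d1v : forall d a, vanish d.+1 a -> vanish d (d1 a))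
  (d2v : forall d a, vanish d.+1 a -> vanish d (d2 a)).

(** The increments [mu] and [nu] vanish below degree [d]. Up to degree [d] they are therefore
    multiplied only by values at the origin, and [mu * nu] contributes nothing since [d > 0]. *)
Lemma linearizedM M N m0 n0 c1 c2 e1 e2 :
  linearized M m0 c1 c2 -> linearized N n0 e1 e2 ->
  linearized (fun phi => M phi * N phi) (m0 * n0)
    (m0 * e1 + n0 * c1) (m0 * e2 + n0 * c2).
Proof.
move=> hM hN phi /[dup] /hM[M0 Ml] /hN[N0 Nl]; split=> [|psi d d0 v i j ij].
  by rewrite hmulE00 M0 N0.
pose mu := M (phi + psi) - M phi; pose nu := N (phi + psi) - N phi.
have muE k l : (k + l <= d)%N -> mu k l = c1 * d1 psi k l + c2 * d2 psi k l.
  by move=> kl; rewrite /mu haddE hoppE (Ml _ _ d0 v _ _ kl) addrAC subrr add0r.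
have nuE k l : (k + l <= d)%N -> nu k l = e1 * d1 psi k l + e2 * d2 psi k l.
  by move=> kl; rewrite /nu haddE hoppE (Nl _ _ d0 v _ _ kl) addrAC subrr add0r.
have vmu : vanish d mu.
  by move=> k l kl; rewrite muE ?(ltnW kl) // (d1v v kl) (d2v v kl) !mulr0 addr0.
have vnu : vanish d nu.
  by move=> k l kl; rewrite nuE ?(ltnW kl) // (d1v v kl) (d2v v kl) !mulr0 addr0.
have -> : M (phi + psi) * N (phi + psi) = M phi * N phi + M phi * nu + N phi * mu + mu * nu.
  by rewrite /mu /nu; move: (M _) (M _) (N _) (N _) => a b a' b'; ring.
rewrite !haddE (hmul_vanish _ vnu ij) (hmul_vanish _ vmu ij) (hmul_vanish _ vnu ij).
rewrite M0 N0 (vmu 0%N 0%N d0) mul0r addr0 -addrA; congr (_ + _).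
rewrite nuE // muE //; move: (d1 _ _ _) (d2 _ _ _) => a b; ring.
Qed.

Hypotheses (d1D : forall a b i j, d1 (a + b) i j = d1 a i j + d1 b i j)
  (d2D : forall a b i j, d2 (a + b) i j = d2 a i j + d2 b i j).

Let d_near (d : H -> H) : (forall k a, vanish k.+1 a -> vanish k (d a)) ->
  (forall a b i j, d (a + b) i j = d a i j + d b i j) ->
  forall phi, vanish 2 (phi - phi0) -> d phi 0%N 0%N = d phi0 0%N 0%N.
Proof. by move=> dv dD phi v; rewrite -[phi](subrK phi0) dD (dv _ _ v) // add0r. Qed.

Lemma linearized_d1 : linearized d1 (d1 phi0 0%N 0%N) 1 0.
Proof.
move=> phi v; split=> [|psi d d0 vpsi i j ij]; first exact: d_near.
by rewrite d1D mul1r mul0r addr0.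
Qed.

Lemma linearized_d2 : linearized d2 (d2 phi0 0%N 0%N) 0 1.
Proof.
move=> phi v; split=> [|psi d d0 vpsi i j ij]; first exact: d_near.
by rewrite d2D mul1r mul0r add0r.
Qed.

Variables (F : comNzRingType) (k : {rmorphism F -> K}) (t : {rmorphism F -> H}).
Hypothesis tk : forall a, t a 0%N 0%N = k a.
Local Notation xi := (d1 phi0 0%N 0%N).
Local Notation eta := (d2 phi0 0%N 0%N).

Lemma linearized_ext M N m0 c1 c2 : M =1 N -> linearized M m0 c1 c2 -> linearized N m0 c1 c2.
Proof. by move=> /funext ->. Qed.

Lemma linearized_inner (c : {poly F}) : exists c1,
  linearized (fun phi => ev2 t (d1 phi) (d2 phi) c%:P) (ev2 k xi eta c%:P) c1 0.
Proof.
elim/poly_ind: c => [|c a [c1 IH]].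
  exists 0; rewrite !raddf0; apply: (linearized_ext (M := fun=> 0)).
    by move=> phi; rewrite !raddf0.
  exact: (linearizedC 0).
have L := linearizedD (linearizedM IH linearized_d1) (linearizedC (t a)).
move: L; rewrite !mulr0 !addr0 => L; eexists.
rewrite polyCD polyCM ev2D ev2M ev2CX ev2CC -tk.
apply: linearized_ext L => phi.
by rewrite ev2D ev2M ev2CX ev2CC.
Qed.

(** The chain rule. Only the coefficient along [d2], the partial derivative in the outer variable,
    must be known to be non-zero, so [c1] is left unspecified. *)
Lemma linearized_ev2 (P : {poly {poly F}}) : exists c1,
  linearized (fun phi => ev2 t (d1 phi) (d2 phi) P) (ev2 k xi eta P) c1 (ev2 k xi eta P^`()).
Proof.
elim/poly_ind: P => [|P c [c1 IH]].
  exists 0; rewrite !raddf0; apply: (linearized_ext (M := fun=> 0)).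
    by move=> phi; rewrite !raddf0.
  exact: (linearizedC 0).
have [c1' Lc] := linearized_inner c.
have L := linearizedD (linearizedM IH linearized_d2) Lc.
have e : ev2 k xi eta P * 1 + eta * ev2 k xi eta P^`() + 0 =
    ev2 k xi eta (P * 'X + c%:P)^`().
  by rewrite derivD derivM derivX derivC !addr0 !mulr1 ev2D ev2M ev2X mulrC addrC.
rewrite e in L; eexists; rewrite ev2D ev2M ev2X.
apply: linearized_ext L => phi.
by rewrite ev2D ev2M ev2X.
Qed.
End Linearization.

Section FormalSolution.
Variables (F : diffField) (K : fieldType) (k : {rmorphism F -> K}).
Local Notation H := (hseries K).
Local Notation tk := (taylor k).

Definition hd (b : bool) : H -> H := if b then @hdy K else @hdx K.

(** The gradient at the origin is prescribed to be the simple point, which settles degree 0. From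
    degree 1 on, [formal_solve] applies because the linearised equation has the non-zero coefficient
    [c2]. *)
Lemma formal_first_order (b : bool) (P : {poly {poly F}}) (x y : K) :
  ev2 k x y P = 0 -> ev2 k x y P^`() != 0 ->
  exists phi : H, [/\ hd b phi 0%N 0%N = x, hd (~~ b) phi 0%N 0%N = y &
    ev2 tk (hd b phi) (hd (~~ b) phi) P = 0].
Proof.
move=> P0 P'0.
pose phi0 : H := fun i j => if (i, j) == (1, 0)%N then (if b then y else x)
                 else if (i, j) == (0, 1)%N then (if b then x else y) else 0.
have e1 : hd b phi0 0%N 0%N = x by rewrite /hd /phi0; case: (b).
have e2 : hd (~~ b) phi0 0%N 0%N = y by rewrite /hd /phi0; case: (b).
have dv c d a : vanish d.+1 a -> vanish d (hd c a).
  by case: c; [exact: vanish_dy|exact: vanish_dx].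
have dD c (a a' : H) i j : hd c (a + a') i j = hd c a i j + hd c a' i j by case: c.
have [c1] := @linearized_ev2 _ phi0 _ _ (dv b) (dv (~~ b)) (dD b) (dD (~~ b))
  _ k tk (fun=> erefl) P.
rewrite e1 e2 P0; set c2 := ev2 k x y P^`() => L.
pose N phi := ev2 tk (hd b phi) (hd (~~ b) phi) P.
(* The index [a] counts derivatives in [x], so the coefficient [c1] of [hd b] has index 0 exactly
   when [b] holds. *)
pose c (a : nat) := if (a == 0%N) == b then c1 else c2.
have [||phi [near zero]] := @formal_solve _ N phi0 1 1 c.
- by exists (nat_of_bool b); [case: (b)|rewrite /c; case: (b)].
- move=> phi psi d near d0; rewrite !addn1 => v i j ij.
  have [_ Ll] := L _ near; rewrite /N (Ll _ _ d0 v _ _ ij) !big_ord_recr big_ord0 /= add0r.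
  by congr (_ + _); rewrite /c /hd; case: (b); rewrite /= ?subn0 ?subnn !addn0 !addn1 // addrC.
have near0 := near : vanish 2 (phi - phi0).
have phiE i j : (i + j < 2)%N -> phi i j = phi0 i j.
  by move=> /near0/eqP; rewrite haddE hoppE subr_eq0 => /eqP.
exists phi; split.
- by rewrite -e1 /hd; case: (b); apply: phiE.
- by rewrite -e2 /hd; case: (b); apply: phiE.
apply: hseriesP => i j; have [/eqP|ij] := posnP (i + j); last exact: zero.
by rewrite addn_eq0 => /andP[/eqP -> /eqP ->]; have [-> _] := L _ near.
Qed.

Hypothesis ch0 : [pchar K] =i pred0.

(** Hurwitz series form a domain, and the factor [c] evaluated at the series has non-zero constant
    term. *)
Lemma formal_dvd (b : bool) (P Q R : {poly {poly F}}) (c : {poly F}) (phi : H) :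
  c *: Q = R * P -> ev2 tk (hd b phi) (hd (~~ b) phi) P = 0 ->
  (map_poly k c).[hd b phi 0%N 0%N] != 0 -> ev2 tk (hd b phi) (hd (~~ b) phi) Q = 0.
Proof.
move=> e P0 c0; set X := hd b phi; set Y := hd _ phi.
have c00 : ev2 tk X Y c%:P 0%N 0%N = (map_poly k c).[X 0%N 0%N].
  elim/poly_ind: (c) => [|p a IH]; first by rewrite !rmorph0 horner0.
  rewrite polyCD polyCM ev2D ev2M ev2CX ev2CC haddE hmulE00 IH.
  by rewrite rmorphD rmorphM /= map_polyX map_polyC hornerMXaddC.
have := congr1 (ev2 tk X Y) e; rewrite -mul_polyC !ev2M P0 mulr0.
move/(hseries_mulf_eq0 ch0)=> /orP[/eqP h|/eqP //].
by move: c0; rewrite -c00 h eqxx.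
Qed.
End FormalSolution.

Section Subst2Morph.
Variables (F : fieldType) (B C : comNzRingType).
Lemma subst2_morph (k : {rmorphism F -> B}) (k' : {rmorphism F -> C})
  (f : {rmorphism B -> C}) x y (Q : mpoly2 F) : (forall a, f (k a) = k' a) ->
  f (subst2 k x y Q) = subst2 k' (f x) (f y) Q.
Proof.
move=> fk; move: Q; apply: (subst2_uniq (f := fun Q => f (subst2 k x y Q))).
- by move=> p q; rewrite subst2D rmorphD.
- by move=> p q; rewrite subst2M rmorphM.
- by move=> c; rewrite subst2C.
- by rewrite subst2X0.
- by rewrite subst2X1.
Qed.
End Subst2Morph.

Section ToPoly.
Variable F : fieldType.

Definition ccst : {rmorphism F -> {poly {poly F}}} := polyC \o polyC.

(* The inner variable is the second one if [b] holds, the first one otherwise. *)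
Definition topoly (b : bool) (Q : mpoly2 F) : {poly {poly F}} :=
  subst2 ccst (if b then 'X else 'X%:P) (if b then 'X%:P else 'X) Q.

Lemma ev2_topoly (B : comNzRingType) (k : {rmorphism F -> B}) b x y Q :
  ev2 k x y (topoly b Q) = subst2 k (if b then y else x) (if b then x else y) Q.
Proof.
rewrite (@subst2_morph _ _ _ ccst k (ev2 k x y)); last exact: ev2CC.
by case: b; rewrite ev2X ev2CX.
Qed.

Let inner b (m : 'X_{1..2}) := m (if b then i21 else i20).
Let outer b (m : 'X_{1..2}) := m (if b then i20 else i21).

Lemma topoly_term b (m : 'X_{1..2}) a i j :
  (ccst a * ((if b then 'X else 'X%:P) ^+ m i20 * (if b then 'X%:P else 'X) ^+ m i21))`_j`_i =
  a * ((j == outer b m) && (i == inner b m))%:R.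
Proof.
transitivity ((ccst a * ('X%:P ^+ inner b m * 'X ^+ outer b m))`_j`_i).
  by rewrite /inner /outer; case: (b) => //; rewrite [X in ccst a * X]mulrC.
rewrite /ccst /= mulrA -polyC_exp -polyCM coefCM coefXn; case: (j == _).
  by rewrite mulr1 coefCM coefXn.
by rewrite mulr0 coef0 mulr0.
Qed.

Lemma size_topoly b (Q : mpoly2 F) m : m \in msupp Q -> (0 < outer b m)%N ->
  (1 < size (topoly b Q))%N.
Proof.
move=> mQ m0; rewrite ltnNge; apply/negP => /leq_sizeP/(_ _ m0).
rewrite /topoly subst2E coef_sum => /(congr1 (fun p : {poly F} => p`_(inner b m))) /eqP.
rewrite coef0 coef_sum (bigD1_seq m) ?msupp_uniq //= big1_seq ?addr0 => [|k /andP[km kQ]].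
  by rewrite topoly_term !eqxx mulr1 mcoeff_eq0 mQ.
rewrite topoly_term; case: eqP => [eo|]; last by rewrite mulr0.
case: eqP => [ei|]; last by rewrite mulr0.
by case/eqP: km; move: eo ei; rewrite /outer /inner; case: (b) => e e'; apply: mn2P.
Qed.
End ToPoly.

(* [deval c Dx Dy (fun=> f)] and [cm_eval c (jet Dx Dy f)] are convertible.   *)
Section Descent.
Variables (F : diffField) (hF : diff_closed F) (hchar : [pchar F] =i pred0).
Local Notation R := (dpoly F 'I_1).

Definition jet (B : Type) (Dx Dy : B -> B) (f : B) (v : dvar 'I_1) : B :=
  iter v.2.1 Dx (iter v.2.2 Dy f).

Lemma cm_evalD (I : choiceType) (A B : comNzRingType) (c : {rmorphism A -> B}) z
    (p q : {malg A[{cmonom I}]}) : cm_eval c z (p + q) = cm_eval c z p + cm_eval c z q.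
Proof. exact: (rmorphD (cm_eval c z)). Qed.

Lemma cm_eval_morph (I : choiceType) (A B C : comNzRingType) (c : {rmorphism A -> B}) 
    (f : {rmorphism B -> C}) z (p : {malg A[{cmonom I}]}) :
  f (cm_eval c z p) = cm_eval (f \o c) (f \o z) p.
Proof.
elim/malg_ind: p => [|p q ep eq|a m]; first by rewrite !raddf0.
  by rewrite !cm_evalD rmorphD ep eq.
rewrite !cm_evalZ !cm_eval_mon rmorphM /cm_prod rmorph_prod; congr (_ * _).
by apply: eq_bigr => v _; rewrite rmorphXn.
Qed.

(** A formal solution is a solution in [hfield], an extension of [F] by Taylor expansion;
    [diff_closed] then yields one in [F]. *)
Lemma closed_solve (p q : R) (K : fieldType) (k : {rmorphism F -> K}) (phi : hseries K) :
  cm_eval (taylor k) (jet (@hdx K) (@hdy K) phi) p = 0 ->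
  cm_eval (taylor k) (jet (@hdx K) (@hdy K) phi) q != 0 ->
  exists f : F, cm_eval idfun (jet dx dy f) p = 0 /\ cm_eval idfun (jet dx dy f) q != 0.
Proof.
move=> p0 q0.
have ch0 : [pchar K] =i pred0 by move=> n; rewrite (fmorph_pchar k).
pose z (i : 'I_1) : hfield ch0 := hemb ch0 phi.
have zE : (fun v : dvar 'I_1 => iter v.2.1 dx (iter v.2.2 dy (z v.1))) =
    hemb ch0 \o jet (@hdx K) (@hdy K) phi.
  apply/funext => -[i [a b]]; rewrite /z /jet /=.
  elim: a => [|a IH] /=; last by rewrite IH; apply: hemb_dx.
  by elim: b => [|b IH] //=; rewrite IH; apply: hemb_dy.
have ev r : deval (taylor_field k ch0) dx dy z r =
    hemb ch0 (cm_eval (taylor k) (jet (@hdx K) (@hdy K) phi) r).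
  rewrite cm_eval_morph -zE //.
have [|f [fp fq]] := hF (N := 1) (eqs := [:: p]) (neqs := [:: q]).
  exists (hfield ch0), (taylor_field k ch0); split; first exact: taylor_extension.
  exists z; split=> r; rewrite inE => /eqP ->; rewrite ev; first by rewrite p0 rmorph0.
  by apply/eqP; rewrite hemb_eq0.
have fE r : deval idfun dx dy f r = cm_eval idfun (jet dx dy (f ord0)) r.
  by congr (cm_eval _ _ r); apply/funext => -[i ab]; rewrite /jet /= (ord1 i).
exists (f ord0); rewrite -!fE; split; first by apply: fp; rewrite inE.
by apply/eqP; apply: fq; rewrite inE.
Qed.
End Descent.

Lemma sum_degree (F : fieldType) (V : nmodType) (P : mpoly2 F) (p : nat) (X : F -> nat -> nat -> V) :
  (forall a b, X 0 a b = 0) ->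
  \sum_(m <- msupp P | mdeg m == p) X P@_m (m i20) (m i21) =
  \sum_(a < p.+1) X P@_(mn2 a (p - a)) a (p - a)%N.
Proof.
move=> X0; pose e (a : 'I_p.+1) := mn2 a (p - a).
transitivity (\sum_(a < p.+1) \sum_(m <- msupp P | m == e a) X P@_m (m i20) (m i21)); last first.
  apply: eq_bigr => a _; have [eP|eP] := boolP (e a \in msupp P).
    by rewrite -big_filter filter_pred1_uniq ?msupp_uniq // big_seq1.
  rewrite (memN_msupp_eq0 eP) X0 big_seq_cond big1 // => m /andP[mP /eqP me].
  by rewrite -me mP in eP.
rewrite (exchange_big_dep predT) //= big_mkcond; apply: eq_bigr => m _.
case: eqP => [dm|dm]; last first.
  rewrite big1 // => a /eqP me; case: dm; rewrite me mdeg2 /= subnKC //.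
  by rewrite -ltnS (ltn_ord a).
rewrite mdeg2 in dm; have lt : (m i20 < p.+1)%N by rewrite -dm ltnS leq_addr.
rewrite (big_pred1 (Ordinal lt)) // => a; apply/eqP/eqP => [me|->].
  by apply: val_inj; rewrite /= me.
by rewrite /e /= (_ : (p - m i20)%N = m i21) -?dm ?addKn //; apply: mn2P.
Qed.

Lemma hsumE (K : comNzRingType) (I : Type) (s : seq I) (P : pred I) (E : I -> hseries K) i j :
  (\sum_(x <- s | P x) E x) i j = \sum_(x <- s | P x) E x i j.
Proof. exact: (big_morph (fun a : hseries K => a i j)). Qed.

Section LinearSolve.
Variables (F : diffField).
Local Notation H := (hseries F).
Local Notation tk := (taylor (idfun : {rmorphism F -> F})).

Definition hop (P : mpoly2 F) (phi : H) : H :=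
  \sum_(m <- msupp P) tk P@_m * iter (m i20) (@hdx F) (iter (m i21) (@hdy F) phi).

Lemma iter_hdD a b (phi psi : H) :
  iter a (@hdx F) (iter b (@hdy F) (phi + psi)) =
  iter a (@hdx F) (iter b (@hdy F) phi) + iter a (@hdx F) (iter b (@hdy F) psi).
Proof. by apply: hseriesP => i j; rewrite haddE !iter_hd. Qed.

(** The leading coefficients of [P] at the origin are not all zero, so [formal_solve] applies with
    [d0 = 0]. If the order is positive, the value [w] at the origin is free. *)
Lemma formal_linear (P : mpoly2 F) (r w : F) : P != 0 -> exists phi : H,
  hop P phi = tk r /\ ((1 < msize P)%N -> phi 0%N 0%N = w).
Proof.
move=> P0; set p := (msize P).-1.
have mp m : m \in msupp P -> (mdeg m <= p)%N.
  by move=> mP; rewrite -ltnS prednK ?lt0n ?msize_poly_eq0 // msize_mdeg_lt.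
pose phi0 : H := fun i j => if (i, j) == (0, 0)%N then w else 0.
have [||phi [near zero]] := @formal_solve F (fun phi => hop P phi - tk r) phi0 p 0
  (fun a => P@_(mn2 a (p - a))).
- have lP : mleadc P != 0 by rewrite mleadc_eq0.
  exists (mlead P i20).
    by have := mp _ (mlead_supp P0); rewrite mdeg2; apply: leq_trans; apply: leq_addr.
  have e : mdeg (mlead P) = p by rewrite /p -(mlead_deg P0).
  rewrite -{1}e mdeg2 addKn -mn2_eta //.
- move=> phi psi d _ _ v i j ij; rewrite !haddE addrAC; congr (_ + _).
  rewrite -(@sum_degree _ _ P p (fun c a b => c * psi (i + a)%N (j + b)%N)); last first.
    by move=> a b; rewrite mul0r.
  rewrite big_mkcond /hop !hsumE -big_split big_seq [RHS]big_seq.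
  apply: eq_bigr => m mP /=; rewrite iter_hdD mulrDr haddE; congr (_ + _).
  have vm : vanish (d + p - mdeg m) (iter (m i20) (@hdx F) (iter (m i21) (@hdy F) psi)).
    move=> k l kl; rewrite iter_hd; apply: v; move: kl; rewrite mdeg2.
    by lia.
  have dm : (d <= d + p - mdeg m)%N by rewrite -addnBA ?leq_addr ?mp.
  rewrite (hmul_vanish _ vm (leq_trans ij dm)) iter_hd; case: eqP => [//|ne].
  rewrite -iter_hd vm ?mulr0 //; apply: leq_ltn_trans ij _.
  by rewrite -addnBA ?mp // -[X in (X < _)%N]addn0 ltn_add2l subn_gt0 ltn_neqAle mp // andbT; apply/eqP.
exists phi; split=> [|sP].
  by apply/eqP; rewrite -subr_eq0; apply/eqP/hseriesP => i j; apply: zero.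
have : (phi - phi0) 0%N 0%N = 0 by apply: near; rewrite /p; case: (msize P) sP => [|[]].
by rewrite haddE hoppE => /eqP; rewrite subr_eq0 => /eqP.
Qed.
End LinearSolve.

Lemma rmorph_monom2 (A B : nzRingType) (rho : {rmorphism A -> B}) a b x y x' y' :
  rho x = x' -> rho y = y' -> rho (x ^+ a * y ^+ b) = x' ^+ a * y' ^+ b.
Proof. by move=> <- <-; rewrite !rmorphM !rmorphXn. Qed.

Section SolveIn.
Variables (F : diffField) (hF : diff_closed F) (hchar : [pchar F] =i pred0).
Local Notation R := (dpoly F 'I_1).
Local Notation id := (idfun : {rmorphism F -> F}).

Definition jvar (a b : nat) : R := mon (ucm (ord0 : 'I_1, (a, b))).

Definition lin_form (P : mpoly2 F) : R := mlin (fun m => jvar (m i20) (m i21)) P.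

Lemma cm_eval_lin_form (B : comNzRingType) (c : {rmorphism F -> B}) (Dx Dy : B -> B) f P :
  cm_eval c (jet Dx Dy f) (lin_form P) =
  \sum_(m <- msupp P) c P@_m * iter (m i20) Dx (iter (m i21) Dy f).
Proof.
rewrite /lin_form /mlin (big_morph _ (cm_evalD c _) (raddf0 (cm_eval c _))).
by apply: eq_bigr => m _; rewrite cm_evalZ cm_evalV.
Qed.

Lemma cm_evalBC (B : comNzRingType) (c : {rmorphism F -> B}) z (p : R) (r : F) :
  cm_eval c z (p - (malgC r : R)) = cm_eval c z p - c r.
Proof. by rewrite (raddfB (cm_eval c z)) /= cm_evalC. Qed.

Definition lin_op (P : mpoly2 F) (f : F) : F :=
  \sum_(m <- msupp P) P@_m * iter (m i20) dx (iter (m i21) dy f).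

Theorem solve_linear (P : mpoly2 F) (r : F) : P != 0 -> exists f, lin_op P f = r.
Proof.
move=> P0; have [phi [hphi _]] := formal_linear r 0 P0.
have [||f [fp _]] := @closed_solve F hF hchar (lin_form P - (malgC r : R)) 1 F id phi.
- rewrite cm_evalBC cm_eval_lin_form; apply/eqP; rewrite subr_eq0; exact/eqP.
- by rewrite rmorph1 oner_eq0.
exists f; move: fp; rewrite cm_evalBC cm_eval_lin_form => /eqP.
by rewrite subr_eq0 => /eqP.
Qed.

Theorem solve_homogeneous (P : mpoly2 F) : (1 < msize P)%N ->
  exists2 f, f != 0 & lin_op P f = 0.
Proof.
move=> sP; have P0 : P != 0 by rewrite -msize_poly_eq0 -lt0n (ltn_trans _ sP).
have [phi [hphi /(_ sP) phi00]] := formal_linear 0 1 P0.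
have [||f [fp fq]] := @closed_solve F hF hchar (lin_form P) (jvar 0 0) F id phi.
- by rewrite cm_eval_lin_form -[LHS]/(hop P phi) hphi rmorph0.
- rewrite cm_evalV; apply/eqP => /(congr1 (fun a : hseries F => a 0%N 0%N)).
  by apply/eqP; rewrite -[X in X == _]/(phi 0%N 0%N) phi00 oner_eq0.
exists f; first by move: fq; rewrite cm_evalV.
by move: fp; rewrite cm_eval_lin_form.
Qed.

(** A simple point of the curve [Q = 0] is the initial gradient of a formal solution. Its first
    coordinate is non-zero, and this passes to [F] as an inequation. *)
Theorem solve_gradient (Q : mpoly2 F) m : m \in msupp Q -> (0 < mdeg m)%N ->
  exists2 f, eval_grad f Q = 0 & (dx f != 0) || (dy f != 0).
Proof.
move=> mQ m0; pose b := m i21 == 0%N.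
have sQ : (1 < size (topoly b Q))%N.
  apply: size_topoly mQ _; move: m0; rewrite mdeg2 /b.
  by have [e|e] := posnP (m i21); [rewrite e addn0|].
have [K [k [x [y [P [S [c [x0 cx e P0 P'0]]]]]]]] := simple_point hchar sQ.
have [phi [phix phiy Pphi]] := formal_first_order b P0 P'0.
have ch0 : [pchar K] =i pred0 by move=> n; rewrite (fmorph_pchar k).
have := formal_dvd ch0 e Pphi; rewrite phix horner_map fmorph_eq0 => /(_ cx).
rewrite ev2_topoly => Qphi.
pose p : R := mlin (fun m => jvar 1 0 ^+ m i20 * jvar 0 1 ^+ m i21) Q.
have evp (B : comNzRingType) (h : {rmorphism F -> B}) (Dx Dy : B -> B) f :
    cm_eval h (jet Dx Dy f) p = subst2 h (Dx f) (Dy f) Q.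
  rewrite /p /mlin (big_morph _ (cm_evalD h _) (raddf0 (cm_eval h _))) subst2E.
  apply: eq_bigr => l _; rewrite cm_evalZ; congr (_ * _).
  by apply: rmorph_monom2; apply: cm_evalV.
have [||f [fp fq]] := @closed_solve F hF hchar p (if b then jvar 0 1 else jvar 1 0) K k phi.
- by rewrite evp; move: Qphi; rewrite /hd; case: (b).
- have : hd b phi != 0.
    apply/eqP => h; move: phix; rewrite h => /esym/eqP.
    by rewrite fmorph_eq0 (negbTE x0).
  by rewrite /hd; case: (b); rewrite cm_evalV.
exists f; first by move: fp; rewrite evp subst2E.
by move: fq; case: (b); rewrite cm_evalV => ->; rewrite ?orbT.
Qed.
End SolveIn.

(** * Edges of the polygon *)

Section Hull.
Implicit Types (A : rat * rat -> Prop) (p : rat * rat).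

Lemma hull_gen A p : A p -> convex_hull A p.
Proof.
move=> Ap; exists [:: (1, p)]; split; rewrite ?big_seq1 ?mul1r //.
by move=> w; rewrite inE => /eqP ->.
Qed.

Lemma hull_le A a b kappa p : (forall x, A x -> a * x.1 + b * x.2 <= kappa) ->
  convex_hull A p -> a * p.1 + b * p.2 <= kappa.
Proof.
move=> hA [r [rA r1 e1 e2]]; rewrite -e1 -e2 -[kappa]mul1r -r1.
rewrite !mulr_sumr mulr_suml -big_split big_seq [leRHS]big_seq /=.
apply: ler_sum => w wr; have [w0 /hA wA] := rA w wr.
by rewrite mulrCA [b * _]mulrCA -mulrDr ler_wpM2l.
Qed.

(* A face of the hull is the hull of the generators that it contains. *)
Lemma hull_face A c kappa p x : (forall x, A x -> x.1 + c * x.2 <= kappa) ->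
  convex_hull A p -> p.1 + c * p.2 = kappa ->
  (forall y, A y -> y.1 + c * y.2 = kappa -> y = x) -> p = x.
Proof.
move=> hA [r [rA r1 e1 e2]] pk one.
have gap : \sum_(w <- r) w.1 * (kappa - (w.2.1 + c * w.2.2)) = 0.
  rewrite (eq_bigr (fun w => w.1 * kappa - (w.1 * w.2.1 + c * (w.1 * w.2.2)))); last first.
    by move=> w _; ring.
  rewrite sumrB big_split -mulr_suml -mulr_sumr r1 e1 e2 /= mul1r pk subrr //.
have wx w : w \in r -> w.1 = 0 \/ w.2 = x.
  move=> wr; have [w0 wA] := rA w wr; move: gap => /eqP; rewrite big_seq psumr_eq0; last first.
    by move=> v vr; have [v0 /hA vA] := rA v vr; rewrite mulr_ge0 // subr_ge0.
  move/allP => /(_ w wr); rewrite wr mulf_eq0 => /orP[/eqP|/eqP e]; first by left.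
  by right; apply: one => //; lra.
have px (P : rat * rat -> rat) : \sum_(w <- r) w.1 * P w.2 = P x.
  rewrite -[RHS]mul1r -r1 mulr_suml big_seq [RHS]big_seq; apply: eq_bigr => w /wx[->|-> //].
  by rewrite !mul0r.
have E1 := px fst; have E2 := px snd; case: p x e1 e2 E1 E2 {pk one wx px} => [p1 p2] [x1 x2] /=.
by move=> -> -> -> ->.
Qed.
End Hull.

Lemma ord2_sub_max (F : fieldType) (S : mpoly3 F) (P : pred 'X_{1..3}) m :
  m \in msupp S -> P m -> exists m', [/\ m' \in msupp S, P m', (ord2 m <= ord2 m')%N &
    forall k, k \in msupp S -> P k -> (ord2 k <= ord2 m')%N].
Proof.
move=> mS Pm; pose s := [seq k <- msupp S | P k].
have ms : m \in s by rewrite mem_filter Pm.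
suff [m' m's max] : exists2 m', m' \in s & forall k, k \in s -> (ord2 k <= ord2 m')%N.
  move: m's; rewrite mem_filter => /andP[Pm' m'S]; exists m'; split=> //; first exact: max.
  by move=> k kS Pk; apply: max; rewrite mem_filter Pk.
have ex : exists k, has (fun x => ord2 x == k) s by exists (ord2 m); apply/hasP; exists m.
have ub k : has (fun x => ord2 x == k) s -> (k <= \max_(x <- s) ord2 x)%N.
  by case/hasP => x xs /eqP <-; apply: leq_bigmax_seq.
have [k /hasP[x xs /eqP xk] max] := ex_maxnP ex ub.
by exists x => // y ys; rewrite xk; apply: max; apply/hasP; exists y.
Qed.

Section Points.
Variables (F : diffField) (T : ldo F) (N : nat) (gn : seq (nat * F)).
Hypothesis N0 : (0 < N)%N.
Local Notation S := (Dop gn T).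
Local Notation g := (scale_exps N gn).

Definition points_le (h : seq (rat * F)) (c kappa : rat) : Prop :=
  forall j t, Ccoef T h j t <> 0 -> j + c * t%:R <= kappa.

Lemma level_ge0 m : 0 <= level N m.
Proof. by rewrite divr_ge0 ?ler0n. Qed.

(** For [c >= 0] the bound need only be tested, at each level, for the largest order of a monomial;
    there [Ccoef_top] shows that [C_(j,t)] is non-zero. *)
Lemma points_leP c kappa : 0 <= c ->
  points_le g c kappa <-> in_wt N c (fun x => x <= kappa) S.
Proof.
move=> c0; split=> [h m mS|h j t /Ccoef_supp[m [mS <- tm]]]; last first.
  by apply: le_trans (h m mS); rewrite lerD2l ler_wpM2l // ler_nat.
have [||m' [m'S /eqP e mm' max]] := @ord2_sub_max _ S (fun k => level N k == level N m) m => //.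
have nz : Ccoef T g (level N m) (ord2 m') <> 0.
  rewrite Ccoef_top => [|k kS /eqP]; last exact: max.
  move/symb_form_eq0/eqP; apply/negP.
  have sec := @section_and (fun k => level N k == level N m) (fun k => ord2 k == ord2 m')
    (level_section N0 (j := _)).
  by apply: (slice_neq0 sec m'S); rewrite e !eqxx.
by apply: le_trans (h _ _ nz); rewrite lerD2l ler_wpM2l // ler_nat.
Qed.

(** A monomial of the same level and of larger order would lie beyond the line, so [Ccoef_top]
    applies. *)
Lemma Ccoef_line c kappa t : 0 < c -> in_wt N c (fun x => x <= kappa) S ->
  Ccoef T g (kappa - c * t%:R) t = symb_form (hpart t (wtop N c kappa S)).
Proof.
move=> c0 h; rewrite Ccoef_top => [|m mS lm].
  congr symb_form; rewrite hpart_slice; apply: eq_slice => m; apply/andP/andP => -[/eqP e /eqP o].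
    by rewrite /wt e o subrK !eqxx.
  by split; rewrite ?o // -e /wt o addrK.
by have := h m mS; rewrite /wt lm -lerBrDl opprB addrCA subrr addr0 ler_pM2l // ler_nat.
Qed.

Lemma Ccoef_ge0 j t : Ccoef T g j t <> 0 -> 0 <= j.
Proof. by case/Ccoef_supp => m [_ <- _]; apply: level_ge0. Qed.

Definition gen_point (h : seq (rat * F)) (p : rat * rat) : Prop := p = (0, 0) \/
  exists (j : rat) (t : nat), p = (j, t%:R) /\ Ccoef T h j t <> 0.

Lemma gen_ge0 p : gen_point g p -> 0 <= p.1 /\ 0 <= p.2.
Proof.
by case=> [->|[j [t [-> /Ccoef_ge0 j0]]]] //=; split=> //; apply: ler0n.
Qed.

Lemma edgeP c kappa : 0 < c -> is_edge (polygon T g) c kappa ->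
  points_le g c kappa /\ exists t1 t2, [/\ (t1 < t2)%N,
    Ccoef T g (kappa - c * t1%:R) t1 <> 0 & Ccoef T g (kappa - c * t2%:R) t2 <> 0].
Proof.
move=> c0 [side [p [p' [Pp Pp' pp' pk p'k]]]].
have P0 : polygon T g (0, 0) by apply: hull_gen; left.
have ge0 q : polygon T g q -> 0 <= q.1 /\ 0 <= q.2.
  move=> Pq; have H (a b : rat) : (forall x, gen_point g x -> a * x.1 + b * x.2 <= 0) ->
    a * q.1 + b * q.2 <= 0 by move=> h; apply: hull_le Pq => x /h.
  split.
    have := H (-1) 0 _; rewrite mul0r addr0 mulN1r oppr_le0; apply => x /gen_ge0[x0 _].
    by rewrite mul0r addr0 mulN1r oppr_le0.
  have := H 0 (-1) _; rewrite mul0r add0r mulN1r oppr_le0; apply => x /gen_ge0[_ x0].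
  by rewrite mul0r add0r mulN1r oppr_le0.
(* The polygon lies in the first quadrant, which a line with [kappa <= 0] meets at most in the
   origin. Hence [kappa > 0], and the origin decides on which side of the line the polygon lies. *)
have zero q : polygon T g q -> q.1 + c * q.2 = kappa -> kappa <= 0 -> q = (0, 0).
  case: q => a b /ge0 /= [a0 b0] e k0.
  have cb : 0 <= c * b by rewrite mulr_ge0 // ltW.
  have -> : a = 0 by lra.
  by have /eqP : c * b = 0 by [lra]; rewrite mulf_eq0 gt_eqF //= => /eqP ->.
have kpos : 0 < kappa.
  by rewrite ltNge; apply/negP => k0; case: pp'; rewrite (zero _ Pp) // (zero _ Pp').
have {side} le q : polygon T g q -> q.1 + c * q.2 <= kappa.
  by case: side => [h|/(_ _ P0)]; [exact: h|rewrite /= mulr0 addr0 leNgt kpos].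
have leg x : gen_point g x -> x.1 + c * x.2 <= kappa by move=> /hull_gen; apply: le.
split=> [j t nz|].
  by apply: (leg (j, t%:R)); right; exists j, t.
have on x : gen_point g x -> x.1 + c * x.2 = kappa -> exists t, x = (kappa - c * t%:R, t%:R) /\
    Ccoef T g (kappa - c * t%:R) t <> 0.
  case=> [->|[j [t [-> nz]]]] /= e; first by move: kpos; rewrite -e mulr0 addr0 ltxx.
  by exists t; rewrite -e addrK.
(* If the line contained at most one generator, [hull_face] would make the two points of the edge
   equal; with no generator on it, any [x] will do, here the origin. *)
have [[x Gx xk]|none] := pselect (exists2 x, gen_point g x & x.1 + c * x.2 = kappa); last first.
  by case: pp'; rewrite (hull_face leg Pp pk (x := (0, 0))) ?(hull_face leg Pp' p'k (x := (0, 0))) //;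
    move=> y Gy yk; case: none; exists y.
have [[y [Gy yk yx]]|none] := pselect (exists y, [/\ gen_point g y, y.1 + c * y.2 = kappa & y <> x]).
  have [t [ex nt]] := on x Gx xk; have [u [ey nu]] := on y Gy yk.
  have : t <> u by move=> tu; apply: yx; rewrite ex ey tu.
  by case: (ltngtP t u) => // lt _; [exists t, u|exists u, t].
have uniq y : gen_point g y -> y.1 + c * y.2 = kappa -> y = x.
  by move=> Gy yk; apply: contrapT => yx; apply: none; exists y.
by case: pp'; rewrite (hull_face leg Pp pk uniq) (hull_face leg Pp' p'k uniq).
Qed.

Lemma edge_intro c kappa t1 t2 : points_le g c kappa -> (t1 < t2)%N ->
  Ccoef T g (kappa - c * t1%:R) t1 <> 0 -> Ccoef T g (kappa - c * t2%:R) t2 <> 0 ->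
  0 <= c -> is_edge (polygon T g) c kappa.
Proof.
move=> h t12 n1 n2 c0; split.
  left=> p; rewrite -[X in X + _]mul1r; apply: hull_le => x [->|[j [t [-> nz]]]] /=.
    rewrite !mulr0 addr0; apply: le_trans (h _ _ n1).
    by rewrite addr_ge0 ?mulr_ge0 ?(Ccoef_ge0 n1).
  by rewrite mul1r; apply: h.
exists (kappa - c * t1%:R, t1%:R), (kappa - c * t2%:R, t2%:R); split.
- by apply: hull_gen; right; exists (kappa - c * t1%:R), t1.
- by apply: hull_gen; right; exists (kappa - c * t2%:R), t2.
- by case=> _ /eqP; rewrite eqr_nat (ltn_eqF t12).
- by rewrite /= subrK.
- by rewrite /= subrK.
Qed.

Lemma right_edge_intro kappa t : points_le g 0 kappa -> (0 < t)%N ->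
  Ccoef T g kappa 0 <> 0 -> Ccoef T g kappa t <> 0 -> right_edge (polygon T g) kappa.
Proof.
move=> h t0 n0 nt; have E : is_edge (polygon T g) 0 kappa.
  by apply: edge_intro h t0 _ _ _; rewrite ?mul0r ?subr0.
split=> //; last by apply: hull_gen; right; exists kappa, 0%N.
move=> p; rewrite -[p.1]mul1r -[X in X <= _]addr0 -(mul0r p.2).
apply: hull_le => x [->|[j [u [-> nz]]]] /=.
  by rewrite mulr0 mul0r addr0 (Ccoef_ge0 n0).
by rewrite mul1r; apply: h.
Qed.
End Points.

(** * Order of the conjugated operators *)

Section Order.
Variable F : diffField.
Local Notation A := (mpoly3 F).

Definition order_le (n : nat) (S : A) := forall m, m \in msupp S -> (ord2 m <= n)%N.

Lemma order_leD n S S' : order_le n S -> order_le n S' -> order_le n (S + S').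
Proof. by move=> h h' m /msuppD_le; rewrite mem_cat => /orP[]; [apply: h|apply: h']. Qed.

Lemma order_leZ n a S : order_le n S -> order_le n (a *: S).
Proof. by move=> h m /msuppZ_le; apply: h. Qed.

Lemma order_le_sum n (I : Type) (r : seq I) (E : I -> A) :
  (forall i, order_le n (E i)) -> order_le n (\sum_(i <- r) E i).
Proof.
move=> h; elim: r => [|i r IH]; first by rewrite big_nil => m; rewrite msupp0.
by rewrite big_cons; apply: order_leD.
Qed.

Lemma order_leM a b S S' : order_le a S -> order_le b S' -> order_le (a + b) (S * S').
Proof.
move=> h h' m /msuppM_le /allpairsP[[m1 m2] /= [m1S m2S ->]].
by rewrite /ord2 !mnmDE addnACA leq_add // -/(ord2 _) ?h ?h'.
Qed.

Lemma order_leX n m : (ord2 m <= n)%N -> order_le n 'X_[m].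
Proof. by move=> h k; rewrite msuppX inE => /eqP ->. Qed.

Lemma order_leW n n' S : (n <= n')%N -> order_le n S -> order_le n' S.
Proof. by move=> nn h m /h; move/leq_trans; apply. Qed.

Lemma order_le_coefder n (d : F -> F) S : derivation d -> order_le n S ->
  order_le n (coefder d S).
Proof.
move=> dd h m; rewrite mcoeff_msupp mcoeff_coefder // => nz; apply: h.
by rewrite mcoeff_msupp; apply: contraNneq nz => ->; rewrite der0.
Qed.

Lemma order_le_grad (E : nat * F -> F) gn : order_le 1 (\sum_(p <- gn) E p *: 'X_i32 ^+ p.1).
Proof.
apply: order_le_sum => p; apply: order_leZ; rewrite mpolyXn; apply: order_leX.
by rewrite /ord2 !mulmnE !mnm1E.
Qed.

Lemma order_le_Lx gn n S : order_le n S -> order_le n.+1 (Lx gn S).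
Proof.
move=> h; apply: order_leD.
  by apply: order_leW (leqnSn n) _; apply: order_le_coefder h; apply: dx_derivation.
rewrite -add1n; apply: order_leM h; apply: order_leD; last exact: order_le_grad.
by apply: order_leX; rewrite /ord2 !mnm1E.
Qed.

Lemma order_le_Ly gn n S : order_le n S -> order_le n.+1 (Ly gn S).
Proof.
move=> h; apply: order_leD.
  by apply: order_leW (leqnSn n) _; apply: order_le_coefder h; apply: dy_derivation.
rewrite -add1n; apply: order_leM h; apply: order_leD; last exact: order_le_grad.
by apply: order_leX; rewrite /ord2 !mnm1E.
Qed.

Lemma cm_deg2 (m : {cmonom 'I_2}) : monalg.mdeg m = (m ord0 + m ord_max)%N.
Proof.
elim/cmonom_ind: m => [|v m IH]; first by rewrite !onecmE; apply: monalg.mdeg1.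
apply: (etrans (monalg.mdegM _ _)); rewrite monalg.mdegU IH !mulcmE !ucmE.
move: (m ord0) (m ord_max) => a b.
by move: v; apply: ord2_ind; rewrite -!val_eqE /=; lia.
Qed.

(** Conjugation does not raise the order, so the range [t < msize T] in [edge_sum] misses no point
    of the line. *)
Lemma ord2_Dop gn (T : ldo F) m : m \in msupp (Dop gn T) -> (ord2 m < monalg.msize T)%N.
Proof.
move: m; case E : (monalg.msize T) => [|n].
  move: E; move/eqP; rewrite monalg.msize_eq0 => /eqP -> m.
  by rewrite /Dop monalg.msupp0 big_seq_fset0 msupp0.
rewrite -/(order_le n _) /Dop big_seq; elim/big_ind: _ => [m|S S' h h'|k kT].
- by rewrite msupp0.
- exact: order_leD.
apply: order_leZ; have kn : (k ord0 + k ord_max <= n)%N.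
  by rewrite -cm_deg2 -ltnS -E; apply: monalg.msize_mdeg_lt.
apply: order_leW kn _; elim: (k ord0) => [|a IH] /=; last exact: order_le_Lx.
rewrite add0n; elim: (k ord_max) => [|b IH] /=; last exact: order_le_Ly.
by rewrite -mpolyX0; apply: order_leX; rewrite /ord2 !mnm0E.
Qed.
End Order.

(** * Edge polynomials and lower ends of faces *)

Section Line.
Variable F : diffField.
Local Notation A := (mpoly2 F).

Lemma hpart_sum (k : nat) (Q : A) : (forall m, m \in msupp Q -> (mdeg m < k)%N) ->
  Q = \sum_(t < k) hpart t Q.
Proof.
move=> lt; apply/mpolyP => m; rewrite (big_morph (mcoeff m) (mcoeffD m) (mcoeff0 _ m)).
have [mQ|mQ] := boolP (m \in msupp Q).
  rewrite (bigD1 (Ordinal (lt m mQ))) //= mcoeff_hpart eqxx big1 ?addr0 // => t tm.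
  by rewrite mcoeff_hpart; case: eqP => // e; case/eqP: tm; apply: val_inj.
rewrite (memN_msupp_eq0 mQ) big1 // => t _.
by rewrite mcoeff_hpart (memN_msupp_eq0 mQ) if_same.
Qed.

Lemma edge_sumE (T : ldo F) N gn c kappa : (0 < N)%N -> 0 < c ->
  in_wt N c (fun x => x <= kappa) (Dop gn T) ->
  edge_sum T (scale_exps N gn) c kappa = symb_form (wtop N c kappa (Dop gn T)).
Proof.
move=> N0 c0 h; rewrite /edge_sum (eq_bigr (fun t : 'I__ =>
  symb_form (hpart t (wtop N c kappa (Dop gn T))))) => [|t _]; last exact: Ccoef_line.
rewrite {2}(@hpart_sum (monalg.msize T) (wtop _ _ _ _)); first exact/esym/mlin_sum.
move=> m /msupp_slice[m' [m'S _ ->]].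
by rewrite mdeg_front; apply: ord2_Dop m'S.
Qed.

Lemma hpart_neq0 t (Q : A) m : m \in msupp Q -> mdeg m = t -> hpart t Q != 0.
Proof.
move=> mQ mt; apply/eqP => /(congr1 (mcoeff m)); rewrite mcoeff_hpart mt eqxx mcoeff0.
by apply/eqP; rewrite mcoeff_eq0 mQ.
Qed.

Lemma hpart_ex t (Q : A) : hpart t Q != 0 -> exists2 m, m \in msupp Q & mdeg m = t.
Proof.
case/msupp_neq0 => m; rewrite mcoeff_msupp mcoeff_hpart; case: (mdeg m =P t) => [mt|]; last by rewrite eqxx.
by rewrite -mcoeff_msupp; exists m.
Qed.

Lemma low1_tshift (v : 'I_2 -> F) (Q : A) :
  subst2 (idfun : {rmorphism F -> F}) (v i20) (v i21) Q = 0 -> low 1 (tshift v Q).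
Proof.
move=> Q0 m; rewrite lt0n mdeg_eq0; apply: contraTneq => ->; rewrite mcoeff_msupp negbK.
rewrite -[0]Q0; apply/eqP; apply: (subst2_uniq (f := fun Q => (tshift v Q)@_0)).
- by move=> p q; rewrite tshiftD mcoeffD.
- by move=> p q; rewrite tshiftM rmorphM.
- by move=> c; rewrite tshiftC mcoeffC eqxx mulr1.
- by rewrite tshiftXU mcoeffD mcoeffX mcoeffC eqxx mulr1 mnm1_eq0 add0r.
- by rewrite tshiftXU mcoeffD mcoeffX mcoeffC eqxx mulr1 mnm1_eq0 add0r.
Qed.

(* [last_slope g = s_k]; [e] is the ordinate of the lower endpoint of the     *)
(* face of slope [s_k] of the polygon P_(k+1).                                *)
Definition last_slope (g : seq (rat * F)) : rat := (last (1, 0) g).1.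

Definition lower_end (T : ldo F) (g : seq (rat * F)) (e : nat) : Prop :=
  (0 < e)%N /\ exists kappa, [/\ points_le T g (last_slope g) kappa,
    Ccoef T g (kappa - last_slope g * e%:R) e <> 0 &
    forall t, (t < e)%N -> Ccoef T g (kappa - last_slope g * t%:R) t = 0].

(** The ordinates on the line of slope [c] are the degrees of [W], and [e] is the least of them.
    When [W] is a translated polynomial, [e] is an order of vanishing. *)
Lemma lower_end_intro (T : ldo F) N gn c kappa (g := scale_exps N gn)
    (W := wtop N c kappa (Dop gn T)) :
  (0 < N)%N -> 0 < c -> last_slope g = c ->
  in_wt N c (fun x => x <= kappa) (Dop gn T) -> W != 0 -> low 1 W ->
  exists2 e, lower_end T g e & low e W.
Proof.
move=> N0 c0 gc h W0 W1; have [m0 m0W] := msupp_neq0 W0.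
have ex : exists k, has (fun m => mdeg m == k) (msupp W).
  by exists (mdeg m0); apply/hasP; exists m0.
have [e /hasP[m mW /eqP me] min] := ex_minnP ex.
have lowe : low e W by move=> k kW; apply: min; apply/hasP; exists k.
exists e => //; split; first by rewrite -me; apply: W1.
exists kappa; rewrite gc; split.
- by apply/points_leP => //; apply: ltW.
- rewrite Ccoef_line // => /symb_form_eq0/eqP; apply/negP.
  exact: hpart_neq0 mW me.
move=> t te; rewrite Ccoef_line //; have [-> |/hpart_ex[k kW kt]] := eqVneq (hpart t W) 0.
  exact: mlin0.
by move: (lowe k kW); rewrite kt leqNgt te.
Qed.
End Line.

(** * The first polygon *)

(** Two non-zero linear forms with a common non-trivial zero are proportional. *)
Lemma power_factor (F : fieldType) (R : comAlgType F) (x y : R) (a1 a2 v0 v1 : F) (e m : nat) (s : R) :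
  (a1, a2) <> (0, 0) -> (v0 != 0) || (v1 != 0) -> a1 * v0 + a2 * v1 = 0 -> (m <= e)%N ->
  exists r, (v0 *: y - v1 *: x) ^+ e * s = (a1 *: x + a2 *: y) ^+ m * r.
Proof.
move=> a0 v0v av me; have [k e0 e1] : exists2 k, v0 = k * a2 & - v1 = k * a1.
  have [v00|v00] := eqVneq v0 0.
    move: av v0v; rewrite v00 eqxx /= mulr0 add0r => /eqP.
    rewrite mulf_eq0 => /orP[/eqP a20 _|/eqP -> /eqP //]; exists (- v1 / a1); first by rewrite a20 mulr0.
    by rewrite divfK //; apply/eqP => a10; apply: a0; rewrite a10 a20.
  have a20 : a2 != 0.
    apply/eqP => a20; move/eqP: av; rewrite a20 mul0r addr0 mulf_eq0 (negbTE v00) orbF.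
    by move/eqP => a10; apply: a0; rewrite a10 a20.
  exists (v0 / a2); first by rewrite divfK.
  apply: (mulfI a20); rewrite mulrN; move/eqP: av; rewrite addrC addr_eq0 => /eqP ->.
  by rewrite opprK mulrCA mulrA divfK // mulrC.
have -> : v0 *: y - v1 *: x = k *: (a1 *: x + a2 *: y).
  by rewrite scalerDr !scalerA -e0 -e1 scaleNr addrC.
exists ((a1 *: x + a2 *: y) ^+ (e - m) * (k ^+ e *: s)).
by rewrite exprZn -scalerAl scalerAr mulrA -exprD subnKC.
Qed.

Lemma cm_eval_id (F : comNzRingType) (I : choiceType)
    (f : {malg F[{cmonom I}]} -> {malg F[{cmonom I}]}) :
  (forall p q, f (p + q) = f p + f q) -> (forall a, f (malgC a) = malgC a) ->
  (forall v p, f (mon (ucm v) * p) = mon (ucm v) * f p) -> forall p, f p = p.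
Proof.
move=> fD fC fv; apply: malg_cmonom_ind => [p q ep eq|//|v p ep].
  by rewrite fD ep eq.
by rewrite fv ep.
Qed.

Lemma subst2_linpow (F : fieldType) (R : comAlgType F) (k : {rmorphism F -> R}) (x y : R)
    (v0 v1 : F) e (s : mpoly2 F) : (forall a u, k a * u = a *: u) ->
  subst2 k x y ((v0 *: 'X_i21 - v1 *: 'X_i20) ^+ e * s) =
  (v0 *: y - v1 *: x) ^+ e * subst2 k x y s.
Proof.
move=> kE; rewrite subst2M subst2Xn -scaleNr subst2D !subst2Z subst2X0 subst2X1.
by rewrite !kE scaleNr.
Qed.

Section Symbol.
Variable F : diffField.
Local Notation A := (mpoly2 F).

(** Symbols live in [{malg _}] in the statement, and in [mpoly] where orders of vanishing are
    computed; [ldo_poly] and [poly_ldo] translate. *)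
Definition ldo_poly : ldo F -> A := cm_eval (@mpolyC 2 F) (fun i : 'I_2 => 'X_i).

Definition poly_ldo : A -> ldo F :=
  subst2 (malgC : {rmorphism F -> ldo F}) (mon (ucm (ord0 : 'I_2))) (mon (ucm (ord_max : 'I_2))).

Lemma ldo_polyD p q : ldo_poly (p + q) = ldo_poly p + ldo_poly q.
Proof. exact: (rmorphD (cm_eval (@mpolyC 2 F) _)). Qed.

Lemma ldo_polyM p q : ldo_poly (p * q) = ldo_poly p * ldo_poly q.
Proof. exact: (rmorphM (cm_eval (@mpolyC 2 F) _)). Qed.

Lemma ldo_polyX p k : ldo_poly (p ^+ k) = ldo_poly p ^+ k.
Proof. exact: (rmorphXn (cm_eval (@mpolyC 2 F) _)). Qed.

Lemma ldo_polyZ a p : ldo_poly (a *: p) = a *: ldo_poly p.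
Proof. by rewrite /ldo_poly cm_evalZ mul_mpolyC. Qed.

Lemma ldo_polyV v : ldo_poly (mon (ucm v)) = 'X_v.
Proof. exact: cm_evalV. Qed.

Lemma ord2E : (ord0 = i20 :> 'I_2) * (ord_max = i21 :> 'I_2).
Proof. by split; apply: val_inj. Qed.

Lemma ldo_poly_mon m : ldo_poly (mon m) = 'X_[mn2 (m ord0) (m ord_max)].
Proof.
elim/cmonom_ind: m => [|v m IH].
  rewrite mon1 !onecmE (_ : mn2 0 0 = 0%MM) ?mpolyX0; last by apply: mn2P; rewrite mnm0E.
  exact: (rmorph1 (cm_eval (@mpolyC 2 F) _)).
rewrite monM ldo_polyM ldo_polyV IH -mpolyXD; congr 'X_[_].
apply: mn2P; rewrite mnmDE !mulcmE !ucmE mnm1E ?(mn2E0, mn2E1) ord2E //.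
Qed.

Lemma poly_ldoK p : poly_ldo (ldo_poly p) = p.
Proof.
move: p; apply: cm_eval_id => [p q|a|v p].
- by rewrite ldo_polyD /poly_ldo subst2D.
- by rewrite /ldo_poly cm_evalC /poly_ldo subst2C.
rewrite ldo_polyM ldo_polyV /poly_ldo subst2M; congr (_ * _).
by move: v; apply: ord2_ind; rewrite ?subst2X0 ?subst2X1 ord2E.
Qed.

Lemma ldo_poly_lin (a1 a2 : F) (x y : ldo F) X Y : ldo_poly x = X -> ldo_poly y = Y ->
  ldo_poly (a1 *: x + a2 *: y) = a1 *: X + a2 *: Y.
Proof. by move=> <- <-; apply: (etrans (ldo_polyD _ _)); congr (_ + _); apply: ldo_polyZ. Qed.

Lemma ldo_poly_symb : ldo_poly (symb_x F) = 'X_i20 /\ ldo_poly (symb_y F) = 'X_i21.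
Proof.
have -> : symb_x F = mon (ucm (ord0 : 'I_2)) by rewrite monE.
have -> : symb_y F = mon (ucm (ord_max : 'I_2)) by rewrite monE.
by rewrite (ldo_polyV ord0) (ldo_polyV ord_max) !ord2E.
Qed.

Lemma poly_ldo_linpow (v0 v1 : F) e s :
  poly_ldo ((v0 *: 'X_i21 - v1 *: 'X_i20) ^+ e * s) =
  (v0 *: symb_y F - v1 *: symb_x F) ^+ e * poly_ldo s.
Proof.
have -> : symb_x F = mon (ucm (ord0 : 'I_2)) by rewrite monE.
have -> : symb_y F = mon (ucm (ord_max : 'I_2)) by rewrite monE.
apply: subst2_linpow; exact: mul_malgC.
Qed.

Lemma Dop_nil (T : ldo F) : Dop [::] T =
  \sum_(k <- monalg.msupp T) monalg.mcoeff k T *: 'X_[mn3 (k ord0) (k ord_max) 0].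
Proof.
apply: eq_bigr => k _; congr (_ *: _).
have cx := coefderX (dx_derivation F); have cy := coefderX (dy_derivation F).
have Ly0 b : iter b (Ly [::]) 1 = 'X_[mn3 0 b 0] :> mpoly3 F.
  elim: b => [|b IH] /=; first by rewrite -mpolyX0; congr 'X_[_]; apply: mn3P; rewrite mnm0E.
  rewrite IH /Ly /grady big_nil addr0 cy add0r -mpolyXD; congr 'X_[_].
  by apply: mn3P; rewrite mnmDE mnm1E.
elim: (k ord0) => [|a IH] /=; first exact: Ly0.
rewrite IH /Lx /gradx big_nil addr0 cx add0r -mpolyXD; congr 'X_[_].
by apply: mn3P; rewrite mnmDE mnm1E.
Qed.

Lemma wt_mn3 a b : wt 1 1 (mn3 a b 0) = (a + b)%:R.
Proof. by rewrite /wt /level /ord2 /= mul0r add0r mul1r. Qed.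

Section Start.
Variables (T : ldo F) (n : nat).
Hypothesis hn : has_order T n.

Lemma wt_Dop_nil : in_wt 1 1 (fun x => x <= n%:R) (Dop [::] T).
Proof.
rewrite Dop_nil big_seq; elim/big_ind: _ => [||k kT]; first exact: in_wt0.
  by move=> *; apply: in_wtD.
apply: in_wtZ; apply: in_wtX; rewrite wt_mn3 ler_nat -cm_deg2 -ltnS.
by have := monalg.msize_mdeg_lt kT; rewrite (hn : monalg.msize T = n.+1).
Qed.

Lemma ldo_poly_symbE : ldo_poly (symb T) =
  \sum_(k <- monalg.msupp T | (k ord0 + k ord_max == n)%N)
    monalg.mcoeff k T *: 'X_[mn2 (k ord0) (k ord_max)].
Proof.
rewrite /symb (big_morph _ ldo_polyD (_ : ldo_poly 0 = 0)); last first.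
  exact: (raddf0 (cm_eval (@mpolyC 2 F) _)).
apply: eq_big => [k|k _]; first by rewrite (hn : monalg.msize T = n.+1) eqSS cm_deg2.
by rewrite malgUE ldo_polyZ ldo_poly_mon.
Qed.

(** For [N = 1] and [c = 1], the weight of an unconjugated monomial is its order. *)
Lemma wtop_Dop_nil : wtop 1 1 n%:R (Dop [::] T) = ldo_poly (symb T).
Proof.
rewrite Dop_nil wtop_sum ldo_poly_symbE [RHS]big_mkcond; apply: eq_bigr => k _.
rewrite /wtop /slice mlinX wt_mn3 eqr_nat.
by case: ifP => _; last by rewrite scaler0.
Qed.

Variables (a1 a2 : F) (m : nat).
Hypotheses (ha : (a1, a2) <> (0, 0)) (hm : (1 <= m)%N)
  (hfac : factor_mult (a1 *: symb_x F + a2 *: symb_y F) m (symb T)).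

(** Adjoining [f] with slope 1 translates the symbol by [grad f], a zero of the given linear factor.
    If [e] exceeded [m], then by [form_order] and [power_factor] the factor would divide the symbol
    [m.+1] times. *)
Theorem start_lower_end f : starts a1 a2 f ->
  exists2 e, lower_end T [:: (1, f)] e & (e <= m)%N.
Proof.
case=> af df; set Q := ldo_poly (symb T); set v := gradf f.
have v0 : (v i20 != 0) || (v i21 != 0).
  rewrite -negb_and; apply/negP => /andP[/eqP dxf /eqP dyf]; apply: df.
  by move: dxf dyf; rewrite /v /gradf /= => -> ->.
have [ex ey] := ldo_poly_symb.
have lE := ldo_poly_lin a1 a2 ex ey.
have Q0 : Q != 0.
  apply/eqP => Q0; case: hfac => _; apply; exists 0; rewrite mulr0.
  by rewrite -[symb T]poly_ldoK -/Q Q0 /poly_ldo subst2E msupp0 big_nil.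
have formQ : isform n Q.
  rewrite /Q ldo_poly_symbE; elim/big_ind: _ => [k|p q|k /eqP kn]; first by rewrite msupp0.
    exact: formD.
  by apply: formZ => j; rewrite msuppX inE => /eqP ->; rewrite mdeg2.
have Qv : subst2 (idfun : {rmorphism F -> F}) (v i20) (v i21) Q = 0.
  case: hfac => -[r er] _; rewrite /Q er ldo_polyM ldo_polyX lE.
  rewrite subst2M subst2Xn subst2D !subst2Z subst2X0 subst2X1.
  rewrite -[X in X ^+ m]/(a1 * dx f + a2 * dy f) af.
  by case: (m) hm => // k _; rewrite exprS !mul0r.
have g1 : scale_exps 1 [:: (1%N, f)] = [:: (1, f)] by rewrite /scale_exps /= divr1.
have [bd top] := @wtop_Dop_rcons F 1 1 1 f isT isT (esym (divr1 _)) [::] T n%:R wt_Dop_nil.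
have W0 : wtop 1 1 n%:R (Dop [:: (1%N, f)] T) != 0.
  by rewrite top wtop_Dop_nil; apply: contraNneq Q0 => /tshift_eq0/eqP.
have [||e le lowe] := @lower_end_intro F T 1 [:: (1%N, f)] 1 n%:R isT ltr01 _ bd W0 _.
- by rewrite g1.
- by rewrite top wtop_Dop_nil; apply: low1_tshift.
exists e; first by rewrite -g1.
rewrite leqNgt; apply/negP => me; move: lowe; rewrite top wtop_Dop_nil => lowe.
have [s es] := form_order formQ v0 lowe.
case: hfac => _; apply.
have [r er] := power_factor (symb_x F) (symb_y F) (poly_ldo s) ha v0 af me.
exists r; apply: (etrans (esym (poly_ldoK _))); rewrite -/Q es.
exact: (etrans (poly_ldo_linpow _ _ _ _) er).
Qed.
End Start.
End Symbol.

(** * One step of the procedure *)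

Lemma denq_dvd_nat (s : rat) N : 0 <= s ->
  (s * N%:R \is a Num.nat) = (`|denq s|%N %| N)%N.
Proof.
move=> s0; set d := `|denq s|%N; set n := `|numq s|%N.
have d0 : d%:R != 0 :> rat by rewrite pnatr_eq0 absz_eq0 denq_eq0.
have sE : s = n%:R / d%:R.
  rewrite -[LHS]divq_num_den -[numq s]gez0_abs ?numq_ge0 //.
  by rewrite -[denq s]gez0_abs // ltW.
have cop : coprime d n by rewrite coprime_sym; apply: coprime_num_den.
apply/idP/idP => [/natrP[k]|/dvdnP[k ->]].
  rewrite sE mulrAC => /(canRL (divfK d0)) /eqP; rewrite -!natrM eqr_nat => /eqP e.
  by rewrite -(Gauss_dvdr N cop) e dvdn_mull.
by rewrite sE natrM mulrCA divfK // -natrM natr_nat.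
Qed.

Section Denominator.
Variable F : fieldType.
Implicit Types g : seq (rat * F).

Definition pos_exps g := all (fun p => 0 < p.1) g.

Definition nums (N : nat) g : seq (nat * F) := [seq (Num.truncn (p.1 * N%:R), p.2) | p <- g].

Lemma denominator_rcons g p : denominator (rcons g p) = lcmn (denominator g) `|denq p.1|%N.
Proof. by rewrite /denominator big_rcons /= lcmnC. Qed.

Lemma denominator_gt0 g : (0 < denominator g)%N.
Proof.
rewrite /denominator; elim/big_ind: _ => // [a b a0 b0|p _]; first by rewrite lcmn_gt0 a0.
by rewrite absz_gt0 denq_neq0.
Qed.

Lemma scale_nums N g : (0 < N)%N -> pos_exps g -> (denominator g %| N)%N ->
  scale_exps N (nums N g) = g.
Proof.
move=> N0; elim: g => [|p g IH] //= /andP[p0 g0]; rewrite /denominator big_cons dvdn_lcm.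
move=> /andP[pN gN]; congr (_ :: _); last exact: IH.
case: p p0 pN => s f /= s0; rewrite -denq_dvd_nat ?ltW // => /truncnK ->.
by rewrite mulfK // pnatr_eq0 -lt0n.
Qed.

Lemma exps_nat g p : pos_exps g -> p \in g -> p.1 * (denominator g)%:R \is a Num.nat.
Proof.
move=> /allP g0 pg; rewrite denq_dvd_nat ?(ltW (g0 _ pg)) //.
elim: g pg {g0} => [//|q g IH]; rewrite inE /denominator big_cons => /orP[/eqP ->|/IH].
  exact: dvdn_lcml.
by move/dvdn_trans; apply; apply: dvdn_lcmr.
Qed.
End Denominator.

(** It comes down to [r <= 2 ^ (r - 1) <= 2 ^ ((r - 1) * x)]. *)
Lemma pow2_step r x t : (0 < r)%N -> (0 < x)%N -> (r * 2 ^ (t + x) <= 2 ^ (t + r * x))%N.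
Proof.
case: r => // r _ x0; rewrite (_ : t + r.+1 * x = r * x + (t + x))%N; last by lia.
rewrite [leqRHS]expnD leq_mul2r; apply/orP; right.
by apply: leq_trans (ltn_expl r (ltnSn 1)) _; rewrite leq_exp2l // leq_pmulr.
Qed.

(** Convexity: points on a face of smaller slope [c] do not lie above the lower end, at ordinate
    [e], of the face of slope [s]. *)
Lemma steeper_below (c s kappa ks t e : rat) : c < s ->
  kappa - c * t + s * t <= ks -> ks - s * e + c * e <= kappa -> t <= e.
Proof.
move=> cs h1 h2; rewrite leNgt; apply/negP => lt.
have : 0 < (s - c) * (t - e) by rewrite mulr_gt0 ?subr_gt0.
rewrite mulrBl !mulrBr; move: h1 h2; move: (c * t) (s * t) (c * e) (s * e) => a b a' b'.
by lra.
Qed.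

Lemma level_gap (c d a b kappa : rat) :
  c * d * (a - b) = (kappa - c * b) * d - (kappa - c * a) * d.
Proof. by ring. Qed.

Section Step.
Variables (F : diffField) (ch0 : [pchar F] =i pred0) (T : ldo F).
Implicit Type g : seq (rat * F).
Local Notation A := (mpoly2 F).

Lemma last_slope_rcons g p : last_slope (rcons g p) = p.1.
Proof. by rewrite /last_slope last_rcons. Qed.

Lemma Ccoef_level_int g j t : pos_exps g -> Ccoef T g j t <> 0 ->
  j * (denominator g)%:R \is a Num.nat.
Proof.
move=> g0; have N0 := denominator_gt0 g; have := scale_nums N0 g0 (dvdnn _) => <-.
move/Ccoef_supp => [m [_ <- _]]; rewrite (scale_nums N0 g0 (dvdnn _)) /level.
by rewrite divfK ?natr_nat // pnatr_eq0 -lt0n.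
Qed.

Lemma points_line g c kappa N : (0 < N)%N -> pos_exps g -> (denominator g %| N)%N ->
  0 < c -> points_le T g c kappa ->
  forall t, Ccoef T g (kappa - c * t%:R) t =
    symb_form (hpart t (wtop N c kappa (Dop (nums N g) T))).
Proof.
move=> N0 g0 gN c0 h t; rewrite -[in LHS](scale_nums N0 g0 gN); apply: Ccoef_line => //.
by apply/(@points_leP F T N (nums N g) N0 c kappa (ltW c0)); rewrite scale_nums.
Qed.

(* On the edge the ordinates are congruent modulo [r], so the new ordinate of *)
(* the lower end is at most [t + x] where [t + r x] is at most the old one.   *)
Theorem step_lower_end g e c kappa f : pos_exps g -> lower_end T g e ->
  0 < c < last_slope g -> is_edge (polygon T g) c kappa ->
  vanishes_at_phi (edge_sum T g c kappa) f ->
  exists e', [/\ lower_end T (rcons g (c, f)) e',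
    (denominator (rcons g (c, f)) * 2 ^ e' <= denominator g * 2 ^ e)%N &
    Ccoef T g kappa 0 <> 0 ->
      (denominator (rcons g (c, f)) * e' <= denominator g * e)%N].
Proof.
move=> g0 [e0 [ks [ble be low_e]]] /andP[c0 cs] edge van.
set d := denominator g; set g' := rcons g (c, f); set d' := denominator g'.
have d0 : (0 < d)%N := denominator_gt0 g.
have d'0 : (0 < d')%N := denominator_gt0 g'.
have g'0 : pos_exps g' by rewrite /pos_exps all_rcons /= c0.
have dd' : (d %| d')%N by rewrite /d' denominator_rcons dvdn_lcml.
have gE := scale_nums d'0 g0 dd'; have g'E := scale_nums d'0 g'0 (dvdnn d').
have [ptle [t1 [t2 [t12 n1 n2]]]] :
    points_le T g c kappa /\ exists t1 t2, [/\ (t1 < t2)%N,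
    Ccoef T g (kappa - c * t1%:R) t1 <> 0 & Ccoef T g (kappa - c * t2%:R) t2 <> 0].
  by move: edge; rewrite -gE; apply: edgeP.
set gn := nums d' g in gE; set W := wtop d' c kappa (Dop gn T).
have bd : in_wt d' c (fun x => x <= kappa) (Dop gn T).
  by apply/(@points_leP F T d' gn d'0 c kappa (ltW c0)); rewrite gE.
have CW t : Ccoef T g (kappa - c * t%:R) t = symb_form (hpart t W) by apply: points_line.
have degW t : Ccoef T g (kappa - c * t%:R) t <> 0 <-> exists2 m, m \in msupp W & mdeg m = t.
  rewrite CW; split=> [nz|[m mW mt] /symb_form_eq0/eqP]; last exact/negP/(hpart_neq0 mW mt).
  by apply: hpart_ex; apply/eqP => h; apply: nz; rewrite h; apply: mlin0.
have dege m : m \in msupp W -> (mdeg m <= e)%N.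
  move=> mW; have /ble h1 : Ccoef T g (kappa - c * (mdeg m)%:R) (mdeg m) <> 0.
    by apply: (degW _).2; exists m.
  by rewrite -(ler_nat rat); apply: steeper_below cs h1 (ptle _ _ be).
have [m1 m1W m1t] := (degW t1).1 n1; have [m2 m2W m2t] := (degW t2).1 n2.
have ex : exists k, has (fun m => mdeg m == k) (msupp W).
  by exists t1; apply/hasP; exists m1; rewrite ?m1t.
have [t /hasP[m0 m0W /eqP m0t] tmin] := ex_minnP ex.
have {}tmin m : m \in msupp W -> (t <= mdeg m)%N.
  by move=> mW; apply: tmin; apply/hasP; exists m.
(* The least factor by which [d] must be multiplied for [c] to become integral. Levels lie in [1/d]
   times the integers, so [c d] times a difference of ordinates on the edge is an integer and [r]
   divides this difference. *)
pose r := `|denq (c * d%:R)|%N.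
have r0 : (0 < r)%N by rewrite absz_gt0 denq_neq0.
have cd0 : 0 <= c * d%:R := mulr_ge0 (ltW c0) (ler0n _ d).
have degr m : m \in msupp W -> (r %| mdeg m - t)%N.
  move=> mW; rewrite -denq_dvd_nat //.
  have h (k : 'X_{1..2}) : k \in msupp W -> (kappa - c * (mdeg k)%:R) * d%:R \is a Num.nat.
    by move=> kW; apply: (@Ccoef_level_int g _ (mdeg k) g0); apply: (degW _).2; exists k.
  have hm := h m mW; have ht := h m0 m0W; rewrite m0t in ht.
  rewrite natrEint mulr_ge0 ?ler0n // andbT natrB ?tmin //.
  rewrite (level_gap _ _ _ _ kappa).
  by rewrite rpredB // rpred_nat_num.
have d'r : (d' <= d * r)%N.
  apply: dvdn_leq; first by rewrite muln_gt0 d0.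
  rewrite /d' denominator_rcons dvdn_lcm dvdn_mulr //= -denq_dvd_nat ?ltW //.
  by rewrite natrM mulrA denq_dvd_nat.
pose x := ((e - t) %/ r)%N.
have tx : (t + r * x <= e)%N.
  by rewrite mulnC -leq_subRL ?leq_trunc_div // -m0t dege.
have degx m : m \in msupp W -> exists2 i, (i <= x)%N & mdeg m = (t + r * i)%N.
  move=> mW; have /dvdnP[i ei] := degr m mW; exists i.
    by rewrite /x leq_divRL // -ei leq_sub2r // dege.
  by rewrite mulnC -ei subnKC ?tmin.
have x0 : (0 < x)%N.
  (* The edge contains two distinct ordinates, which differ by at least [r]. *)
  rewrite /x divn_gt0 //; apply: leq_trans (_ : t2 - t <= _)%N; last first.
    by rewrite leq_sub2r // -m2t dege.
  apply: dvdn_leq; last by rewrite -m2t degr.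
  by rewrite subn_gt0 (leq_ltn_trans _ t12) // -m1t tmin.
have W0 : W != 0 by rewrite -msupp_eq0; case: (msupp W) m0W.
have cg' : (c, f) \in g' by rewrite mem_rcons mem_head.
have /truncnK cK := exps_nat g'0 cg'.
have cE : c = (Num.truncn (c * d'%:R))%:R / d'%:R.
  by rewrite cK mulfK // pnatr_eq0 -lt0n.
have C0 : (0 < Num.truncn (c * d'%:R))%N.
  by rewrite lt0n; apply: contraTneq c0 => h; rewrite cE h mul0r ltxx.
have [bd' top] := @wtop_Dop_rcons F d' _ c f d'0 C0 cE gn T kappa bd.
have gn'E : scale_exps d' (rcons gn (Num.truncn (c * d'%:R), f)) = g'.
  by rewrite -g'E /nums /g' map_rcons.
have sumE : edge_sum T g c kappa = symb_form W.
  by have := edge_sumE d'0 c0 bd; rewrite gE.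
have fW : eval_grad f W = 0 by apply/vanishes_symb_form; rewrite -sumE.
have [|||e' le' lowe'] := lower_end_intro d'0 c0 _ bd' _ _.
- by rewrite gn'E last_slope_rcons.
- by rewrite top; apply: contraNneq W0 => /tshift_eq0/eqP.
- by rewrite top; apply: low1_tshift; rewrite subst2E.
rewrite gn'E in le'; rewrite top in lowe'.
have e'x : (e' <= t + x)%N.
  (* The possible degrees other than [t] are the [x] numbers [t + r i] with [1 <= i <= x]. *)
  rewrite -[x in (t + x)%N](size_iota 1) -(size_map (fun i => t + r * i)%N).
  apply: (order_le_degrees ch0 _ _ _ lowe'); last by exists m0.
    apply/mapP => -[i]; rewrite mem_iota => /andP[i0 _] ti.
    have : (0 < r * i)%N by rewrite muln_gt0 r0.
    by rewrite -(ltn_add2l t) addn0 -ti ltnn.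
  move=> m /degx[[|i] ix ->]; first by rewrite muln0 addn0 eqxx.
  by apply/orP; right; apply: map_f; rewrite mem_iota /= add1n ltnS.
exists e'; split=> // [|nz].
  apply: leq_trans (_ : d * r * 2 ^ (t + x) <= _)%N.
    by rewrite leq_mul // leq_exp2l.
  rewrite -mulnA leq_mul2l; apply/orP; right; apply: leq_trans (pow2_step t r0 x0) _.
  by rewrite leq_exp2l.
(* The edge starts on the axis, so [d' e' <= (d r) x <= d e]. *)
have t0 : t = 0%N.
  have [k kW k0] : exists2 m, m \in msupp W & mdeg m = 0%N.
    by apply: (degW _).1; rewrite mulr0 subr0.
  by apply/eqP; rewrite -leqn0 -k0 tmin.
rewrite t0 !add0n in e'x tx; apply: leq_trans (leq_mul d'r e'x) _.
by rewrite -mulnA leq_mul2l tx orbT.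
Qed.
End Step.

(** * Continuation and the terminal step *)

Lemma seq_argmin (T : eqType) (f : T -> rat) (s : seq T) x : x \in s ->
  exists2 y, y \in s & forall z, z \in s -> f y <= f z.
Proof.
elim: s x => [//|a [|b s] IH] x _.
  by exists a => [|z]; rewrite ?mem_head // inE => /eqP ->.
have [y ys min] := IH b (mem_head _ _); have [ay|ya] := leP (f a) (f y).
  exists a => [|z]; rewrite ?mem_head // inE => /orP[/eqP -> //|/min].
  exact: le_trans.
exists y => [|z]; first by rewrite inE ys orbT.
by rewrite inE => /orP[/eqP ->|/min //]; apply: ltW.
Qed.

(** The line of slope [s] through the point of ordinate [e] and abscissa [l] meets the axis at [k],
    to the right of [j]; so the line joining that abscissa at height [o >= e] to [(j, 0)] has
    smaller slope. *)
Lemma ratio_below (j l k s e o : rat) : 0 < o -> 0 < s -> 0 < e -> e <= o ->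
  j < k -> l = k - s * e -> (j - l) / o < s.
Proof.
move=> o0 s0 e0 eo jk ->; rewrite ltr_pdivrMr //.
apply: lt_le_trans (_ : s * e <= _); last by rewrite ler_pM2l.
by move: (s * e) => x; lra.
Qed.

Section Extend.
Variables (F : diffField) (hF : diff_closed F) (ch0 : [pchar F] =i pred0) (T : ldo F).
Implicit Type g : seq (rat * F).

Definition conj_op g := Dop (nums (denominator g) g) T.
Local Notation lev g := (level (denominator g)).
Definition top_op g (j : rat) := slice (fun m => lev g m == j) (conj_op g).

(* [j] is the abscissa of the right-hand end of the polygon, and the operator *)
(* C_(j,0) has positive order. *)
Definition terminal g (j : rat) :=
  (forall m, m \in msupp (conj_op g) -> lev g m <= j) /\ (1 < msize (top_op g j))%N.

Lemma top_op_supp g m : m \in msupp (conj_op g) -> front m \in msupp (top_op g (lev g m)).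
Proof.
move=> mS; rewrite mcoeff_msupp mcoeff_slice ?eqxx // -?mcoeff_msupp //.
by apply: level_section; apply: denominator_gt0.
Qed.

Section OneSymbol.
Variable g : seq (rat * F).
Hypothesis g0 : pos_exps g.
Let N := denominator g.
Let N0 : (0 < N)%N := denominator_gt0 g.
Let gE : scale_exps N (nums N g) = g := scale_nums N0 g0 (dvdnn _).
Local Notation S := (conj_op g).

Lemma symbol_points_le c kappa : 0 <= c -> in_wt N c (fun x => x <= kappa) S ->
  points_le T g c kappa.
Proof. by move=> c0 /(points_leP T (nums N g) N0 kappa c0); rewrite gE. Qed.

Lemma symbol_edge c kappa t1 t2 : points_le T g c kappa -> (t1 < t2)%N ->
  Ccoef T g (kappa - c * t1%:R) t1 <> 0 -> Ccoef T g (kappa - c * t2%:R) t2 <> 0 ->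
  0 <= c -> is_edge (polygon T g) c kappa.
Proof.
have := @edge_intro F T N (nums N g) c kappa t1 t2; rewrite gE; exact.
Qed.

Lemma symbol_right_edge kappa t : points_le T g 0 kappa -> (0 < t)%N ->
  Ccoef T g kappa 0 <> 0 -> Ccoef T g kappa t <> 0 -> right_edge (polygon T g) kappa.
Proof.
have := @right_edge_intro F T N (nums N g) kappa t; rewrite gE; exact.
Qed.

Lemma symbol_supp j t : Ccoef T g j t <> 0 ->
  exists m, [/\ m \in msupp S, lev g m = j & (t <= ord2 m)%N].
Proof. have := @Ccoef_supp F N (nums N g) T j t; rewrite gE; exact. Qed.

Lemma symbol_bot j : Ccoef T g j 0 = op_form (top_op g j).
Proof. have := @Ccoef_bot F N (nums N g) T j; rewrite gE; exact. Qed.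

Lemma symbol_line c kappa t : 0 < c -> in_wt N c (fun x => x <= kappa) S ->
  Ccoef T g (kappa - c * t%:R) t = symb_form (hpart t (wtop N c kappa S)).
Proof. have := @Ccoef_line F T N (nums N g) c kappa t; rewrite gE; exact. Qed.

(** The leading monomial of the operator [C_(j,0)] gives a second point on the vertical line, at an
    ordinate equal to its positive order. *)
Lemma terminal_right_edge j : terminal g j -> right_edge (polygon T g) j.
Proof.
case=> top sD; set D := top_op g j in sD.
have D0 : D != 0 by rewrite -msize_poly_eq0 -lt0n (ltn_trans _ sD).
have lD := mlead_supp D0; set t := mdeg (mlead D).
have te : t.+1 = msize D by rewrite /t mlead_deg.
apply: (@symbol_right_edge _ t).
- apply: symbol_points_le => // m /top mj.
  by rewrite /wt mul0r addr0.
- by rewrite -ltnS te.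
- by rewrite symbol_bot => /op_form_eq0/eqP; apply/negP.
have := @Ccoef_top F N (nums N g) T j t; rewrite gE => E; rewrite E {E}; last first.
  move=> m mS mj.
  rewrite -ltnS te -mdeg_front; apply: msize_mdeg_lt.
  by rewrite /D -mj; apply: top_op_supp.
rewrite -(hpart_slice t (fun m => level N m == j)) => /symb_form_eq0/eqP.
exact/negP/(hpart_neq0 lD).
Qed.

(** Let [j] be the largest level. If [C_(j,0)] has positive order, the terminal step is available.
    Otherwise it is multiplication by a non-zero function, and turning a line about [(j, 0)] until
    it meets a monomial of positive order gives an edge that starts on the axis. *)
Theorem extend e : 0 < last_slope g -> lower_end T g e ->
  (exists j, terminal g j) \/
  exists c kappa f, [/\ 0 < c < last_slope g, is_edge (polygon T g) c kappa,
    vanishes_at_phi (edge_sum T g c kappa) f & Ccoef T g kappa 0 <> 0].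
Proof.
set s := last_slope g => s0 [e0 [ks [ble be low_e]]].
have [me [meS mel meo]] := symbol_supp be.
have [mj mjS max] := seq_argmin (fun m => - lev g m) meS.
set j := lev g mj; have {}max m : m \in msupp S -> lev g m <= j.
  by move/max; rewrite lerN2.
have [sD|sD] := ltnP 1 (msize (top_op g j)); first by left; exists j.
right; have D0 : Ccoef T g j 0 <> 0.
  rewrite symbol_bot => /op_form_eq0/eqP; apply/negP; rewrite -msupp_eq0.
  by have := top_op_supp mjS; rewrite -/j; case: (msupp _).
have lt m : m \in msupp S -> (0 < ord2 m)%N -> lev g m < j.
  move=> mS m0; rewrite lt_neqAle max // andbT; apply/eqP => mj'.
  have := msize_mdeg_lt (top_op_supp mS); rewrite mj' mdeg_front.
  by move/leq_trans => /(_ _ sD); rewrite ltnS leqn0 eqn0Ngt m0.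
(* Equality is excluded since the face of slope [s] ends at the positive ordinate [e] and thus
   misses the axis. *)
have jks : j < ks.
  rewrite lt_neqAle; apply/andP; split; last first.
    by have := ble _ _ D0; rewrite mulr0 addr0.
  apply/eqP => jk; have := low_e 0%N e0; rewrite mulr0 subr0 -jk; exact: D0.
have oe : (0 < ord2 me)%N := leq_trans e0 meo.
have meF : me \in [seq m <- msupp S | (0 < ord2 m)%N] by rewrite mem_filter oe.
(* The minimum is the largest [c] for which the line through [(j, 0)] bounds all the points. *)
have [m] := seq_argmin (fun m => (j - lev g m) / (ord2 m)%:R) meF.
rewrite mem_filter => /andP[om mS] min; set c := _ / _ in min.
have om0 : 0 < (ord2 m)%:R :> rat by rewrite ltr0n.
have c0 : 0 < c by rewrite divr_gt0 // subr_gt0 lt.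
have cs : c < s.
  apply: le_lt_trans (min me meF) _.
  by apply: ratio_below jks mel; rewrite ?ltr0n ?ler_nat.
have bd : in_wt N c (fun x => x <= j) S.
  move=> k kS; rewrite /wt; have [k0|k0] := posnP (ord2 k); first by rewrite k0 mulr0 addr0 max.
  rewrite addrC -lerBrDr -ler_pdivlMr ?ltr0n //.
  by apply: min; rewrite mem_filter k0.
have mline : wt N c m = j by rewrite /wt /c divfK ?gt_eqF // addrC subrK.
set W := wtop N c j S.
have fW : front m \in msupp W.
  have -> : W = slice (fun k => wt N c k == j) S by [].
  rewrite mcoeff_msupp mcoeff_slice ?mline ?eqxx // -?mcoeff_msupp //.
  exact: wt_section.
have fm0 : (0 < mdeg (front m))%N by rewrite mdeg_front.
have [f fQ _] := solve_gradient hF ch0 fW fm0.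
have n1 : Ccoef T g (j - c * 0%:R) 0 <> 0 by rewrite mulr0 subr0.
have n2 : Ccoef T g (j - c * (ord2 m)%:R) (ord2 m) <> 0.
  rewrite (symbol_line (ord2 m) c0 bd) => /symb_form_eq0/eqP; apply/negP.
  by apply: (hpart_neq0 fW); rewrite mdeg_front.
have edge := symbol_edge (symbol_points_le (ltW c0) bd) om n1 n2 (ltW c0).
exists c, j, f; split=> //; first by rewrite c0.
have sumE : edge_sum T g c j = symb_form W by have := edge_sumE N0 c0 bd; rewrite gE.
by rewrite sumE; apply/vanishes_symb_form.
Qed.
End OneSymbol.
End Extend.

Lemma recursive_choice (X : Type) (R : seq X -> X -> Prop) : (forall p, exists x, R p x) ->
  exists h : nat -> X, forall n, R (mkseq h n) (h n).
Proof.
move=> /choice[nx nxP]; pose pref n := iter n (fun p => rcons p (nx p)) [::].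
exists (fun n => nx (pref n)) => n; rewrite (_ : mkseq _ n = pref n) //.
by elim: n => [|n IH] //; rewrite mkseqS IH.
Qed.

Lemma exponent_shift (k K N s : rat) : N != 0 -> (0 - (s - k / N)) * N = (K / N - s) * N + k - K.
Proof. by move=> N0; field. Qed.

Section Terminal.
Variables (F : diffField) (hF : diff_closed F) (ch0 : [pchar F] =i pred0) (T : ldo F).
Variables (g : seq (rat * F)) (j : rat).
Hypotheses (g0 : pos_exps g) (gj : terminal T g j).
Let N := denominator g.
Let N0 : (0 < N)%N := denominator_gt0 g.
Let gE : scale_exps N (nums N g) = g := scale_nums N0 g0 (dvdnn _).
Local Notation S := (conj_op T g).
Local Notation D := (top_op T g j).

Definition der_at (m : 'X_{1..3}) (x : F) : F := iter (m i30) dx (iter (m i31) dy x).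

Lemma der_at0 m : der_at m 0 = 0.
Proof.
rewrite /der_at; have -> : iter (m i31) dy (0 : F) = 0.
  by elim: (m i31) => //= b ->; rewrite (der0 (dy_derivation F)).
by elim: (m i30) => //= a ->; rewrite (der0 (dx_derivation F)).
Qed.

Lemma lin_op_top x : lin_op D x = \sum_(m <- msupp S | level N m == j) S@_m * der_at m x.
Proof.
by have := @mlin_slice F F^o (fun m => iter (m i20) dx (iter (m i21) dy x))
  (fun m => level N m == j) S.
Qed.

Lemma top_level : exists K, j = K%:R / N%:R.
Proof.
have [_ sD] := gj; have : D != 0 by rewrite -msize_poly_eq0 -lt0n (ltn_trans _ sD).
by case/msupp_neq0 => m /msupp_slice[m' [_ /eqP <- _]]; exists (m' i32).
Qed.

(** The coefficient of [G^(j - n/N)] is [D] applied to [h_n] plus terms in earlier [h_i], so the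
    [h_n] are found one by one. Only [h_0] must be a non-zero solution of the homogeneous equation,
    which exists because [D] has positive order. *)
Theorem terminal_solution : exists h, terminal_step T g j h /\
  is_solution T g (fseries 0 N h).
Proof.
have [top sD] := gj; have [K jE] := top_level.
have D0 : D != 0 by rewrite -msize_poly_eq0 -lt0n (ltn_trans _ sD).
have [h0 h00 Dh0] := solve_homogeneous hF ch0 sD.
have NR : N%:R != 0 :> rat by rewrite pnatr_eq0 -lt0n.
have levE m : (level N m == j) = (m i32 == K).
  by rewrite /level jE (can_eq (divfK NR)) eqr_nat.
have topK m : m \in msupp S -> (m i32 <= K)%N.
  by move/top; rewrite jE ler_pM2r ?invr_gt0 ?ltr0n // ler_nat.
(* A monomial with exponent [k < K] of [zeta] meets [h] at index [n + k - K]. The guard [K <= n + k]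
   excludes negative indices, which truncated subtraction would send to 0. *)
pose low_terms (p : nat -> F) n := \sum_(m <- msupp S | (m i32 < K)%N && (K <= n + m i32)%N)
  S@_m * der_at m (p (n + m i32 - K)%N).
have [h hP] : exists h : nat -> F, forall n,
    lin_op D (h n) = - low_terms (nth 0 (mkseq h n)) n /\ (n = 0%N -> h n = h0).
  have [p|h hP] := @recursive_choice F (fun p x =>
    lin_op D x = - low_terms (nth 0 p) (size p) /\ (size p = 0%N -> x = h0)).
    case: p => [|y p].
      exists h0; split=> //; rewrite Dh0 /low_terms big1 ?oppr0 // => m /andP[lt le].
      by rewrite add0n leqNgt lt in le.
    by have [x xP] := solve_linear hF ch0 (- low_terms (nth 0 (y :: p)) (size (y :: p))) D0;
      exists x.
  by exists h => n; have := hP n; rewrite size_mkseq.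
have solves n : lin_op D (h n) + low_terms h n = 0.
  rewrite (hP n).1 addrC; apply/eqP; rewrite subr_eq0; apply/eqP.
  apply: eq_bigr => m /andP[lt le]; rewrite nth_mkseq //.
  by rewrite ltn_subLR // addnC ltn_add2r.
have H m s : fseries 0 N h (s - level N m) =
    if (j - s) * N%:R + (m i32)%:R - K%:R \is a Num.nat then
      h (Num.truncn ((j - s) * N%:R + (m i32)%:R - K%:R)) else 0.
  by rewrite /fseries /level (exponent_shift _ K%:R) // -jE.
have sol : is_solution T g (fseries 0 N h).
  move=> s; rewrite -[X in series_act T X]gE series_actE -/S.
  (* Levels do not exceed [j], so exponents not of the form [j - n/N] receive no contribution. *)
  have [/natrP[n sn]|sn] := boolP ((j - s) * N%:R \is a Num.nat); last first.
    rewrite big_seq big1 // => m mS; rewrite -/(der_at m _) H ifF ?der_at0 ?mulr0 //.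
    apply: contraNF sn => h1; rewrite -[X in X \is a _](addrK (m i32)%:R).
    rewrite -[X in X - _](subrK K%:R) -addrA -natrB ?topK //.
    by rewrite rpredD ?natr_nat.
  rewrite -[RHS](solves n) lin_op_top /low_terms (bigID (fun m => level N m == j)) /=.
  congr (_ + _); rewrite [LHS]big_seq_cond [RHS]big_seq_cond.
    apply: eq_bigr => m /andP[mS]; rewrite levE => /eqP mK.
    by rewrite -/(der_at m _) H mK addrK sn natr_nat natrK.
  rewrite [RHS](eq_bigl (fun m => (m \in msupp S) && (m i32 != K) && (K <= n + m i32)%N)).
    rewrite [RHS]big_mkcondr; apply: congr_big => // m; first by rewrite levE.
    rewrite levE => /andP[mS _]; rewrite -/(der_at m _) H sn -natrD.
    case: leqP => [le|lt]; first by rewrite -natrB // natr_nat natrK.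
    rewrite ifF ?der_at0 ?mulr0 //; apply/negP => /natr_ge0.
    by rewrite subr_ge0 ler_nat leqNgt lt.
  by move=> m; rewrite andbA ltn_neqAle; case: (boolP (m \in _)) => //= /topK ->; rewrite andbT.
exists h; split=> //; split.
- exact: terminal_right_edge.
- by rewrite (hP 0%N).2 //; apply/eqP.
- have := @BbarE F N (nums N g) T j (h 0%N); rewrite gE => ->.
  by rewrite (hP 0%N).2.
- by move=> i; apply: sol.
Qed.
End Terminal.

(** * Branches *)

Lemma start_exists (F : diffField) (hF : diff_closed F) (ch0 : [pchar F] =i pred0) (a1 a2 : F) :
  (a1, a2) <> (0, 0) -> exists f, starts a1 a2 f.
Proof.
move=> a0; pose Q : mpoly 2 F := a1 *: 'X_i20 + a2 *: 'X_i21.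
have [m mQ m0] : exists2 m, m \in msupp Q & (0 < mdeg m)%N.
  have coef i : Q@_(U_(i)) = if i == i20 then a1 else a2.
    rewrite mcoeffD !mcoeffZ !mcoeffX !eq_mnm1.
    by move: i; apply: ord2_ind; rewrite /= ?mulr1 ?mulr0 ?addr0 ?add0r.
  have [a10|a10] := eqVneq a1 0.
    exists U_(i21)%MM; rewrite ?mdeg1 // mcoeff_msupp coef /=.
    by apply/eqP => a20; apply: a0; rewrite a10 a20.
  by exists U_(i20)%MM; rewrite ?mdeg1 // mcoeff_msupp coef.
have [f fQ fxy] := solve_gradient hF ch0 mQ m0; exists f; split.
  have E : subst2 (idfun : {rmorphism F -> F}) (dx f) (dy f) Q = eval_grad f Q := subst2E _ _ _ _.
  rewrite -[RHS]fQ -E.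
  by rewrite subst2D !subst2Z subst2X0 subst2X1.
by case=> fx fy; move: fxy; rewrite fx fy eqxx.
Qed.

Section Tree.
Variables (F : diffField) (hF : diff_closed F) (ch0 : [pchar F] =i pred0).
Variables (T : ldo F) (n : nat) (hn : has_order T n) (a1 a2 : F) (m : nat).
Hypotheses (ha : (a1, a2) <> (0, 0)) (hm : (1 <= m)%N)
  (hfac : factor_mult (a1 *: symb_x F + a2 *: symb_y F) m (symb T)).
Local Notation branch := (branch T a1 a2).

Lemma denominator1 (f : F) : denominator [:: (1, f)] = 1%N.
Proof. by rewrite /denominator big_seq1. Qed.

Lemma branch_symbol g : branch g ->
  [/\ frac_symbol g, starts a1 a2 (head (1, 0) g).2, pos_exps g & 0 < last_slope g].
Proof.
elim=> {g} [f sf|g c kappa f _ [[h1 h2 h3] sg pg lg] _ /andP[c0 cs] _].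
  by split=> //; rewrite /pos_exps /= ltr01.
rewrite last_slope_rcons; split=> //.
- case: g h1 h2 h3 cs {sg pg lg} => [|p g] /=; first by move/eqP; rewrite eq_sym oner_eq0.
  move=> h1 h2 h3 cs; split=> //=; rewrite /unzip1 map_rcons.
    by rewrite rcons_path; apply/andP; split=> //; rewrite last_map.
  by rewrite all_rcons /= c0.
- by case: g h1 sg {h2 h3 pg lg cs} => [/eqP|//]; rewrite /= eq_sym oner_eq0.
- by rewrite /pos_exps all_rcons /= c0.
Qed.

(** The invariant of all branches: [q 2^e] is at most [2^m] at the start and never increases. *)
Theorem branch_lower_end g : branch g -> exists2 e, lower_end T g e &
  (denominator g * 2 ^ e <= 2 ^ m)%N.
Proof.
elim=> {g} [f sf|g c kappa f bg [e le de] edge cs van].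
  have [e le em] := start_lower_end hn ha hm hfac sf; exists e => //.
  by rewrite denominator1 mul1n leq_exp2l.
have [_ _ g0 _] := branch_symbol bg.
have [e' [le' de' _]] := step_lower_end ch0 g0 le cs edge van.
by exists e' => //; apply: leq_trans de' de.
Qed.

Lemma branch_denominator g : branch g -> (denominator g <= 2 ^ (m - 1))%N.
Proof.
case/branch_lower_end => e [e0 _] de; rewrite -(leq_pmul2r (ltn0Sn 1)) -expnSr.
rewrite subn1 prednK //; apply: leq_trans de; rewrite leq_mul2l -[X in (X <= _)%N]expn1.
by rewrite leq_exp2l // e0 orbT.
Qed.

(* [M] clears the denominators of all slopes of all branches, so that the       *)
(* decreasing slopes of a branch become decreasing natural numbers.           *)
Let M : rat := ((2 ^ m)`!)%:R.

Lemma last_slope_nat g : branch g -> last_slope g * M \is a Num.nat.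
Proof.
move=> bg; have [[h1 _ _] _ g0 s0] := branch_symbol bg.
have dM : (denominator g %| (2 ^ m)`!)%N.
  apply: dvdn_fact; rewrite denominator_gt0 (leq_trans (branch_denominator bg)) //.
  by rewrite leq_exp2l // leq_subr.
have lg : last (1, 0) g \in g.
  by case: g h1 {bg g0 s0 dM} => [/eqP|p g _]; rewrite /= ?mem_last // eq_sym oner_eq0.
have := exps_nat g0 lg; rewrite -/(last_slope g) !denq_dvd_nat ?(ltW s0) //.
by move/dvdn_trans; apply.
Qed.

Lemma last_slope_decr g p : branch g -> branch (rcons g p) -> p.1 < last_slope g ->
  (Num.truncn (p.1 * M) < Num.truncn (last_slope g * M))%N.
Proof.
move=> bg bg' lt; rewrite -(ltr_nat rat) !truncnK ?last_slope_nat //.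
  by rewrite ltr_pM2r // ltr0n fact_gt0.
by rewrite -[p.1](last_slope_rcons g) last_slope_nat.
Qed.

Theorem continue g e : branch g -> lower_end T g e -> exists g' e' j,
  [/\ branch (g ++ g'), lower_end T (g ++ g') e', terminal T (g ++ g') j &
      (denominator (g ++ g') * e' <= denominator g * e)%N].
Proof.
have [k] := ubnP (Num.truncn (last_slope g * M)); elim: k g e => // k IH g e gk bg le.
have [_ _ g0 s0] := branch_symbol bg.
have [[j tj]|[c [kappa [f [cs edge van C0]]]]] := extend hF ch0 g0 s0 le.
  by exists [::], e, j; rewrite cats0.
have [e1 [le1 _ /(_ C0) de1]] := step_lower_end ch0 g0 le cs edge van.
have bg1 : branch (rcons g (c, f)) := BranchStep bg edge cs van.
have lt := last_slope_decr bg bg1 (andP cs).2.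
have [||//|g' [e' [j [bg' le' tj de']]]] := IH (rcons g (c, f)) e1.
- by rewrite last_slope_rcons; apply: leq_trans lt _.
- exact: bg1.
exists ((c, f) :: g'), e', j; rewrite -cat_rcons; split=> //.
exact: leq_trans de' de1.
Qed.

Lemma branch_rcons_slope g p : g != [::] -> branch (rcons g p) -> p.1 < last_slope g.
Proof.
move=> gn; move E : (rcons g p) => h bh; case: bh E => [f _|g1 c kappa f _ _ /andP[_ cs] _] E.
  by case: g gn E => // q [|? ?].
by have [-> ->] := rcons_inj E.
Qed.

Theorem no_infinite_branch : ~ exists b : nat -> rat * F,
  forall k, branch (mkseq b k.+1).
Proof.
case=> b bb; have lastb k : last_slope (mkseq b k.+1) = (b k).1.
  by rewrite mkseqS last_slope_rcons.
have dec k : (Num.truncn ((b k).1 * M) + k <= Num.truncn ((b 0%N).1 * M))%N.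
  elim: k => [|k IH]; first by rewrite addn0.
  apply: leq_trans IH; rewrite addnS -addSn leq_add2r -(lastb k).
  have bk := bb k.+1; rewrite mkseqS in bk.
  apply: last_slope_decr (bb k) (bk) _; apply: branch_rcons_slope bk.
  by rewrite -size_eq0 size_mkseq.
by have := dec (Num.truncn ((b 0%N).1 * M)).+1; rewrite addnS ltnNge leq_addl.
Qed.
End Tree.

Theorem theorem2p5 (F : diffField) (hchar : [pchar F] =i pred0)
    (hF : diff_closed F) (T : ldo F) (n : nat) (hn : has_order T n)
    (a1 a2 : F) (ha : (a1, a2) <> (0, 0)) (m : nat) (hm : (1 <= m)%N)
    (hfac : factor_mult (a1 *: symb_x F + a2 *: symb_y F) m (symb T)) :
  (exists (g : seq (rat * F)) (s0 : rat) (h : nat -> F),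
     [/\ frac_symbol g /\ starts a1 a2 (head (1, 0) g).2,
         s0 * (denominator g)%:R \is a Num.int,
         exists i, h i <> 0,
         is_solution T g (fseries s0 (denominator g) h) &
         (denominator g <= m)%N])
  /\
  [/\ forall g, branch T a1 a2 g ->
        exists (g' : seq (rat * F)) (j5 : rat) (h : nat -> F),
          [/\ branch T a1 a2 (g ++ g'),
              terminal_step T (g ++ g') j5 h &
              is_solution T (g ++ g') (fseries 0 (denominator (g ++ g')) h)],
      ~ (exists b : nat -> rat * F,
           forall k : nat, branch T a1 a2 (mkseq b k.+1)) &
      forall g j5 h, branch T a1 a2 g -> terminal_step T g j5 h ->
        (denominator g <= 2 ^ (m - 1))%N].
Proof.
split; last split.
- have [f sf] := start_exists hF hchar ha.
  have [e le em] := start_lower_end hn ha hm hfac sf.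
  have [g' [e' [j [bg [e'0 _] tj de]]]] := continue hF hchar hn ha hm hfac (BranchStart T sf) le.
  have [fg sg g0 _] := branch_symbol bg.
  have [h [[_ h0 _ _] sol]] := terminal_solution hF hchar g0 tj.
  exists ([:: (1, f)] ++ g'), 0, h; split=> //.
  + by rewrite mul0r rpred0.
  + by exists 0%N.
  (* With [e'] positive, [q <= q e' <= 1 * e <= m]; the denominator of the initial symbol is 1. *)
  apply: leq_trans em; rewrite -[e]mul1n -(denominator1 f); apply: leq_trans de.
  exact: leq_pmulr.
- move=> g bg; have [e le _] := branch_lower_end hchar hn ha hm hfac bg.
  have [g' [e' [j [bg' _ tj _]]]] := continue hF hchar hn ha hm hfac bg le.
  have [_ _ g0 _] := branch_symbol bg'.
  have [h [th sol]] := terminal_solution hF hchar g0 tj.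
  by exists g', j, h.
- exact (no_infinite_branch hchar hn ha hm hfac).
- move=> g j5 h bg _; exact (branch_denominator hchar hn ha hm hfac bg).
Qed.
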